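(* Let $\Omega\subset\mathbb{R}^n$ be a generalized polytope and $0\le k\le n$. Then $$\|\nabla\omega\|^2=\|d\omega\|^2+\|\delta\omega\|^2\qquad\text{for every }\omega\in C_T^1(\overline\Omega;\Lambda^k)\cup C_N^1(\overline\Omega;\Lambda^k).$$
   Context: Polytopes are not assumed convex: a bounded open polytope is a bounded open set, equal to the interior of its closure, whose boundary is contained in a finite union of hyperplanes. $\Omega$ is a generalized polytope if there exist bounded open polytopes $\Omega_0,\Omega_1,\dots,\Omega_M$ such that for all $i,j\in\{1,\dots,M\}$ with $i\ne j$: $\overline\Omega_i\subset\Omega_0$, $\overline\Omega_i\cap\overline\Omega_j=\emptyset$, and $\Omega=\Omega_0\setminus\bigcup_{i=1}^M\overline\Omega_i$. $\nu$ is the outward unit normal, defined a.e. on $\partial\Omega$. $C_T^1(\overline\Omega;\Lambda^k)$ (resp. $C_N^1(\overline\Omega;\Lambda^k)$) is the set of $k$-forms $\omega\in C^1(\overline\Omega;\Lambda^k)$ with $\nu\wedge\omega=0$ (resp. $\nu\lrcorner\omega=0$) on $\partial\Omega$ (wherever $\nu$ is defined). Norms are $L^2(\Omega)$-norms; components $\omega^{i_1\cdots i_k}$ are antisymmetric, $|\omega|^2=\sum_{i_1<\cdots<i_k}(\omega^{i_1\cdots i_k})^2$, $|\nabla\omega|^2$ sums the squares of all first partial derivatives of the components with $i_1<\cdots<i_k$, $(\nu\lrcorner\omega)^{i_1\cdots i_{k-1}}=\sum_j\nu^j\omega^{ji_1\cdots i_{k-1}}$, $d$ is the exterior derivative, $(\delta\omega)^{i_1\cdots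 i_{k-1}}=\sum_j\partial_{x_j}\omega^{ji_1\cdots i_{k-1}}$ ($\delta\omega=0$ and $\nu\lrcorner\omega=0$ if $k=0$). *)

(* Defs.v *)
From HB Require Import structures.
From mathcomp Require Import all_boot all_order perm all_algebra.
From mathcomp Require Import all_classical all_reals all_analysis.
Set Implicit Arguments.
Unset Strict Implicit.
Unset Printing Implicit Defensive.
Import Order.TTheory GRing.Theory Num.Theory.
Import numFieldNormedType.Exports.
Local Open Scope classical_set_scope.
Local Open Scope ring_scope.

(** * Lebesgue measure on R^n

    'rV[R]_n carries the product of n copies of the Borel sigma-algebra of R,
    and [lebesgue_rV n] is the n-fold product of [lebesgue_measure]. *)

Definition rV_display : measure_display.
Proof. exact: default_measure_display. Qed.

Section measurable_rV.
Context {R : realType} (n : nat).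

Definition rV_coord (i : 'I_n) (v : 'rV[R]_n) : measurableTypeR R := v 0 i.

HB.instance Definition _ := @isMeasurable.Build rV_display 'rV[R]_n
  (g_sigma_preimage rV_coord) (@sigma_algebra0 _ _ _)
  (@sigma_algebraC _ _) (@sigma_algebra_bigcup _ _ _).

End measurable_rV.

Section measurable_rV_lemmas.
Context {R : realType}.

Lemma measurable_rV_coord n (i : 'I_n) :
  measurable_fun [set: 'rV[R]_n] (rV_coord i).
Proof.
move=> _ Y mY; rewrite setTI; apply: sub_sigma_algebra => /=.
rewrite -bigcup_seq/=; exists i => /=; first by rewrite mem_index_enum.
by exists Y => //; rewrite setTI.
Qed.

Lemma measurable_fun_rV d (T : measurableType d) n (f : T -> 'rV[R]_n) :
  (forall i, measurable_fun setT (rV_coord i \o f)) -> measurable_fun setT f.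
Proof.
move=> mf; apply: (@measurability _ _ _ _ setT f
  (\big[setU/set0]_(i < n) preimage_set_system setT (@rV_coord R n i)
     measurable)) => //.
move=> _ [A + <-]; rewrite -bigcup_seq => -[i _ [B mB <-]].
rewrite !setTI -comp_preimage -[X in measurable X]setTI.
exact: (mf i measurableT _ mB).
Qed.

End measurable_rV_lemmas.

Section lebesgue_rV.
Context {R : realType}.

Definition rV_cons n (p : measurableTypeR R * 'rV[R]_n) : 'rV[R]_n.+1 :=
  \row_(i < n.+1) if unlift ord0 i is Some j then p.2 0 j else p.1.

Definition rV_uncons n (v : 'rV[R]_n.+1) : measurableTypeR R * 'rV[R]_n :=
  (v 0 ord0, \row_(j < n) v 0 (lift ord0 j)).

Lemma rV_consK n : cancel (@rV_cons n) (@rV_uncons n).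
Proof.
move=> [x v]; congr pair; first by rewrite mxE unlift_none.
by apply/rowP => j; rewrite !mxE liftK.
Qed.

Lemma rV_unconsK n : cancel (@rV_uncons n) (@rV_cons n).
Proof.
by move=> v; apply/rowP => i; rewrite mxE; case: unliftP => [j|] ->; rewrite ?mxE.
Qed.

Lemma measurable_rV_cons n : measurable_fun setT (@rV_cons n).
Proof.
apply: measurable_fun_rV => i; case: (unliftP ord0 i) => [j ->|->].
- rewrite (_ : _ \o _ = rV_coord j \o snd).
    by apply: measurableT_comp => //; exact: measurable_rV_coord.
  by apply/funext => p; rewrite /= /rV_coord mxE liftK.
- rewrite (_ : _ \o _ = fst)//.
  by apply/funext => p; rewrite /= /rV_coord mxE unlift_none.
Qed.

Lemma measurable_rV_uncons n : measurable_fun setT (@rV_uncons n).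
Proof.
apply/measurable_fun_pairP; split; first exact: measurable_rV_coord.
apply: measurable_fun_rV => j.
rewrite (_ : _ \o _ = rV_coord (lift ord0 j)); first exact: measurable_rV_coord.
by apply/funext => v; rewrite /= /rV_coord mxE.
Qed.

Section step.
Variables (n : nat) (m : {sigma_finite_measure set 'rV[R]_n -> \bar R}).

Definition lebesgue_rV_step :=
  pushforward (lebesgue_measure \x m)%E (@rV_cons n).

Let step0 : lebesgue_rV_step set0 = 0%E.
Proof. by rewrite /lebesgue_rV_step /pushforward preimage_set0 measure0. Qed.

Let step_ge0 A : (0 <= lebesgue_rV_step A)%E.
Proof. by rewrite /lebesgue_rV_step /pushforward measure_ge0. Qed.

Let step_sigma_additive : semi_sigma_additive lebesgue_rV_step.
Proof.
move=> F mF tF mUF; rewrite /lebesgue_rV_step /pushforward preimage_bigcup.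
have mpre A : measurable A -> measurable (@rV_cons n @^-1` A).
  by move=> mA; rewrite -[X in measurable X]setTI; exact: measurable_rV_cons.
apply: measure_semi_sigma_additive => [i||]; first exact: mpre.
- apply/trivIsetP => i j _ _ ij; rewrite -preimage_setI.
  by move/trivIsetP : tF => /(_ _ _ _ _ ij) ->//; rewrite preimage_set0.
- by rewrite -preimage_bigcup; exact: mpre.
Qed.

HB.instance Definition _ := isMeasure.Build _ _ _ lebesgue_rV_step
  step0 step_ge0 step_sigma_additive.

Let step_sigma_finite : sigma_finite setT lebesgue_rV_step.
Proof.
have /sigma_finiteP[F [TF ndF Foo]] := sigma_finiteT (@lebesgue_measure R).
have /sigma_finiteP[G [TG ndG Goo]] := sigma_finiteT m.
exists (fun k => @rV_uncons n @^-1` (F k `*` G k)).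
  rewrite -preimage_bigcup (_ : \bigcup_i _ = setT) ?preimage_setT//.
  rewrite -subTset => -[x v] _.
  have [k _ Fkx] : (\bigcup_i F i) x by rewrite -TF.
  have [l _ Glv] : (\bigcup_i G i) v by rewrite -TG.
  exists (maxn k l) => //; split.
  - by move: x Fkx; exact/subsetPset/ndF/leq_maxl.
  - by move: v Glv; exact/subsetPset/ndG/leq_maxr.
move=> k; have [mFk Fk] := Foo k; have [mGk Gk] := Goo k; split.
  rewrite -[X in measurable X]setTI; apply: measurable_rV_uncons => //.
  exact: measurableX.
rewrite /lebesgue_rV_step /pushforward -comp_preimage (_ : _ \o _ = id).
  by rewrite preimage_id product_measure1E// lte_mul_pinfty// ge0_fin_numE.
by apply/funext => p; rewrite /= rV_consK.
Qed.

HB.instance Definition _ := Measure_isSigmaFinite.Build _ _ _ lebesgue_rV_step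
  step_sigma_finite.

End step.

Fixpoint lebesgue_rV n : {sigma_finite_measure set 'rV[R]_n -> \bar R} :=
  match n with
  | 0 => \d_(0 : 'rV[R]_0)
  | n'.+1 => lebesgue_rV_step (lebesgue_rV n')
  end.

Lemma lebesgue_rV_box n (A : 'I_n -> set (measurableTypeR R)) :
  (forall i, measurable (A i)) ->
  (lebesgue_rV n [set v : 'rV[R]_n | forall i, A i (v 0%R i)] =
   \prod_(i < n) lebesgue_measure (A i))%E.
Proof.
elim: n A => [|n IHn] A mA.
  by rewrite big_ord0 /= diracE mem_set// => -[].
rewrite big_ord_recl -IHn//= /lebesgue_rV_step /pushforward -product_measure1E//; last first.
  rewrite (_ : mkset _ = \bigcap_(i in [set: 'I_n]) (rV_coord i @^-1` A (lift ord0 i))).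
    apply: fin_bigcap_measurable => // i _.
    by rewrite -[X in measurable X]setTI; exact: measurable_rV_coord.
  by apply/seteqP; split => v /= h i; [move=> _|]; exact: h.
congr product_measure1; apply/seteqP; split => -[x v] /=.
  move=> h; split => [|j].
    by have := h ord0; rewrite mxE unlift_none.
  by have := h (lift ord0 j); rewrite mxE liftK.
move=> [h0 h] i; rewrite mxE; case: unliftP => [j|] ->//.
Qed.

End lebesgue_rV.

(** * Generalized polytopes *)

Section polytopes.
Context {R : realType} {n : nat}.
Implicit Types (x y nu : 'rV[R]_n) (P Omega : set 'rV[R]_n).

Definition dotv x y : R := \sum_(i < n) x 0 i * y 0 i.

Definition boundary P : set 'rV[R]_n := closure P `\` P^°.

Definition hyperplane (h : 'rV[R]_n * R) : set 'rV[R]_n :=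
  [set x | dotv h.1 x = h.2].

Definition open_polytope P : Prop :=
  [/\ bounded_set P, open P, (closure P)^° = P &
    exists2 hs : seq ('rV[R]_n * R), {in hs, forall h, h.1 != 0} &
      boundary P `<=` \bigcup_(h in [set` hs]) hyperplane h].

Definition generalized_polytope Omega : Prop :=
  exists (P0 : set 'rV[R]_n) (M : nat) (P : 'I_M -> set 'rV[R]_n),
    [/\ open_polytope P0 /\ (forall i, open_polytope (P i)),
        forall i, closure (P i) `<=` P0,
        forall i j, i != j -> closure (P i) `&` closure (P j) = set0 &
        Omega = P0 `\` \bigcup_i closure (P i)].

(* [nu] is the outward unit normal to [Omega] at [x]: near the boundary point
   [x], [Omega] is an open half-space with normal [nu]. For a set whose boundary
   lies in finitely many hyperplanes and which is the interior of its closure,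
   this covers every boundary point lying on only one of the hyperplanes, hence
   almost all of them, and every boundary point where there is a tangent
   hyperplane. *)
Definition outward_unit_normal Omega x nu : Prop :=
  [/\ boundary Omega x, dotv nu nu = 1 &
      \forall y \near x, Omega y <-> dotv nu (y - x) < 0].

End polytopes.

(** * Differential forms *)

(* Elements of Lambda^k are represented by all their components
   w^{i_1 ... i_k}, required to be antisymmetric by [antisym_components]. *)
Definition components (R : realType) (n k : nat) := k.-tuple 'I_n -> R.

Section forms.
Context {R : realType} {n : nat}.
Implicit Types (k : nat) (v x : 'rV[R]_n).

Definition antisym_components k (w : components R n k) : Prop :=
  forall (s : 'S_k) (I : k.-tuple 'I_n),
    w [tuple tnth I (s a) | a < k] = (-1) ^+ s * w I.

Definition increasing k (I : k.-tuple 'I_n) : bool :=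
  sorted (fun i j : 'I_n => (i < j)%N) I.

Definition sqnorm k (w : components R n k) : R :=
  \sum_(I : k.-tuple 'I_n | increasing I) w I ^+ 2.

Definition del_index k (a : 'I_k.+1) (I : k.+1.-tuple 'I_n) : k.-tuple 'I_n :=
  [tuple tnth I (lift a b) | b < k].

Definition wedge1 v k (w : components R n k) : components R n k.+1 :=
  fun I => \sum_(a < k.+1) (-1) ^+ a * v 0 (tnth I a) * w (del_index a I).

(* For k = 0 the contraction is 0, in the dummy degree 0.-1 = 0. *)
Definition contract v k : components R n k -> components R n k.-1 :=
  match k with
  | 0 => fun _ _ => 0
  | k'.+1 => fun w I => \sum_(j < n) v 0 j * w [tuple of j :: I]
  end.

Definition partial (j : 'I_n) (f : 'rV[R]_n -> R) x : R :=
  'D_(delta_mx 0 j : 'rV[R]_n) f x.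

Definition ext_deriv k (w : 'rV[R]_n -> components R n k) x :
    components R n k.+1 :=
  fun I => \sum_(a < k.+1)
    (-1) ^+ a * partial (tnth I a) (fun y => w y (del_index a I)) x.

Definition codiff k : ('rV[R]_n -> components R n k) ->
    'rV[R]_n -> components R n k.-1 :=
  match k with
  | 0 => fun _ _ _ => 0
  | k'.+1 => fun w x I =>
      \sum_(j < n) partial j (fun y => w y [tuple of j :: I]) x
  end.

Definition sqnorm_grad k (w : 'rV[R]_n -> components R n k) x : R :=
  \sum_(I : k.-tuple 'I_n | increasing I)
    \sum_(j < n) partial j (fun y => w y I) x ^+ 2.

Variable Omega : set 'rV[R]_n.

(* C^1 in Omega, and the function and its first partial derivatives extend
   continuously to the closure; the extension of [f] is [f] itself. *)
Definition C1_closure (f : 'rV[R]_n -> R) : Prop :=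
  [/\ forall x, Omega x -> differentiable f x,
      {within closure Omega, continuous f} &
      forall j : 'I_n, exists2 g : 'rV[R]_n -> R,
        {within closure Omega, continuous g} &
        forall x, Omega x -> g x = partial j f x].

(* Only the values of a form on the closure of Omega matter. *)
Definition C1_form k (w : 'rV[R]_n -> components R n k) : Prop :=
  (forall x, closure Omega x -> antisym_components (w x)) /\
  (forall I, C1_closure (fun x => w x I)).

Definition C1_T k : set ('rV[R]_n -> components R n k) :=
  [set w | C1_form w /\
    forall x nu, outward_unit_normal Omega x nu ->
      forall I, wedge1 nu (w x) I = 0].

Definition C1_N k : set ('rV[R]_n -> components R n k) :=
  [set w | C1_form w /\
    forall x nu, outward_unit_normal Omega x nu ->
      forall I, contract nu (w x) I = 0].

(* The square of the L^2(Omega)-norm of a field whose pointwise squared norm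
   is [f]. *)
Definition sqL2 (f : 'rV[R]_n -> R) : \bar R :=
  \int[lebesgue_rV n]_(x in Omega) (f x)%:E.

End forms.

Arguments C1_T {R n} Omega k.
Arguments C1_N {R n} Omega k.

(* Main.v *)
Require Import Defs.
From mathcomp Require Import all_boot all_order perm all_algebra.
From mathcomp Require Import all_classical all_reals all_analysis.
From mathcomp Require Import measurable_realfun ring lra zify.
Import Order.TTheory GRing.Theory Num.Theory.
Import numFieldNormedType.Exports.
Set Implicit Arguments.
Unset Strict Implicit.
Unset Printing Implicit Defensive.
Local Open Scope classical_set_scope.
Local Open Scope ring_scope.

(** The defect |d w|^2 + |delta w|^2 - |grad w|^2 is, at each point, a linear
combination of null Lagrangians
  {f, g}_(p, q) = D_p f * D_q g - D_q f * D_p g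
in which f and g are components of w.  If w is C^2 each of them is a divergence,
and it remains to see that the boundary terms cancel on flat pieces of the
boundary and that the lower dimensional skeleton does not contribute.  Here w is
only C^1, and the boundary need not be Lipschitz near the skeleton, so the
argument is arranged as follows.

The defect has two expressions as a sum of null Lagrangians
(gaffney_identity_dvg and gaffney_identity_ext).  Both are sums of terms
  sum_(a, b) {u_a, u_b}_(e_a, e_b)
with coordinate directions e_a, and the boundary condition says exactly that
sum_a nu_a u_a = 0: for nu _| w = 0 in the first expression, where the u_a are
the w^(aJ), and for nu /\ w = 0 in the second one, where they are the signed
components of w obtained by deleting one entry of a multi-index.

The analytic core is that {f, g} has integral zero over a bounded open set as
soon as f * g = 0 on the boundary (Rintegral_bracket_product0).  For compactly
supported C^1 functions this follows from the translation invariance of Lebesgue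
measure alone: one derivative of g is replaced with a difference quotient, which
is moved onto f by a translation (Rintegral_null_lagrangian).  In general f and
g are cut off by functions of f * g.

Multiply u_a by a cutoff phi that vanishes on all of the boundary except a part
of one hyperplane with unit normal nu.  Split each e_a into its tangential part
and a multiple of nu.  Terms with two tangential directions are insensitive to
the distance to the hyperplane, which may thus be used as a cutoff, and in the
others the combination sum_a nu_a u_a appears, which vanishes on the boundary
(Rintegral_brackets_flat).  Finally 1 is a sum of such cutoffs and of an error
that lives in the slabs of width 1/m about two distinct hyperplanes.  The
intersection of two slabs has measure O(1/m^2), by packing disjoint translates
of it in a cube (slabs_measure), whereas the gradient of the error is O(m), so
that the error disappears in the limit (Rintegral_brackets_polytope). *)

(** * Translation invariance of Lebesgue measure *)

Section translation_1d.
Context {R : realType}.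

Lemma measurable_translation1 (t : R) :
  measurable_fun setT (fun x : measurableTypeR R => x + t : measurableTypeR R).
Proof. exact: measurable_funD. Qed.

Lemma lebesgue_measure_translation (t : R) (A : set (measurableTypeR R)) :
  measurable A ->
  lebesgue_measure ((fun x => x + t) @^-1` A) = lebesgue_measure A.
Proof.
move=> mA; symmetry.
pose m := measure_function_pushforward__canonical__measure_function_Measure
  (@lebesgue_measure R) (measurable_translation1 t).
apply: (@lebesgue_measure_unique R m) => // X /ocitvP [->|[[a b] /= ab ->]].
  by rewrite !measure0.
rewrite /m /= /pushforward (_ : _ @^-1` _ = `](a - t), (b - t)]%classic); last first.
  by apply/seteqP; split => x /=; rewrite !in_itv /= ltrBlDr lerBrDr.
by rewrite !lebesgue_measure_itv /= !lte_fin ltrD2r -!EFinD; case: ifP => // _;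
  congr EFin; ring.
Qed.

End translation_1d.

Section translation.
Context {R : realType}.

Lemma measurable_translation n (v : 'rV[R]_n) :
  measurable_fun setT (fun x : 'rV[R]_n => x + v).
Proof.
apply: measurable_fun_rV => i.
rewrite (_ : _ \o _ = (fun y : measurableTypeR R => y + v 0 i) \o rV_coord i).
  by apply: measurableT_comp; [exact: measurable_translation1|exact: measurable_rV_coord].
by apply/funext => x; rewrite /= /rV_coord mxE.
Qed.

(** Slicing along the first coordinate reduces the claim to the invariance of the
two factors of the product measure. *)
Lemma lebesgue_rV_translation n (v : 'rV[R]_n) (A : set 'rV[R]_n) :
  measurable A ->
  lebesgue_rV n ((fun x => x + v) @^-1` A) = lebesgue_rV n A.
Proof.
elim: n v A => [|n IHn] v A mA.
  rewrite (_ : _ @^-1` A = A)//; apply/funext => x /=.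
  by congr A; apply/rowP => -[].
rewrite /= /lebesgue_rV_step /pushforward.
pose t := v 0 ord0; pose v' : 'rV[R]_n := \row_(j < n) v 0 (lift ord0 j).
set B := (@rV_cons R n) @^-1` A.
have mB : measurable B.
  by rewrite -[X in measurable X]setTI; exact: measurable_rV_cons.
have -> : (@rV_cons R n) @^-1` ((fun x => x + v) @^-1` A) =
    (fun p : measurableTypeR R * 'rV[R]_n => (p.1 + t, p.2 + v')) @^-1` B.
  apply/seteqP; split => -[x y]; rewrite /B /= => H; congr A : H;
  apply/rowP => i; rewrite !mxE; case: unliftP => [j|] -> //; rewrite !mxE//.
rewrite /product_measure1.
pose f := fun y => lebesgue_rV n (xsection B y).
have mf : measurable_fun setT f by exact: measurable_fun_xsection.
transitivity (\int[lebesgue_measure]_y f (y + t)%R)%E.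
  apply: eq_integral => x _ /=.
  rewrite /f (_ : xsection _ x =
    (fun y => y + v') @^-1` (xsection B (x + t)%R)).
    by apply: IHn; exact: measurable_xsection.
  by apply/seteqP; split => y /=; rewrite /xsection /= !inE.
have /= := @ge0_integral_pushforward _ _ _ _ R _ (measurable_translation1 t)
  lebesgue_measure setT f measurableT mf (fun _ _ => measure_ge0 _ _).
rewrite preimage_setT => <-.
pose m := measure_function_pushforward__canonical__measure_function_Measure
  (@lebesgue_measure R) (measurable_translation1 t).
rewrite -/f.
apply: (@eq_measure_integral _ (measurableTypeR R) R setT lebesgue_measure m f).
move=> C mC _.
exact: lebesgue_measure_translation.
Qed.

End translation.

(** * Open sets and continuous functions are measurable *)

Section row_vectors.
Context {R : realType} {n : nat}.
Implicit Types (x y v : 'rV[R]_n) (U D : set 'rV[R]_n).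

Lemma le_coord_norm x i : `|x 0 i| <= `|x|.
Proof.
rewrite [leRHS]/Num.Def.normr /= mx_normrE; apply/bigmax_geP; right => /=.
by exists (0, i).
Qed.

Lemma norm_lt_coord x e : 0 < e -> (forall i, `|x 0 i| < e) -> `|x| < e.
Proof.
move=> e0 h; rewrite [ltLHS]/Num.Def.normr /= mx_normrE; apply/bigmax_ltP; split => //.
by move=> [i j] _ /=; rewrite (ord1 i).
Qed.

(** Cubes with rational centres and radii 1/(k+1) form a countable base. *)
Lemma open_measurable_rV U : open U -> measurable U.
Proof.
move=> oU.
pose box (c : 'rV[rat]_n * nat) : set 'rV[R]_n :=
  [set x | forall i, `|x 0 i - ratr (c.1 0 i)| < c.2.+1%:R^-1].
pose F c := if `[< box c `<=` U >] then box c else set0.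
have -> : U = \bigcup_c F c.
  apply/seteqP; split => [x Ux|x [c _]]; last first.
    by rewrite /F; case: asboolP => // h; exact: h.
  move/open_subball : oU => /(_ _ Ux) [e /= e0 he].
  have [k hk] : exists k : nat, 2 * k.+1%:R^-1 < (e / 2) :> R.
    have [k hk] := @ltr_add_invr R 0 (e / 4) ltac:(lra).
    by exists k; move: hk; rewrite add0r; set z := _^-1; lra.
  have z0 : 0 < k.+1%:R^-1 :> R by rewrite invr_gt0.
  have hr : forall i, exists q : rat, `|x 0 i - ratr q| < k.+1%:R^-1.
    move=> i; move: z0; set z := _^-1 => z0.
    have [q /[!in_itv]/= /andP[q1 q2]] :=
      @rat_in_itvoo R (x 0 i - z) (x 0 i + z) ltac:(lra).
    by exists q; rewrite ltr_norml; apply/andP; split; lra.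
  pose c : 'rV[rat]_n * nat := (\row_i projT1 (cid (hr i)), k).
  have bc : box c x by move=> i; rewrite /= mxE; exact: projT2 (cid (hr i)).
  exists c => //; rewrite /F; case: asboolP => // nb; exfalso; apply: nb => y hy.
  apply: (he (e/2)) => //=; [|lra|].
    by rewrite /ball_ /= sub0r normrN gtr0_norm; lra.
  rewrite mx_norm_ball /ball_ /=; apply: norm_lt_coord; first lra.
  move=> i; rewrite !mxE; have := bc i; have := hy i; rewrite /= !mxE.
  set q := ratr _; move: hk; set z := (k.+1%:R^-1 : R) => hk h1 h2.
  by apply: le_lt_trans hk; rewrite ler_norml;
    move: h1 h2; rewrite !ltr_norml => /andP[? ?] /andP[? ?]; apply/andP; split; lra.
apply: countable_bigcupT_measurable => // c; rewrite /F; case: asboolP => // _.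
rewrite (_ : box c = \bigcap_(i in [set: 'I_n])
   (rV_coord i @^-1` ball (ratr (c.1 0 i) : R) c.2.+1%:R^-1)).
  apply: fin_bigcap_measurable => // i _.
  rewrite -[X in measurable X]setTI; apply: measurable_rV_coord => //.
  exact: measurable_ball.
by apply/seteqP; split => x /= h i; [move=> _|]; have := h i;
  rewrite /ball /= distrC => h'; exact: h'.
Qed.

Lemma continuous_measurable_rV D (f : 'rV[R]_n -> R) :
  open D -> {in D, continuous f} -> measurable_fun D f.
Proof.
move=> oD cf; apply: (measurability _ (RGenOpens.measurableE R)) => //.
move=> _ [_ [a [b ->] <-]]; apply: open_measurable_rV.
rewrite openE => x [Dx /= fx].
have h : nbhs x (f @^-1` `]a, b[%classic).
  by apply: cf; [rewrite inE|exact: (interval_open _ _ fx)].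
rewrite /interior; apply: filterI h; exact: open_nbhs_nbhs.
Qed.

End row_vectors.

(** * Bounded measurable functions on a set of finite measure *)

Section bounded_measurable.
Context d (T : measurableType d) (R : realType).
Variables (mu : {measure set T -> \bar R}) (D : set T).
Hypotheses (mD : measurable D) (Doo : (mu D < +oo)%E).
Implicit Types (f g : T -> R) (E N : set T).

Definition bounded_measurable f :=
  measurable_fun D f /\ exists M, forall x, D x -> `|f x| <= M.

Lemma bounded_measurable_cst r : bounded_measurable (fun=> r).
Proof. by split; [exact: measurable_cst|exists `|r|]. Qed.

Lemma bounded_measurableD f g : bounded_measurable f ->
  bounded_measurable g -> bounded_measurable (fun x => f x + g x).
Proof.
move=> [mf [M fM]] [mg [M' gM]]; split; first exact: measurable_funD.
exists (M + M') => x Dx; apply: le_trans (ler_normD _ _) _.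
by apply: lerD; [exact: fM|exact: gM].
Qed.

Lemma bounded_measurableM f g : bounded_measurable f ->
  bounded_measurable g -> bounded_measurable (fun x => f x * g x).
Proof.
move=> [mf [M fM]] [mg [M' gM]]; split; first exact: measurable_funM.
exists (M * M') => x Dx; rewrite normrM.
by apply: ler_pM => //; [exact: fM|exact: gM].
Qed.

Lemma bounded_measurableN f : bounded_measurable f ->
  bounded_measurable (fun x => - f x).
Proof.
move=> [mf [M fM]]; split; first exact: measurable_funN.
by exists M => x Dx; rewrite normrN; exact: fM.
Qed.

Lemma bounded_measurableB f g : bounded_measurable f ->
  bounded_measurable g -> bounded_measurable (fun x => f x - g x).
Proof.
by move=> bf bg; apply: bounded_measurableD => //; exact: bounded_measurableN.
Qed.

Lemma bounded_measurable_sum I (s : seq I) (P : pred I) (h : I -> T -> R) :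
  (forall i, P i -> bounded_measurable (h i)) ->
  bounded_measurable (fun x => \sum_(i <- s | P i) h i x).
Proof.
move=> bh; elim: s => [|i s IH].
  rewrite (_ : (fun _ => _) = fun=> 0); first exact: bounded_measurable_cst.
  by apply/funext => x; rewrite big_nil.
rewrite (_ : (fun _ => _) = fun x => if P i
    then h i x + \sum_(j <- s | P j) h j x else \sum_(j <- s | P j) h j x).
  by case: (boolP (P i)) => // Pi; apply: bounded_measurableD => //; exact: bh.
by apply/funext => x; rewrite big_cons.
Qed.

Lemma eq_bounded_measurable f g : (forall x, D x -> f x = g x) ->
  bounded_measurable f -> bounded_measurable g.
Proof.
move=> fg [mf [M fM]]; split.
  by apply: (eq_measurable_fun f) mf => x; rewrite inE; exact: fg.
by exists M => x Dx; rewrite -fg//; exact: fM.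
Qed.

Lemma bounded_on_le f M : (forall x, D x -> `|f x| <= M) -> [bounded f x | x in D].
Proof.
move=> fM; exists M; split; first exact: num_real.
by move=> z Mz x /= Dx; apply: le_trans (fM _ Dx) (ltW Mz).
Qed.

Lemma bounded_measurable_integrable f :
  bounded_measurable f -> mu.-integrable D (EFin \o f).
Proof.
move=> [mf [M fM]]; apply: measurable_bounded_integrable => //.
exact: bounded_on_le fM.
Qed.

Local Notation I f := (Rintegral mu D f).

Lemma RintegralD_bounded f g : bounded_measurable f -> bounded_measurable g ->
  I (fun x => f x + g x) = I f + I g.
Proof. by move=> ? ?; apply: RintegralD => //; exact: bounded_measurable_integrable. Qed.

Lemma RintegralB_bounded f g : bounded_measurable f -> bounded_measurable g ->
  I (fun x => f x - g x) = I f - I g.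
Proof. by move=> ? ?; apply: RintegralB => //; exact: bounded_measurable_integrable. Qed.

Lemma RintegralZ_bounded r f : bounded_measurable f ->
  I (fun x => r * f x) = r * I f.
Proof. by move=> ?; apply: RintegralZl => //; exact: bounded_measurable_integrable. Qed.

Lemma Rintegral_sum_bounded J (s : seq J) (P : pred J) (h : J -> T -> R) :
  (forall i, P i -> bounded_measurable (h i)) ->
  I (fun x => \sum_(i <- s | P i) h i x) = \sum_(i <- s | P i) I (h i).
Proof.
move=> bh; elim: s => [|i s IH].
  rewrite big_nil; under eq_Rintegral do rewrite big_nil.
  by rewrite Rintegral_cst// mul0r.
rewrite big_cons; under eq_Rintegral do rewrite big_cons.
case: (boolP (P i)) => // Pi; rewrite RintegralD_bounded ?IH//; first exact: bh.
exact: bounded_measurable_sum.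
Qed.

Lemma eq_Rintegral_on f g : (forall x, D x -> f x = g x) -> I f = I g.
Proof. by move=> fg; apply: eq_Rintegral => x; rewrite inE; exact: fg. Qed.

Lemma Rintegral_null f N : bounded_measurable f -> measurable N ->
  mu N = 0%E -> (forall x, D x -> ~ N x -> f x = 0) -> I f = 0.
Proof.
move=> bf mN N0 f0; rewrite /Rintegral (negligible_integral mN)//; last first.
  exact: bounded_measurable_integrable.
by rewrite integral0_eq// => x [Dx Nx]; rewrite f0.
Qed.

Lemma le_Rintegral_small f E M : bounded_measurable f -> measurable E ->
  0 <= M -> E `<=` D -> (forall x, D x -> ~ E x -> f x = 0) ->
  (forall x, D x -> `|f x| <= M) -> `|I f| <= M * fine (mu E).
Proof.
move=> bf mE M0 ED fE fM.
apply: (@le_trans _ _ (I (fun x => `|f x|))).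
  by apply: le_normr_Rintegral => //; exact: bounded_measurable_integrable.
rewrite (_ : I _ = Rintegral mu E (fun x => `|f x|)); last first.
  rewrite -[in RHS](setIidr ED) Rintegral_mkcondr; apply: eq_Rintegral_on => x Dx.
  rewrite /patch; case: ifPn => // /negP; rewrite inE => nE.
  by rewrite fE// normr0.
have Eoo : (mu E < +oo)%E.
  by apply: le_lt_trans Doo; apply: le_measure; rewrite ?inE.
rewrite -Rintegral_cst//; apply: le_Rintegral => //.
- apply: (integrableS mD) => //.
  have /integrable_norm := bounded_measurable_integrable bf.
  by [].
- apply: measurable_bounded_integrable => //.
  by exists M; split; [exact: num_real|move=> z Mz x _ /=; rewrite ger0_norm// ltW].
- by move=> x Ex; apply: fM; exact: ED.
Qed.

Lemma bounded_convergence (h : nat -> T -> R) f M :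
  (forall m, measurable_fun D (h m)) -> measurable_fun D f ->
  (forall m x, D x -> `|h m x| <= M) ->
  (forall x, D x -> h ^~ x @ \oo --> f x) ->
  (fun m => I (h m)) @ \oo --> I f.
Proof.
move=> mh mf hM hf.
have [|||||if_ _ cv] := @dominated_convergence _ _ _ mu D mD
  (fun m => EFin \o h m) (EFin \o f) (EFin \o cst `|M|).
- by move=> m; exact/measurable_EFinP.
- exact/measurable_EFinP.
- by apply: aeW => x Dx; apply: cvg_EFin; [exact: nearW|exact: hf].
- by apply: measurable_bounded_integrable => //; apply: (@bounded_on_le _ `|M|) => x _; rewrite /= normr_id.
- by apply: aeW => x m Dx /=; rewrite lee_fin (le_trans (hM _ _ Dx))// ler_norm.
rewrite /Rintegral; apply: fine_cvg; rewrite fineK//.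
exact: integrable_fin_num.
Qed.

End bounded_measurable.

(** * Packing disjoint translates *)

Section packing.
Context {R : realType} {n : nat}.
Implicit Types (x y v a : 'rV[R]_n) (A B E : set 'rV[R]_n).
Local Notation mu := (@lebesgue_rV R n).

Definition cube (r : R) : set 'rV[R]_n := [set x | `|x| < r].

Lemma open_cube r : open (cube r).
Proof.
have [r0|r0] := ltP 0 r.
  rewrite (_ : cube r = ball (0 : 'rV[R]_n) r); first exact: ball_open.
  by apply/seteqP; split => x; rewrite mx_norm_ball /ball_ /cube /= sub0r normrN.
rewrite (_ : cube r = set0); first exact: open0.
by rewrite -subset0 => x /(le_lt_trans (normr_ge0 _)); rewrite ltNge r0.
Qed.

Lemma measurable_cube r : measurable (cube r).
Proof. apply: open_measurable_rV; exact: open_cube. Qed.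

Lemma lebesgue_rV_cube_fin r : (mu (cube r) < +oo)%E.
Proof.
pose A (i : 'I_n) : set (measurableTypeR R) := `]- r, r[%classic.
have mA i : measurable (A i) by exact: measurable_itv.
have mA' : measurable [set v : 'rV[R]_n | forall i, A i (v 0%R i)].
  rewrite (_ : mkset _ = \bigcap_(i in [set: 'I_n]) (rV_coord i @^-1` A i)).
    apply: fin_bigcap_measurable => // i _.
    by rewrite -[X in measurable X]setTI; exact: measurable_rV_coord.
  by apply/seteqP; split => v /= h i; [move=> _|]; exact: h.
apply: (@le_lt_trans _ _ (mu [set v : 'rV[R]_n | forall i, A i (v 0%R i)])).
  apply: le_measure; rewrite ?inE//; first exact: measurable_cube.
  move=> x /= xr i; rewrite /A /= in_itv /= -ltr_norml.
  exact: le_lt_trans (le_coord_norm _ _) xr.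
rewrite lebesgue_rV_box//.
rewrite (eq_bigr (fun=> (fine (lebesgue_measure (`]- r, r[%classic : set R)))%:E)); last first.
  move=> i _; rewrite fineK// lebesgue_measure_itv /=; case: ifP => //.
by rewrite prodEFin ltry.
Qed.

(** The translates of E have the measure of E, so this is additivity. *)
Lemma packing (I : finType) (v : I -> 'rV[R]_n) E B :
  measurable E -> measurable B ->
  (forall i x, E x -> B (x + v i)) ->
  (forall i j x y, E x -> E y -> x + v i = y + v j -> i = j) ->
  (#|I|%:R%:E * mu E <= mu B)%E.
Proof.
move=> mE mB EB inj.
pose F i := (fun x => x + - v i) @^-1` E.
have mF i : measurable (F i).
  by rewrite -[X in measurable X]setTI; exact: measurable_translation.
have FE i : mu (F i) = mu E by exact: lebesgue_rV_translation.
have tF : trivIset [set: 'I_#|I|] (F \o enum_val).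
  apply/trivIsetP => i j _ _ ij; rewrite -subset0 => x [Ex Ey].
  have /enum_val_inj ijE : enum_val i = enum_val j.
    by apply: (inj _ _ _ _ Ex Ey); rewrite !subrK.
  by rewrite ijE eqxx in ij.
have <- : (mu (\big[setU/set0]_(k < #|I|) F (enum_val k)) =
    #|I|%:R%:E * mu E)%E.
  rewrite [LHS](measure_bigsetU_ord mu xpredT (fun k => mF (enum_val k)) tF).
  rewrite (eq_bigr (fun=> mu E)) => [|k _]; last exact: FE.
  elim: #|I| => [|m IH]; first by rewrite big_ord0 mul0e.
  rewrite big_ord_recr /= IH -[X in (_ + X)%E]mul1e -ge0_muleDl ?lee_fin//.
  by rewrite -EFinD natr1.
apply: le_measure; rewrite ?inE//.
  exact: bigsetU_measurable.
apply: (big_ind (fun X => X `<=` B)) => [x //|X Y XB YB|k _ x Fx]; first by rewrite subUset; split.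
by have := EB (enum_val k) _ Fx; rewrite subrK.
Qed.

Lemma packing_null E B : measurable E -> measurable B -> (mu B < +oo)%E ->
  (forall m, exists v : 'I_m.+1 -> 'rV[R]_n,
     (forall i x, E x -> B (x + v i)) /\
     (forall i j x y, E x -> E y -> x + v i = y + v j -> i = j)) ->
  mu E = 0%E.
Proof.
move=> mE mB Boo h.
have hm m : (m.+1%:R%:E * mu E <= mu B)%E.
  have [v [h1 h2]] := h m.
  by have := packing mE mB h1 h2; rewrite card_ord.
have Eoo : (mu E < +oo)%E.
  by apply: le_lt_trans Boo; apply: le_trans (hm 0%N); rewrite mul1e.
have Efin : mu E \is a fin_num by rewrite ge0_fin_numE.
have Bfin : mu B \is a fin_num by rewrite ge0_fin_numE.
rewrite -(fineK Efin); congr EFin.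
apply/eqP; rewrite eq_le fine_ge0 ?andbT//.
rewrite leNgt; apply/negP => e0.
have [m hh] : exists m : nat, fine (mu B) / fine (mu E) < m.+1%:R.
  exists (Num.truncn (fine (mu B) / fine (mu E))).
  by rewrite truncnS_gt.
have := hm m; rewrite -(fineK Efin) -(fineK Bfin) -EFinM lee_fin leNgt.
by rewrite -ltr_pdivrMr// hh.
Qed.

Lemma dotvD a x y : dotv a (x + y) = dotv a x + dotv a y.
Proof. by rewrite -big_split; apply: eq_bigr => i _; rewrite mxE mulrDr. Qed.

Lemma dotvZ a t x : dotv a (t *: x) = t * dotv a x.
Proof. by rewrite big_distrr; apply: eq_bigr => i _; rewrite mxE mulrCA. Qed.

Lemma dotvN a x : dotv a (- x) = - dotv a x.
Proof. by rewrite -scaleN1r dotvZ mulN1r. Qed.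

Lemma dotvB a x y : dotv a (x - y) = dotv a x - dotv a y.
Proof. by rewrite dotvD dotvN. Qed.

Lemma dotvC a x : dotv a x = dotv x a.
Proof. by apply: eq_bigr => i _; rewrite mulrC. Qed.

Lemma dotvZl a t x : dotv (t *: x) a = t * dotv x a.
Proof. by rewrite dotvC dotvZ (dotvC a). Qed.

Lemma dotvBl a x y : dotv (x - y) a = dotv x a - dotv y a.
Proof. by rewrite dotvC dotvB !(dotvC a). Qed.

Lemma dotv_eq0 a : dotv a a = 0 -> a = 0.
Proof.
move=> /eqP; rewrite psumr_eq0 => [/allP h|i _]; last by rewrite -expr2 sqr_ge0.
apply/rowP => i; rewrite mxE; apply/eqP.
have := h i; rewrite mem_index_enum => /(_ isT) /implyP/(_ isT).
by rewrite mulf_eq0 orbb.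
Qed.

Lemma dotv_ge0 a : 0 <= dotv a a.
Proof. by apply: sumr_ge0 => i _; rewrite -expr2 sqr_ge0. Qed.

Lemma differentiable_dotv a x : differentiable (dotv a) x.
Proof.
rewrite (_ : dotv a = \sum_(i < n) (fun y : 'rV[R]_n => a 0 i *: y 0 i)); last first.
  by apply/funext => y; rewrite fct_sumE.
apply: differentiable_sum => i.
by apply: differentiableZ; exact: differentiable_coord.
Qed.

Lemma continuous_dotv a : continuous (dotv a).
Proof. by move=> x; apply: differentiable_continuous; exact: differentiable_dotv. Qed.

Lemma derive_dotv a x v : 'D_v (dotv a) x = dotv a v.
Proof.
rewrite /derive; apply: cvg_lim => //.
apply: (@cvg_near_cst _ _ _ _ 0^').
near=> h; rewrite /= dotvD dotvZ addrK /GRing.scale /= mulrA mulVf ?mul1r//.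
by near: h; exact: nbhs_dnbhs_neq.
Unshelve. all: by end_near. Qed.

Lemma measurable_dotv D a : measurable D -> measurable_fun D (dotv a).
Proof.
move=> mD; apply: (@measurable_funTS _ _ _ _ _ (dotv a)).
apply: continuous_measurable_rV; first exact: openT.
by move=> x _; exact: continuous_dotv.
Qed.

(** Translating the slice along its normal produces any number of disjoint copies
of it in a bounded set. *)
Lemma hyperplane_null a b r :
  dotv a a = 1 -> mu (cube r `&` [set x | dotv a x = b]) = 0%E.
Proof.
move=> a1.
apply: (@packing_null _ (cube (r + `|a|))).
- have := @measurable_dotv (cube r) a (measurable_cube r) (measurable_cube r)
     [set b] (measurable_set1 b).
  by [].
- exact: measurable_cube.
- exact: lebesgue_rV_cube_fin.
move=> m; exists (fun i => (i%:R / m.+1%:R) *: a); split.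
  move=> i x [xr _]; rewrite /cube /=; apply: le_lt_trans (ler_normD _ _) _.
  apply: ltr_leD => //; rewrite normrZ ger0_norm; last by rewrite divr_ge0.
  by rewrite ler_piMl// ler_pdivrMr// mul1r ler_nat ltnW.
move=> i j x y [_ /= xb] [_ /= yb] /(congr1 (dotv a)).
rewrite !dotvD xb yb !dotvZ a1 !mulr1 => /addrI.
move/mulIf; rewrite invr_eq0 pnatr_eq0 => /(_ isT)/eqP.
by rewrite eqr_nat => /eqP/val_inj.
Qed.

End packing.

Section slabs.
Context {R : realType} {n : nat}.
Implicit Types (x y v a : 'rV[R]_n) (A B E : set 'rV[R]_n).
Local Notation mu := (@lebesgue_rV R n).

Definition slab (h : 'rV[R]_n * R) (e : R) : set 'rV[R]_n :=
  [set x | `|dotv h.1 x - h.2| < e].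

Lemma measurable_slab h e : measurable (slab h e).
Proof.
apply: open_measurable_rV.
rewrite (_ : slab h e = dotv h.1 @^-1` `](h.2 - e), (h.2 + e)[%classic).
  by apply: open_comp; [move=> x _; exact: continuous_dotv|exact: itv_open].
by apply/seteqP; split => x; rewrite /slab /= in_itv /= ltr_distl.
Qed.

(** Let p, q be dual to the two normals.  Translation by 2 i p / (N+1) + 2 j q / (N+1)
moves the offsets from the hyperplanes by 2 i / (N+1) and 2 j / (N+1), while
these offsets vary by less than 2 / (N+1) in the intersection of the slabs: the
(N+1)^2 translates with i, j <= N are disjoint. *)
Lemma slabs_packing (h h' : 'rV[R]_n * R) r : dotv h.1 h.1 = 1 -> dotv h'.1 h'.1 = 1 ->
  dotv h.1 h'.1 ^+ 2 != 1 ->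
  exists C : R, forall N,
   N.+1%:R ^+ 2 * fine (mu (cube r `&` slab h N.+1%:R^-1 `&` slab h' N.+1%:R^-1)) <= C.
Proof.
case: h h' => [a b] [a' b'] /= a1 a1'; set c := dotv a a' => c1.
have c0 : 1 - c ^+ 2 != 0 by rewrite subr_eq0 eq_sym.
pose p := (1 - c ^+ 2)^-1 *: (a - c *: a').
pose q := (1 - c ^+ 2)^-1 *: (a' - c *: a).
have ap : dotv a p = 1 by rewrite dotvZ dotvB dotvZ a1 -/c -expr2 mulVf.
have a'p : dotv a' p = 0 by rewrite dotvZ dotvB dotvZ a1' dotvC -/c mulr1 subrr mulr0.
have aq : dotv a q = 0 by rewrite dotvZ dotvB dotvZ a1 -/c mulr1 subrr mulr0.
have a'q : dotv a' q = 1.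
  by rewrite dotvZ dotvB dotvZ a1' [dotv a' a]dotvC -/c -expr2 mulVf.
clearbody p q.
exists (fine (mu (cube (r + 2 * `|p| + 2 * `|q|)))) => N.
have M0 : 0 < N.+1%:R :> R by rewrite ltr0n.
set E := _ `&` _.
have mE : measurable E.
  apply: measurableI; last exact: measurable_slab.
  apply: measurableI; [exact: measurable_cube|exact: measurable_slab].
set B := cube _.
have mB : measurable B by exact: measurable_cube.
have Boo : (mu B < +oo)%E by exact: lebesgue_rV_cube_fin.
have sep (t s s' : R) (i i' : 'I_N.+1) : `|s - t| < N.+1%:R^-1 ->
   `|s' - t| < N.+1%:R^-1 ->
   s + i%:R * 2 / N.+1%:R = s' + i'%:R * 2 / N.+1%:R -> i = i'.
  move=> h1 h2 e.
  have : `|(i%:R : R) - i'%:R| < 1.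
    have -> : (i%:R : R) - i'%:R = ((s' - t) - (s - t)) * N.+1%:R / 2.
      apply: (@mulfI _ (2 / N.+1%:R)); first by rewrite mulf_neq0// invr_neq0// gt_eqF.
      transitivity (s' - s); last by field; rewrite gt_eqF.
      have -> : s' = s + i%:R * 2 / N.+1%:R - i'%:R * 2 / N.+1%:R by rewrite e addrK.
      by field; rewrite gt_eqF.
    rewrite !normrM [`|N.+1%:R|]gtr0_norm// [`|2^-1|]gtr0_norm// ltr_pdivrMr// mul1r.
    rewrite -ltr_pdivlMr//; apply: le_lt_trans (ler_normB _ _) _.
    by rewrite [X in _ < X](_ : _ = N.+1%:R^-1 + N.+1%:R^-1) ?ltrD//; field; rewrite gt_eqF.
  wlog ii : i i' s s' h1 h2 e / (i <= i')%N.
    move=> W; case/orP: (leq_total i i') => ii; first exact: (W i i' s s').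
    by rewrite distrC => hh; apply/esym/(W i' i s' s).
  rewrite distrC -natrB// normr_nat -[1]/(1%:R) ltr_nat ltnS leqn0 subn_eq0 => i'i.
  by apply/val_inj/eqP; rewrite eqn_leq ii.
have := @packing R n _ (fun ij : 'I_N.+1 * 'I_N.+1 =>
   (ij.1%:R * 2 / N.+1%:R) *: p + (ij.2%:R * 2 / N.+1%:R) *: q) E B mE mB.
have hi (i : 'I_N.+1) (z : 'rV[R]_n) : `|(i%:R * 2 / N.+1%:R) *: z| <= 2 * `|z|.
  rewrite normrZ ger0_norm; last by rewrite divr_ge0// mulr_ge0.
  by rewrite ler_wpM2r// ler_pdivrMr// mulrC ler_pM2l// ler_nat ltnW.
have Eoo : (mu E < +oo)%E.
  apply: le_lt_trans (lebesgue_rV_cube_fin r); apply: le_measure;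
    rewrite ?inE//; [exact: measurable_cube|by move=> x [[]]].
have Efin : mu E \is a fin_num by rewrite ge0_fin_numE.
have Bfin : mu B \is a fin_num by rewrite ge0_fin_numE.
rewrite -(fineK Efin) -(fineK Bfin) -EFinM lee_fin card_prod card_ord natrM -expr2.
apply.
- move=> [i j] x [[xr _] _]; rewrite /B /cube /= in xr *.
  apply: le_lt_trans (ler_normD _ _) _; rewrite -addrA ltr_leD//.
  by apply: le_trans (ler_normD _ _) _; rewrite lerD.
- move=> [i j] [i' j'] x y [[_ /= xa] xa'] [[_ /= ya] ya'] /= e.
  have := congr1 (dotv a) e; have := congr1 (dotv a') e.
  rewrite !dotvD !dotvZ ap a'p aq a'q !(mulr0,mulr1,addr0,add0r) => e1 e2.
  by congr pair; [apply: sep e2; eassumption|apply: sep e1; eassumption].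
Qed.

(** The slabs of distinct parallel hyperplanes are disjoint as soon as they are thin,
which is absorbed by the constant. *)
Lemma slabs_measure (h h' : 'rV[R]_n * R) r : dotv h.1 h.1 = 1 -> dotv h'.1 h'.1 = 1 ->
  hyperplane h <> hyperplane h' ->
  exists C : R, forall N,
   N.+1%:R ^+ 2 * fine (mu (cube r `&` slab h N.+1%:R^-1 `&` slab h' N.+1%:R^-1)) <= C.
Proof.
move=> a1 a1' hh'.
have [c1|] := eqVneq (dotv h.1 h'.1 ^+ 2) 1; last exact: slabs_packing.
case: h h' a1 a1' hh' c1 => [a b] [a' b'] /= a1 a1' hh'; set c := dotv a a' => c1.
have a'E : a' = c *: a.
  apply/eqP; rewrite -subr_eq0; apply/eqP/dotv_eq0.
  rewrite !(dotvBl, dotvB, dotvZl, dotvZ) a1 a1' [dotv a' a]dotvC -/c.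
  by transitivity (1 - c ^+ 2); [ring|rewrite c1 subrr].
pose d := `|b' - c * b|.
have d0 : 0 < d.
  rewrite normr_gt0 subr_eq0; apply/eqP => b'E; apply: hh'.
  apply/seteqP; split => x /=; rewrite /hyperplane /= b'E a'E dotvZl.
    by move=> ->.
  by move/(congr1 ( *%R c)); rewrite !mulrA -expr2 c1 !mul1r.
have cabs : `|c| = 1 by apply/eqP; rewrite -sqrp_eq1 ?real_normK ?num_real ?c1.
exists ((2 / d) ^+ 2 * fine (mu (cube r))) => N.
have M0 : 0 < N.+1%:R :> R by rewrite ltr0n.
set E := _ `&` _.
have mE : measurable E.
  apply: measurableI; last exact: measurable_slab.
  apply: measurableI; [exact: measurable_cube|exact: measurable_slab].
have [dN|dN] := ltP N.+1%:R (2 / d); last first.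
  rewrite (_ : E = set0); first by rewrite measure0 mulr0 mulr_ge0 ?sqr_ge0 ?fine_ge0.
  rewrite -subset0 => x [[_ /= h1] h2].
  rewrite /slab /= a'E dotvZl in h2.
  have : d < N.+1%:R^-1 + N.+1%:R^-1.
    rewrite /d (_ : b' - _ = c * (dotv a x - b) - (c * dotv a x - b')); last by ring.
    apply: le_lt_trans (ler_normB _ _) _.
    by rewrite normrM cabs mul1r ltrD.
  rewrite -mulr2n -[_ *+ 2]mulr_natl -ltr_pdivrMl// [_^-1 * _]mulrC.
  move: dN; rewrite ler_pdivrMr// => dN.
  rewrite -(ltr_pM2l M0) mulfV ?gt_eqF// mulrA ltr_pdivrMr// mul1r mulrC => dN'.
  by move: dN'; rewrite mulrC ltNge dN.
apply: ler_pM; rewrite ?sqr_ge0 ?fine_ge0//.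
  by rewrite ler_sqr ?nnegrE ?ltW// divr_gt0.
apply: fine_le; rewrite ?ge0_fin_numE//.
- apply: le_lt_trans (lebesgue_rV_cube_fin r); apply: le_measure;
    rewrite ?inE//; [exact: measurable_cube|by move=> x [[]]].
- exact: lebesgue_rV_cube_fin.
- by apply: le_measure; rewrite ?inE//; [exact: measurable_cube|by move=> x [[]]].
Qed.

End slabs.

(** * Integrals of translates, and level sets *)

Section shift.
Context {R : realType} {n : nat}.
Implicit Types (x y v a : 'rV[R]_n) (A B E : set 'rV[R]_n).
Local Notation mu := (@lebesgue_rV R n).

Lemma ge0_integral_shift v (f : 'rV[R]_n -> \bar R) : measurable_fun setT f ->
  (forall x, 0 <= f x)%E ->
  (\int[mu]_x f (x + v)%R = \int[mu]_x f x)%E.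
Proof.
move=> mf f0.
have /= := @ge0_integral_pushforward _ _ _ _ R _ (measurable_translation v)
  mu setT f measurableT mf (fun _ _ => f0 _).
rewrite preimage_setT => <-.
pose m := measure_function_pushforward__canonical__measure_function_Measure
  mu (measurable_translation v).
apply: (@eq_measure_integral _ _ R setT mu m f) => C mC _.
exact: lebesgue_rV_translation.
Qed.

Lemma integral_shift v (f : 'rV[R]_n -> \bar R) : measurable_fun setT f ->
  (\int[mu]_x f (x + v)%R = \int[mu]_x f x)%E.
Proof.
move=> mf; rewrite integralE [RHS]integralE; congr (_ - _)%E.
- transitivity (\int[mu]_x f^\+%E (x + v)%R)%E.
    by apply: eq_integral => x _; rewrite !funeposE.
  by apply: ge0_integral_shift => //; exact: measurable_funepos.
- transitivity (\int[mu]_x f^\-%E (x + v)%R)%E.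
    by apply: eq_integral => x _; rewrite !funenegE.
  by apply: ge0_integral_shift => //; exact: measurable_funeneg.
Qed.

Lemma Rintegral_shift v (f : 'rV[R]_n -> R) r r' : measurable_fun setT f ->
  (forall x, f x != 0 -> cube r x) -> r + `|v| <= r' ->
  \int[mu]_(x in cube r') f (x + v) = \int[mu]_(x in cube r') f x.
Proof.
move=> mf f0 rr'; rewrite Rintegral_mkcond [RHS]Rintegral_mkcond.
have E (g : 'rV[R]_n -> R) : (forall x, g x != 0 -> cube r' x) ->
    (g \_ (cube r')) = g.
  move=> g0; apply/funext => x; rewrite /patch; case: ifPn => //.
  move=> /negP; rewrite inE => nx; apply/esym/eqP; apply: contra_notT nx; exact: g0.
rewrite !E.
- rewrite /Rintegral; congr fine.
  by apply: (@integral_shift v (EFin \o f)); exact/measurable_EFinP.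
- move=> x /f0; rewrite /cube /= => xr; apply: lt_le_trans xr _.
  by apply: le_trans rr'; rewrite lerDl.
- move=> x /f0; rewrite /cube /= => xr; apply: lt_le_trans rr'.
  by rewrite -[x](addrK v); apply: le_lt_trans (ler_normB _ _) _; rewrite ltrD2r.
Qed.

(** At a zero of F with nonzero slope along p, the nearby points of the line
directed by p are not zeros.  Sorting these zeros by the length of that
neighborhood, each class is disjoint from its own short translates along p.
Only rational translations are considered, so that the classes are measurable. *)
Lemma level_set_null (Omega : set 'rV[R]_n) (F : 'rV[R]_n -> R) p r :
  open Omega -> Omega `<=` cube r -> measurable_fun Omega F ->
  measurable_fun Omega (fun x => 'D_p F x) ->
  (forall x, Omega x -> derivable F x p) ->
  let Z := Omega `&` [set x | F x = 0] `&` [set x | 'D_p F x != 0] in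
  measurable Z /\ mu Z = 0%E.
Proof.
move=> oO Or mF mDF dF /=; have mO : measurable Omega by exact: open_measurable_rV.
set Z := _ `&` _.
have m0 : measurable (Omega `&` [set x | F x = 0]).
  exact: (mF mO [set 0] (measurable_set1 0)).
have m1 : measurable (Omega `&` [set x | F x != 0]).
  have := mF mO (~` [set 0]) (measurableC (measurable_set1 0)).
  rewrite (_ : F @^-1` _ = [set x | F x != 0])//.
  by apply/seteqP; split => x /= /eqP.
have mZ : measurable Z.
  rewrite (_ : Z = (Omega `&` [set x | F x = 0]) `&`
    (Omega `&` (fun x => 'D_p F x) @^-1` (~` [set 0]))).
    by apply: measurableI => //; exact: (mDF mO _ (measurableC (measurable_set1 0))).
  apply/seteqP; split => x /=; rewrite /Z /=.
    by move=> [[Ox Fx] /eqP Dx].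
  by move=> [[Ox Fx] [_ /eqP Dx]].
split=> //; pose W := Omega `&` [set x | F x != 0].
pose q (a b : nat) : R := a.+1%:R / b.+1%:R.
pose E k := (Omega `&` [set x | F x = 0]) `&`
  \bigcap_a \bigcap_b (if q a b < k.+1%:R^-1 then
     (fun x => x + q a b *: p) @^-1` W else setT).
have mE k : measurable (E k).
  apply: measurableI => //; apply: bigcapT_measurable => a.
  apply: bigcapT_measurable => b; case: ifP => // _.
  by rewrite -[X in measurable X]setTI; exact: measurable_translation.
have ZE : Z `<=` \bigcup_k E k.
  move=> x [[Ox /= Fx] /= Dx].
  have h1 : \forall h \near (0:R), Omega (h *: p + x).
    have : h *: p + x @[h --> 0] --> (0:R) *: p + x.
      by apply: cvgD; [apply: cvgZr_tmp; exact: cvg_id|exact: cvg_cst].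
    by apply; rewrite scale0r add0r; exact: open_nbhs_nbhs.
  have h2 : \forall h \near (0:R)^', F (h *: p + x) != 0.
    have := dF _ Ox; rewrite /derivable => /cvg_ex[l hl].
    have lD : l = 'D_p F x by apply/esym/cvg_lim.
    have := cvgr_neq0 _ hl; rewrite lD Dx => /(_ _ isT).
    apply: filterS => h /=; rewrite Fx subr0; apply: contra_neq => ->.
    by rewrite scaler0.
  have [e /= e0 he] : \forall h \near (0:R), h != 0 -> F (h *: p + x) != 0 /\ Omega (h *: p + x).
    near=> h => hn; split; last by near: h.
    by move: hn; near: h; exact: h2.
  have [k hk] := @ltr_add_invr R 0 e e0.
  exists k => //; split => // a _ b _; case: ifPn => // qk.
  have q0 : 0 < q a b by rewrite divr_gt0.
  have [||h3 h4] := he (q a b).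
  - rewrite /= sub0r normrN gtr0_norm//; apply: lt_trans qk _.
    by move: hk; rewrite add0r.
  - by rewrite gt_eqF.
  - by rewrite /preimage /= addrC; split.
have E0 k : mu (E k) = 0%E.
  apply: (@packing_null _ _ _ (cube (r + `|p|))) => //.
  - exact: measurable_cube.
  - exact: lebesgue_rV_cube_fin.
  move=> m; exists (fun i => (i%:R / (k.+1 * m.+1)%N%:R) *: p); split.
    move=> i x [[Ox _] _]; rewrite /cube /=; apply: le_lt_trans (ler_normD _ _) _.
    apply: ltr_leD; first exact: Or.
    rewrite normrZ ger0_norm; last by rewrite divr_ge0.
    rewrite ler_piMl// ler_pdivrMr ?ltr0n// mul1r ler_nat.
    by rewrite (leq_trans (ltnW (ltn_ord i)))// leq_pmull.
  have sep (i j : 'I_m.+1) x y : E k x -> E k y ->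
     x + (i%:R / (k.+1 * m.+1)%N%:R) *: p = y + (j%:R / (k.+1 * m.+1)%N%:R) *: p ->
     ~ (i < j)%N.
    move=> [[Ox /= Fx] _] [_ hy] e ij.
    have := hy (j - i).-1 Logic.I (k.+1 * m.+1).-1 Logic.I.
    have qE : q (j - i).-1 (k.+1 * m.+1).-1 =
        j%:R / (k.+1 * m.+1)%N%:R - i%:R / (k.+1 * m.+1)%N%:R.
      rewrite /q prednK ?subn_gt0// prednK ?muln_gt0//.
      by rewrite natrB ?(ltnW ij)// mulrBl.
    have -> : q (j - i).-1 (k.+1 * m.+1).-1 < k.+1%:R^-1.
      rewrite /q prednK ?subn_gt0// prednK ?muln_gt0//.
      rewrite natrM invfM mulrCA gtr_pMr ?invr_gt0// ltr_pdivrMr// mul1r ltr_nat.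
      by rewrite (leq_ltn_trans (leq_subr _ _)).
    rewrite /preimage /= qE scalerBl addrA -e addrK => -[_].
    by rewrite /= Fx eqxx.
  move=> i j x y Ex Ey e; case: (ltngtP i j) => [ij|ij|/val_inj //].
    by case: (sep i j x y Ex Ey e ij).
  by case: (sep j i y x Ey Ex (esym e) ij).
apply: measure_negligible => //.
apply: (negligibleS ZE); apply: negligible_bigcup => k.
exists (E k); split; [exact: mE|exact: E0|by []].
Unshelve. all: by end_near. Qed.

End shift.

(** * Null Lagrangians of compactly supported functions *)

Section directional.
Context {R : realType} {n : nat}.
Implicit Types (x y v p q : 'rV[R]_n) (F G W : 'rV[R]_n -> R).
Local Notation mu := (@lebesgue_rV R n).

Lemma is_derive_line W p x (t : R) : derivable W (x + t *: p) p ->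
  is_derive t 1 (fun s : R => W (x + s *: p)) ('D_p W (x + t *: p)).
Proof.
move=> dW.
have E : (fun h : R => h^-1 *: (((fun s : R => W (x + s *: p)) \o shift t) (h *: 1)
      - W (x + t *: p))) =
   (fun h : R => h^-1 *: ((W \o shift (x + t *: p)) (h *: p) - W (x + t *: p))).
  apply/funext => h /=; congr (_ *: (W _ - _)).
  by rewrite /GRing.scale /= mulr1 -/(GRing.scale _ _) scalerDl addrCA.
by split; [rewrite /derivable E|rewrite /derive E].
Qed.

Lemma derive_line_bound W p x (s M : R) : (forall t, derivable W (x + t *: p) p) ->
  (forall t, `|'D_p W (x + t *: p)| <= M) ->
  `|W (x + s *: p) - W x| <= M * `|s|.
Proof.
move=> dW MW.
pose f t := W (x + t *: p).
have df (t : R) : is_derive t 1 f ('D_p W (x + t *: p)) by exact: is_derive_line.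
have cf : continuous f.
  move=> t; apply: differentiable_continuous; apply/derivable1_diffP.
  exact: (@ex_derive _ _ _ _ _ _ _ (df t)).
have -> : W (x + s *: p) - W x = f s - f 0 by rewrite /f scale0r addr0.
have [s0|s0] := leP 0 s.
  have [|c _ ->] := @MVT_segment R f (fun t => 'D_p W (x + t *: p)) 0 s s0
      (fun t _ => df t).
    exact: continuous_subspaceT.
  by rewrite subr0 normrM ler_wpM2r.
rewrite distrC.
have [|c _ ->] := @MVT_segment R f (fun t => 'D_p W (x + t *: p)) s 0 (ltW s0)
    (fun t _ => df t).
  exact: continuous_subspaceT.
by rewrite sub0r normrM normrN ler_wpM2r.
Qed.

Lemma derive_shift W p v x : 'D_p (fun y => W (y + v)) x = 'D_p W (x + v).
Proof.
rewrite /derive; congr (lim (_ @ 0^')); apply/funext => h /=.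
by rewrite addrA.
Qed.

Lemma derivable_shift W p v x : derivable W (x + v) p ->
  derivable (fun y => W (y + v)) x p.
Proof.
rewrite /derivable; rewrite [X in _ -> cvg (X @ _)](_ : _ =
  (fun h : R => h^-1 *: ((W \o shift (x + v)) (h *: p) - W (x + v))))//.
by apply/funext => h /=; rewrite addrA.
Qed.

Lemma cvg_difference_quotient W p x (s : nat -> R) : derivable W x p ->
  (forall m, s m != 0) -> s @ \oo --> 0 ->
  (fun m => (s m)^-1 * (W (x + s m *: p) - W x)) @ \oo --> 'D_p W x.
Proof.
move=> dW s0 s_0.
have h : s @ \oo --> 0^'.
  move=> A hA; have := s_0 _ hA; rewrite /nbhs /=.
  by apply: filterS => m; exact.
rewrite [X in X @ _](_ : _ =
  (fun h : R => h^-1 *: ((W \o shift x) (h *: p) - W x)) \o s).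
  exact: cvg_comp h dW.
by apply/funext => m; rewrite /= [s m *: p + x]addrC.
Qed.

End directional.

Section null_lagrangian.
Context {R : realType} {n : nat}.
Implicit Types (x y v p q : 'rV[R]_n) (F G W : 'rV[R]_n -> R).
Local Notation mu := (@lebesgue_rV R n).

Let step m : R := m.+1%:R^-1.

Let step_neq0 m : step m != 0. Proof. by rewrite invr_neq0. Qed.

Let step_le1 m : `|step m| <= 1.
Proof. by rewrite ger0_norm ?invr_ge0// invf_le1// ler1n. Qed.

Let cvg_step : step @ \oo --> 0. Proof. exact: cvg_harmonic. Qed.

Let cvg_stepN : (fun m => - step m) @ \oo --> 0.
Proof. by rewrite -[X in _ --> X]oppr0; apply: cvgN; exact: cvg_step. Qed.

Lemma measurable_comp_translation F v : measurable_fun setT F ->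
  measurable_fun setT (fun x => F (x + v)).
Proof. by move=> mF; apply: measurableT_comp => //; exact: measurable_translation. Qed.

Lemma difference_quotient_bound W p (M : R) : (forall x, derivable W x p) ->
  (forall x, `|'D_p W x| <= M) -> forall s x, s != 0 ->
  `|s^-1 * (W (x + s *: p) - W x)| <= M.
Proof.
move=> dW MW s x s0; rewrite normrM normfV ler_pdivrMl ?normr_gt0// mulrC.
exact: derive_line_bound.
Qed.

(** The derivative is the bounded limit of difference quotients, whose integrals
vanish by translation invariance. *)
Lemma Rintegral_derive0 W p (r r' M : R) :
  (forall x, derivable W x p) -> (forall x, `|W x| <= M) ->
  (forall x, `|'D_p W x| <= M) -> measurable_fun setT W ->
  measurable_fun setT (fun x => 'D_p W x) ->
  (forall x, W x != 0 -> cube r x) -> r + `|p| <= r' ->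
  \int[mu]_(x in cube r') ('D_p W x) = 0.
Proof.
move=> dW WM DWM mW mDW W0 rr'.
pose h m x := (step m)^-1 * (W (x + step m *: p) - W x).
have mD : measurable (cube r' : set 'rV[R]_n) := measurable_cube r'.
have Doo := @lebesgue_rV_cube_fin R n r'.
have bW v : bounded_measurable (cube r') (fun x => W (x + v)).
  split; last by exists M.
  by apply: measurable_funTS; exact: measurable_comp_translation.
have bW0 : bounded_measurable (cube r') W.
  by split; [exact: measurable_funTS|exists M].
have h0 m : \int[mu]_(x in cube r') h m x = 0.
  rewrite RintegralZ_bounded//; last exact: bounded_measurableB.
  rewrite RintegralB_bounded// (Rintegral_shift (r := r))// ?subrr ?mulr0//.
  by apply: le_trans rr'; rewrite lerD2l normrZ ler_piMl.
have cv : (fun m => \int[mu]_(x in cube r') h m x) @ \oo -->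
    \int[mu]_(x in cube r') ('D_p W x).
  apply: (@bounded_convergence _ _ _ mu _ mD Doo _ _ M).
  - move=> m; have [] // : bounded_measurable (cube r') (h m).
    apply: bounded_measurableM; first exact: bounded_measurable_cst.
    exact: bounded_measurableB.
  - exact: measurable_funTS.
  - by move=> m x _; exact: difference_quotient_bound.
  - by move=> x _; exact: cvg_difference_quotient.
rewrite (_ : (fun m => _) = fun=> 0) in cv; last by apply/funext => m; exact: h0.
by apply/esym/(cvg_unique _ _ cv) => //; exact: cvg_cst.
Qed.

(** Integrating by parts twice would require second derivatives of G.  Instead, the
derivative of G along q is replaced with a difference quotient DG; then an
integration by parts along p is legitimate, and the difference operator is moved
from the derivative of G to F by a translation. *)
Lemma Rintegral_null_lagrangian F G p q (r r' M : R) :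
  (forall x, derivable F x p /\ derivable F x q) ->
  (forall x, derivable G x p /\ derivable G x q) ->
  measurable_fun setT F -> measurable_fun setT G ->
  measurable_fun setT (fun x => 'D_p F x) -> measurable_fun setT (fun x => 'D_q F x) ->
  measurable_fun setT (fun x => 'D_p G x) -> measurable_fun setT (fun x => 'D_q G x) ->
  (forall x, [/\ `|F x| <= M, `|'D_p F x| <= M & `|'D_q F x| <= M]) ->
  (forall x, [/\ `|G x| <= M, `|'D_p G x| <= M & `|'D_q G x| <= M]) ->
  (forall x, F x != 0 -> cube r x) -> (forall x, 'D_p G x != 0 -> cube r x) ->
  r + `|p| + `|q| <= r' ->
  \int[mu]_(x in cube r') ('D_p F x * 'D_q G x - 'D_q F x * 'D_p G x) = 0.
Proof.
move=> dF dG mF mG mFp mFq mGp mGq FM GM F0 G0 rr'.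
have F1 x : `|F x| <= M by have [] := FM x.
have F2 x : `|'D_p F x| <= M by have [] := FM x.
have F3 x : `|'D_q F x| <= M by have [] := FM x.
have G1 x : `|G x| <= M by have [] := GM x.
have G2 x : `|'D_p G x| <= M by have [] := GM x.
have G3 x : `|'D_q G x| <= M by have [] := GM x.
have M0 : 0 <= M := le_trans (normr_ge0 _) (F1 0).
have mD : measurable (cube r' : set 'rV[R]_n) := measurable_cube r'.
have Doo := @lebesgue_rV_cube_fin R n r'.
pose DG m x := (step m)^-1 * (G (x + step m *: q) - G x).
pose W m x := F x * DG m x.
have bm (f : 'rV[R]_n -> R) : measurable_fun setT f -> (forall x, `|f x| <= M) ->
    forall v, bounded_measurable (cube r') (fun x => f (x + v)).
  move=> mf fM v; split; last by exists M => x _; exact: fM.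
  by apply: measurable_funTS; exact: measurable_comp_translation.
have bm0 (f : 'rV[R]_n -> R) : measurable_fun setT f -> (forall x, `|f x| <= M) ->
    bounded_measurable (cube r') f.
  by move=> mf fM; split; [exact: measurable_funTS|exists M].
have bF := bm F mF F1.
have bGp := bm _ mGp G2.
have bF0 := bm0 F mF F1.
have bGp0 := bm0 _ mGp G2.
have bFp0 := bm0 _ mFp F2.
have mDG m : measurable_fun setT (DG m).
  apply: measurable_funM; first exact: measurable_cst.
  by apply: measurable_funB => //; exact: measurable_comp_translation.
have DGM m x : `|DG m x| <= M.
  by apply: difference_quotient_bound => // y; have [] := dG y.
have bDG m := bm0 _ (mDG m) (DGM m).
have dDG m x : is_derive x p (DG m) ((step m)^-1 *
    ('D_p G (x + step m *: q) - 'D_p G x)).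
  have d1 : is_derive x p (fun y => G (y + step m *: q)) ('D_p G (x + step m *: q)).
    rewrite -derive_shift; apply: DeriveDef => //.
    by apply: derivable_shift; have [] := dG (x + step m *: q).
  have d2 : is_derive x p G ('D_p G x) by apply: DeriveDef => //; have [] := dG x.
  have := is_deriveZ (step m)^-1 (is_deriveB d1 d2).
  by [].
have dW m x : is_derive x p (W m) ('D_p F x * DG m x + F x * ((step m)^-1 *
    ('D_p G (x + step m *: q) - 'D_p G x))).
  have d1 : is_derive x p F ('D_p F x) by apply: DeriveDef => //; have [] := dF x.
  apply: (is_derive_eq (is_deriveM d1 (dDG m x))).
  by rewrite /GRing.scale /= addrC [_ * 'D_p F x]mulrC.
pose h m x := 'D_p F x * DG m x + (step m)^-1 * (F (x + - step m *: q) - F x) * 'D_p G x.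
have h0 m : \int[mu]_(x in cube r') h m x = 0.
  have DWE x : 'D_p (W m) x = 'D_p F x * DG m x +
     F x * ((step m)^-1 * ('D_p G (x + step m *: q) - 'D_p G x)).
    by rewrite (@derive_val _ _ _ _ _ _ _ (dW m x)).
  pose M' := M * M + M * (`|(step m)^-1| * (M + M)).
  have M'0 : 0 <= M * (`|(step m)^-1| * (M + M)).
    by apply: mulr_ge0 => //; apply: mulr_ge0 => //; exact: addr_ge0.
  have := @Rintegral_derive0 (W m) p r r' M'.
  have -> : (\int[mu]_(x in cube r') 'D_p (W m) x = \int[mu]_(x in cube r')
     ('D_p F x * DG m x + (step m)^-1 * (F x * 'D_p G (x + step m *: q)
        - F x * 'D_p G x))).
    by apply: eq_Rintegral_on => x _; rewrite DWE; ring.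
  have -> : (\int[mu]_(x in cube r') h m x = \int[mu]_(x in cube r')
     ('D_p F x * DG m x + (step m)^-1 * (F (x + - step m *: q) * 'D_p G x
        - F x * 'D_p G x))).
    by apply: eq_Rintegral_on => x _; rewrite /h; ring.
  have b1 : bounded_measurable (cube r') (fun x => 'D_p F x * DG m x).
    exact: bounded_measurableM.
  have b2 : bounded_measurable (cube r') (fun x => F x * 'D_p G x).
    exact: bounded_measurableM.
  have b3 : bounded_measurable (cube r') (fun x => F x * 'D_p G (x + step m *: q)).
    by apply: bounded_measurableM.
  have b4 : bounded_measurable (cube r') (fun x => F (x + - step m *: q) * 'D_p G x).
    by apply: bounded_measurableM.
  have split3 (f1 f2 f3 : 'rV[R]_n -> R) : bounded_measurable (cube r') f1 ->
     bounded_measurable (cube r') f2 -> bounded_measurable (cube r') f3 ->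
     \int[mu]_(x in cube r') (f1 x + (step m)^-1 * (f2 x - f3 x)) =
     \int[mu]_(x in cube r') f1 x + (step m)^-1 *
       (\int[mu]_(x in cube r') f2 x - \int[mu]_(x in cube r') f3 x).
    move=> bf1 bf2 bf3; have b23 := bounded_measurableB bf2 bf3.
    rewrite RintegralD_bounded ?RintegralZ_bounded ?RintegralB_bounded//.
    by apply: bounded_measurableM => //; exact: bounded_measurable_cst.
  rewrite !split3//.
  have <- : (\int[mu]_(x in cube r') (F x * 'D_p G (x + step m *: q)) =
     \int[mu]_(x in cube r') (F (x + - step m *: q) * 'D_p G x)).
    rewrite -(@Rintegral_shift _ _ (step m *: q)
      (fun x => F (x + - step m *: q) * 'D_p G x) r r').
    - by apply: eq_Rintegral_on => x _; rewrite scaleNr addrK.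
    - by apply: measurable_funM => //; exact: measurable_comp_translation.
    - by move=> x; rewrite mulf_eq0 negb_or => /andP[_ /G0].
    - apply: le_trans rr'; rewrite -addrA lerD2l.
      by rewrite normrZ (le_trans (ler_piMl _ (step_le1 m)))// lerDr.
  apply.
  - by move=> x; exact: (@ex_derive _ _ _ _ _ _ _ (dW m x)).
  - move=> x; rewrite /W normrM; apply: (@le_trans _ _ (M * M)); last by rewrite lerDl.
    exact: ler_pM.
  - move=> x; rewrite DWE; apply: le_trans (ler_normD _ _) _.
    apply: lerD; first by rewrite normrM; apply: ler_pM.
    rewrite 2!normrM; apply: ler_pM => //; apply: ler_wpM2l => //.
    by apply: le_trans (ler_normB _ _) _; rewrite lerD.
  - exact: measurable_funM.
  - rewrite (_ : (fun x => _) = (fun x => 'D_p F x * DG m x +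
     F x * ((step m)^-1 * ('D_p G (x + step m *: q) - 'D_p G x)))).
      apply: measurable_funD; first exact: measurable_funM.
      apply: measurable_funM => //.
      apply: measurable_funM; first exact: measurable_cst.
      by apply: measurable_funB => //; exact: (@measurable_comp_translation (fun x => 'D_p G x)).
    by apply/funext => x; exact: DWE.
  - by move=> x; rewrite mulf_eq0 negb_or => /andP[/F0].
  - by apply: le_trans rr'; rewrite lerDl.
have cv : (fun m => \int[mu]_(x in cube r') h m x) @ \oo -->
    \int[mu]_(x in cube r') ('D_p F x * 'D_q G x - 'D_q F x * 'D_p G x).
  apply: (@bounded_convergence _ _ _ mu _ mD Doo _ _ (M * M + M * M)).
  - move=> m; have [] // : bounded_measurable (cube r') (h m).
    apply: bounded_measurableD; first exact: bounded_measurableM.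
    apply: bounded_measurableM => //.
    apply: bounded_measurableM; first exact: bounded_measurable_cst.
    by apply: bounded_measurableB.
  - by apply: measurable_funB; apply: measurable_funM; exact: measurable_funTS.
  - move=> m x _; apply: le_trans (ler_normD _ _) _.
    apply: lerD; rewrite normrM; apply: ler_pM => //.
    have := @difference_quotient_bound F q M _ _ (- step m) x.
    rewrite oppr_eq0 step_neq0 invrN mulNr normrN normrM; apply => //.
    by move=> y; have [] := dF y.
  - move=> x _; apply: cvgD.
      apply: cvgMr; apply: cvg_difference_quotient => //; by have [] := dG x.
    rewrite -mulNr; apply: cvgMl.
    rewrite (_ : (fun m => _) = (fun m => - ((- step m)^-1 *
        (F (x + - step m *: q) - F x)))); last first.
      by apply/funext => m; rewrite invrN mulNr opprK.
    apply: cvgN; apply: cvg_difference_quotient; first by have [] := dF x.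
      by move=> m; rewrite oppr_eq0.
    exact: cvg_stepN.
rewrite (_ : (fun m => _) = fun=> 0) in cv; last by apply/funext => m; exact: h0.
by apply/esym/(cvg_unique _ _ cv) => //; exact: cvg_cst.
Qed.

End null_lagrangian.

(** * A step function of class C^1 *)

Section smooth_step.
Context {R : realType}.
Implicit Types (t h : R).

Definition pos_square t : R := Num.max t 0 ^+ 2.

(** The piecewise quadratic function with second derivative 4 on [0, 1/2], -4 on
[1/2, 1] and 0 elsewhere. *)
Definition smoothstep t : R :=
  2 * pos_square t - 4 * pos_square (t - 2^-1) + 2 * pos_square (t - 1).

Definition dsmoothstep t : R :=
  4 * Num.max t 0 - 8 * Num.max (t - 2^-1) 0 + 4 * Num.max (t - 1) 0.

Lemma is_derive_quadratic (f : R -> R) t (d C : R) :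
  (forall h, `|f (t + h) - f t - d * h| <= C * h ^+ 2) -> is_derive t 1 f d.
Proof.
move=> hf.
have cv : h^-1 *: ((f \o shift t) (h *: 1) - f t) @[h --> 0^'] --> d.
  apply/cvgrPdist_le => e e0.
  have C0 : 0 < `|C| + 1 by rewrite ltr_wpDl.
  have ec : 0 < e / (`|C| + 1) by rewrite divr_gt0.
  near=> h; rewrite /= distrC.
  have hn0 : h != 0 by near: h; exact: nbhs_dnbhs_neq.
  rewrite [h *: 1]mulr1 [h + t]addrC.
  have -> : h^-1 *: (f (t + h) - f t) - d = h^-1 * (f (t + h) - f t - d * h).
    by rewrite mulrBr [d * h]mulrC mulKf.
  rewrite normrM normfV ler_pdivrMl ?normr_gt0//; apply: le_trans (hf h) _.
  rewrite -real_normK ?num_real// expr2 mulrCA ler_wpM2l//.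
  have : `|h| <= e / (`|C| + 1) by near: h; exact: dnbhs0_le.
  rewrite ler_pdivlMr// => H; apply: le_trans H; rewrite mulrC.
  by apply: ler_wpM2l => //; rewrite ler_wpDr// ler_norm.
split; first exact: cvgP cv.
exact: cvg_lim.
Unshelve. all: by end_near. Qed.

Lemma pos_square_quadratic t h :
  `|pos_square (t + h) - pos_square t - 2 * Num.max t 0 * h| <= h ^+ 2.
Proof.
rewrite ler_norml /pos_square; case: (leP t 0) => t0; case: (leP (t + h) 0) => th0;
  apply/andP; split; nra.
Qed.

Lemma is_derive_smoothstep t : is_derive t 1 smoothstep (dsmoothstep t).
Proof.
apply: (@is_derive_quadratic _ _ _ 8) => h.
have := pos_square_quadratic t h; have := pos_square_quadratic (t - 2^-1) h.
have := pos_square_quadratic (t - 1) h.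
rewrite /smoothstep /dsmoothstep ![t + h - _]addrAC !ler_norml.
set a := pos_square (t + h); set b := pos_square (t - 2^-1 + h); set c := pos_square (t - 1 + h).
move=> /andP[? ?] /andP[? ?] /andP[? ?]; apply/andP; split; lra.
Qed.

Lemma smoothstep_ge1 t : 1 <= t -> smoothstep t = 1.
Proof.
move=> t1; rewrite /smoothstep /pos_square.
have -> : Num.max t 0 = t by apply/max_idPl; lra.
have -> : Num.max (t - 2^-1) 0 = t - 2^-1 by apply/max_idPl; lra.
have -> : Num.max (t - 1) 0 = t - 1 by apply/max_idPl; lra.
by field.
Qed.

Lemma dsmoothstep_ge1 t : 1 <= t -> dsmoothstep t = 0.
Proof.
move=> t1; rewrite /dsmoothstep.
have -> : Num.max t 0 = t by apply/max_idPl; lra.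
have -> : Num.max (t - 2^-1) 0 = t - 2^-1 by apply/max_idPl; lra.
have -> : Num.max (t - 1) 0 = t - 1 by apply/max_idPl; lra.
by field.
Qed.

Lemma smoothstep_le0 t : t <= 0 -> smoothstep t = 0.
Proof.
move=> t1; rewrite /smoothstep /pos_square.
have -> : Num.max t 0 = 0 by apply/max_idPr; lra.
have -> : Num.max (t - 2^-1) 0 = 0 by apply/max_idPr; lra.
have -> : Num.max (t - 1) 0 = 0 by apply/max_idPr; lra.
by ring.
Qed.

Lemma dsmoothstep_le0 t : t <= 0 -> dsmoothstep t = 0.
Proof.
move=> t1; rewrite /dsmoothstep.
have -> : Num.max t 0 = 0 by apply/max_idPr; lra.
have -> : Num.max (t - 2^-1) 0 = 0 by apply/max_idPr; lra.
have -> : Num.max (t - 1) 0 = 0 by apply/max_idPr; lra.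
by ring.
Qed.

Lemma smoothstep_bound t : 0 <= smoothstep t <= 1.
Proof.
have [t0|t0] := leP t 0; first by rewrite smoothstep_le0// lexx ler01.
have [t1|t1] := leP 1 t; first by rewrite smoothstep_ge1// lexx ler01.
rewrite /smoothstep /pos_square.
have -> : Num.max t 0 = t by apply/max_idPl; lra.
have -> : Num.max (t - 1) 0 = 0 by apply/max_idPr; lra.
by case: (leP (t - 2^-1) 0) => h; apply/andP; split; nra.
Qed.

Lemma dsmoothstep_bound t : `|dsmoothstep t| <= 2.
Proof.
have [t0|t0] := leP t 0; first by rewrite dsmoothstep_le0// normr0.
have [t1|t1] := leP 1 t; first by rewrite dsmoothstep_ge1// normr0.
rewrite /dsmoothstep ler_norml.
have -> : Num.max t 0 = t by apply/max_idPl; lra.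
have -> : Num.max (t - 1) 0 = 0 by apply/max_idPr; lra.
by case: (leP (t - 2^-1) 0) => h; apply/andP; split; lra.
Qed.

Lemma continuous_dsmoothstep : continuous dsmoothstep.
Proof.
have cm (a : R) : continuous (fun t : R => Num.max (t - a) 0).
  move=> t; apply: (@continuous_max _ _ (fun t => t - a) (fun=> 0)); last exact: cvg_cst.
  by apply: cvgB; [exact: cvg_id|exact: cvg_cst].
have cm0 : continuous (fun t : R => Num.max t 0).
  by move=> t; apply: (@continuous_max _ _ id (fun=> 0)); [exact: cvg_id|exact: cvg_cst].
move=> t; rewrite /dsmoothstep.
by apply: cvgD; [apply: cvgB|]; apply: cvgM; try exact: cvg_cst;
  [exact: cm0|exact: cm|exact: cm].
Qed.

Lemma continuous_smoothstep : continuous smoothstep.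
Proof.
move=> t; apply: differentiable_continuous; apply/derivable1_diffP.
exact: (@ex_derive _ _ _ _ _ _ _ (is_derive_smoothstep t)).
Qed.

End smooth_step.

(** * Functions with bounded derivatives on a bounded open set *)

Section C1_functions.
Context {R : realType} {n : nat}.
Variables (Omega : set 'rV[R]_n) (r : R).
Hypotheses (oO : open Omega) (Or : Omega `<=` cube r).
Implicit Types (x y v p q : 'rV[R]_n) (f g F G : 'rV[R]_n -> R).
Local Notation mu := (@lebesgue_rV R n).

(** Compared with C1_closure, continuity of the derivatives up to the boundary is
replaced with what integration needs: a property stable under products and
composition with smoothstep. *)
Definition C1_bounded f :=
  [/\ forall x, Omega x -> differentiable f x,
      forall x, closure Omega x -> f @ within (closure Omega) (nbhs x) --> f x,
      bounded_measurable Omega f &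
      forall p, bounded_measurable Omega (fun x => 'D_p f x)].

Lemma measurable_domain : measurable Omega.
Proof. exact: open_measurable_rV. Qed.

Lemma domain_fin : (mu Omega < +oo)%E.
Proof.
apply: le_lt_trans (lebesgue_rV_cube_fin r); apply: le_measure; rewrite ?inE//.
  exact: measurable_domain.
exact: measurable_cube.
Qed.

Lemma derive_mul f g x p : differentiable f x -> differentiable g x ->
  'D_p (fun y => f y * g y) x = f x * 'D_p g x + g x * 'D_p f x.
Proof. by move=> df dg; apply: deriveM; exact: diff_derivable. Qed.

Lemma derive_sub f g x p : differentiable f x -> differentiable g x ->
  'D_p (fun y => f y - g y) x = 'D_p f x - 'D_p g x.
Proof. by move=> df dg; apply: deriveB; exact: diff_derivable. Qed.

Lemma derive_add f g x p : differentiable f x -> differentiable g x ->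
  'D_p (fun y => f y + g y) x = 'D_p f x + 'D_p g x.
Proof. by move=> df dg; apply: deriveD; exact: diff_derivable. Qed.

Lemma derive_vector f x (a : R) p q : differentiable f x ->
  'D_(a *: p + q) f x = a * 'D_p f x + 'D_q f x.
Proof. by move=> df; rewrite !deriveE// linearP. Qed.

Lemma differentiable_smoothstep (t : R) : differentiable (@smoothstep R) t.
Proof.
apply/derivable1_diffP; exact: (@ex_derive _ _ _ _ _ _ _ (is_derive_smoothstep t)).
Qed.

Lemma derive_smoothstep f x p : differentiable f x ->
  'D_p (fun y => smoothstep (f y)) x = dsmoothstep (f x) * 'D_p f x.
Proof.
move=> df; rewrite deriveE; last first.
  exact: (differentiable_comp df (differentiable_smoothstep _)).
rewrite (diff_comp df (differentiable_smoothstep _)) /= -(deriveE _ df).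
set h := 'D_p f x.
transitivity ('d (@smoothstep R) (f x) (h *: (1 : R))).
  by apply: f_equal; rewrite /GRing.scale /= mulr1.
rewrite linearZ /= -deriveE; last exact: differentiable_smoothstep.
by rewrite (@derive_val _ _ _ _ _ _ _ (is_derive_smoothstep _)) /GRing.scale /= mulrC.
Qed.

Lemma C1_bounded_cst (a : R) : C1_bounded (fun=> a).
Proof.
split.
- by move=> x _.
- by move=> x _; exact: cvg_cst.
- exact: bounded_measurable_cst.
- move=> p; apply: (@eq_bounded_measurable _ _ _ _ (fun=> 0)).
    by move=> x _; rewrite derive_cst.
  exact: bounded_measurable_cst.
Qed.

Lemma C1_boundedM f g : C1_bounded f -> C1_bounded g -> C1_bounded (fun x => f x * g x).
Proof.
move=> [df cf bf bDf] [dg cg bg bDg]; split.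
- by move=> x Ox; apply: differentiableM; [exact: df|exact: dg].
- by move=> x Ox; apply: cvgM; [exact: cf|exact: cg].
- exact: bounded_measurableM.
- move=> p; apply: (@eq_bounded_measurable _ _ _ _
    (fun x => f x * 'D_p g x + g x * 'D_p f x)).
    by move=> x Ox; rewrite derive_mul//; [exact: df|exact: dg].
  by apply: bounded_measurableD; exact: bounded_measurableM.
Qed.

Lemma C1_boundedD f g : C1_bounded f -> C1_bounded g -> C1_bounded (fun x => f x + g x).
Proof.
move=> [df cf bf bDf] [dg cg bg bDg]; split.
- by move=> x Ox; apply: differentiableD; [exact: df|exact: dg].
- by move=> x Ox; apply: cvgD; [exact: cf|exact: cg].
- exact: bounded_measurableD.
- move=> p; apply: (@eq_bounded_measurable _ _ _ _ (fun x => 'D_p f x + 'D_p g x)).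
    by move=> x Ox; rewrite derive_add//; [exact: df|exact: dg].
  by apply: bounded_measurableD.
Qed.

Lemma C1_boundedZ (a : R) f : C1_bounded f -> C1_bounded (fun x => a * f x).
Proof. by move=> Cf; apply: C1_boundedM => //; exact: C1_bounded_cst. Qed.

Lemma C1_boundedB f g : C1_bounded f -> C1_bounded g -> C1_bounded (fun x => f x - g x).
Proof.
move=> Cf Cg; rewrite (_ : (fun x => _) = (fun x => f x + (-1) * g x)).
  by apply: C1_boundedD => //; exact: C1_boundedZ.
by apply/funext => x; rewrite mulN1r.
Qed.

Lemma C1_bounded_sum (I : Type) (s : seq I) (h : I -> 'rV[R]_n -> R) :
  (forall i, C1_bounded (h i)) -> C1_bounded (fun x => \sum_(i <- s) h i x).
Proof.
move=> Ch; elim: s => [|i s IH].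
  rewrite (_ : (fun x => _) = fun=> 0); first exact: C1_bounded_cst.
  by apply/funext => x; rewrite big_nil.
rewrite (_ : (fun x => _) = (fun x => h i x + \sum_(j <- s) h j x)).
  exact: C1_boundedD.
by apply/funext => x; rewrite big_cons.
Qed.

Lemma C1_bounded_smoothstep f : C1_bounded f -> C1_bounded (fun x => smoothstep (f x)).
Proof.
move=> [df cf bf bDf]; split.
- move=> x Ox; exact: (differentiable_comp (df _ Ox) (differentiable_smoothstep _)).
- move=> x Ox; apply: (@cvg_comp _ _ _ f (@smoothstep R) _ (nbhs (f x))).
    exact: cf.
  exact: continuous_smoothstep.
- split; last first.
    by exists 1 => x _; rewrite ger0_norm; case/andP: (smoothstep_bound (f x)).
  apply: measurableT_comp; last by case: bf.
  by apply: continuous_measurable_fun; exact: continuous_smoothstep.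
- move=> p; apply: (@eq_bounded_measurable _ _ _ _ (fun x => dsmoothstep (f x) * 'D_p f x)).
    by move=> x Ox; rewrite derive_smoothstep//; exact: df.
  apply: bounded_measurableM => //; split.
    apply: measurableT_comp; last by case: bf.
    by apply: continuous_measurable_fun; exact: continuous_dsmoothstep.
  by exists 2 => x _; exact: dsmoothstep_bound.
Qed.

Lemma C1_bounded_dotv a : C1_bounded (dotv a).
Proof.
split.
- by move=> x _; exact: differentiable_dotv.
- by move=> x _; apply: cvg_within_filter; exact: continuous_dotv.
- split; first by apply: measurable_dotv; exact: measurable_domain.
  exists (\sum_i `|a 0 i| * r) => x /Or xr.
  apply: le_trans (ler_norm_sum _ _ _) _; apply: ler_sum => i _.
  rewrite normrM ler_wpM2l// ltW//; exact: le_lt_trans (le_coord_norm _ _) xr.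
- move=> p; apply: (@eq_bounded_measurable _ _ _ _ (fun=> dotv a p)).
    by move=> x _; rewrite derive_dotv.
  exact: bounded_measurable_cst.
Qed.

End C1_functions.

(** * Null Lagrangians on a bounded open set *)

Section null_lagrangian_domain.
Context {R : realType} {n : nat}.
Variables (Omega : set 'rV[R]_n) (r : R).
Hypotheses (oO : open Omega) (Or : Omega `<=` cube r).
Implicit Types (x y v p q : 'rV[R]_n) (f g F G : 'rV[R]_n -> R).
Local Notation mu := (@lebesgue_rV R n).

(** The value of df /\ dg on the pair of vectors p, q. *)
Definition bracket p q f g x : R := 'D_p f x * 'D_q g x - 'D_q f x * 'D_p g x.

Lemma derive_span f x p : differentiable f x ->
  'D_p f x = \sum_(j < n) p 0 j * partial j f x.
Proof.
move=> df; rewrite deriveE// [in LHS](row_sum_delta p) linear_sum.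
by apply: eq_bigr => j _; rewrite linearZ /= -deriveE.
Qed.

(** The closure is compact, so continuous extensions to it are bounded. *)
Lemma C1_closure_C1_bounded f : C1_closure Omega f -> C1_bounded Omega f.
Proof.
move=> [df cf Df].
have cO : compact (closure Omega).
  apply: bounded_closed_compact; last exact: closed_closure.
  exists r; split; first exact: num_real.
  move=> M rM x; rewrite closureE => /(_ [set y | `|y| <= M]); apply.
  split; last by move=> y /Or /= yr; exact: ltW (lt_trans yr rM).
  rewrite (_ : mkset _ = Num.norm @^-1` [set y | y <= M])//.
  by apply: closed_comp; [move=> y _; exact: norm_continuous|exact: closed_le].
have sub : Omega `<=` closure Omega := @subset_closure _ Omega.
have bound (g : 'rV[R]_n -> R) : {within closure Omega, continuous g} ->
    bounded_measurable Omega g.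
  move=> cg; split.
    apply: continuous_measurable_rV => // x; rewrite inE => Ox.
    have /subspace_continuousP/(_ _ (sub _ Ox)) := cg.
    rewrite within_interior//; apply: (interiorS sub).
    by have /interior_id -> := oO.
  have /compact_bounded[M [_ hM]] := continuous_compact cg cO.
  exists (M + 1) => x Ox; apply: (hM (M + 1)); first by rewrite ltrDl.
  by exists x => //; exact: sub.
split => //.
- by apply/subspace_continuousP.
- exact: bound.
- move=> p; apply: (@eq_bounded_measurable _ _ _ _
    (fun x => \sum_(j < n) p 0 j * partial j f x)).
    by move=> x Ox; rewrite -derive_span//; exact: df.
  apply: bounded_measurable_sum => j _; apply: bounded_measurableM.
    exact: bounded_measurable_cst.
  have [g cg gE] := Df j; apply: (eq_bounded_measurable gE); exact: bound.
Qed.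

Lemma C1_bounded_bracket p q f g : C1_bounded Omega f -> C1_bounded Omega g ->
  bounded_measurable Omega (bracket p q f g).
Proof.
move=> [_ _ _ bf] [_ _ _ bg].
by apply: bounded_measurableB; exact: bounded_measurableM.
Qed.

Let vanish_near_boundary f := forall x, ~ Omega x ->
  \forall y \near x, Omega y -> f y = 0.

Let is_derive_restrict f p x : C1_bounded Omega f -> vanish_near_boundary f ->
  is_derive x p (f \_ Omega) (((fun y => 'D_p f y) \_ Omega) x).
Proof.
move=> [df _ _ _] f0; rewrite {2}/patch; case: ifPn => [|/negP]; rewrite inE => Ox.
  apply: (@near_eq_is_derive _ _ _ f).
    near=> y; rewrite /patch ifT// inE; near: y; exact: open_nbhs_nbhs.
  apply: DeriveDef => //; apply: diff_derivable; exact: df.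
apply: (@near_eq_is_derive _ _ _ (fun=> 0)).
near=> y; rewrite /patch; case: ifPn => //; rewrite inE => Oy.
have : Omega y -> f y = 0 by near: y; exact: f0.
by move=> ->.
Unshelve. all: by end_near. Qed.

Let bound_restrict f : bounded_measurable Omega f ->
  exists2 M, 0 <= M & forall x, `|(f \_ Omega) x| <= M.
Proof.
move=> [_ [M hM]]; exists `|M| => // x; rewrite /patch; case: ifPn => [|_].
  by rewrite inE => /hM h; apply: le_trans h (ler_norm _).
by rewrite normr0.
Qed.

Let measurable_restrict_domain f : bounded_measurable Omega f ->
  measurable_fun setT (f \_ Omega).
Proof.
move=> [mf _]; apply/(measurable_restrictT _ _).1 => //; exact: measurable_domain.
Qed.

(** Extended by zero, f and g are differentiable on the whole space. *)
Lemma Rintegral_bracket_compact f g p q : C1_bounded Omega f -> C1_bounded Omega g ->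
  vanish_near_boundary f -> vanish_near_boundary g ->
  \int[mu]_(x in Omega) bracket p q f g x = 0.
Proof.
move=> Cf Cg f0 g0.
have Df v x := @is_derive_restrict f v x Cf f0.
have Dg v x := @is_derive_restrict g v x Cg g0.
have DfE v : (fun x => 'D_v (f \_ Omega) x) = (fun y => 'D_v f y) \_ Omega.
  by apply/funext => x; rewrite (@derive_val _ _ _ _ _ _ _ (Df v x)).
have DgE v : (fun x => 'D_v (g \_ Omega) x) = (fun y => 'D_v g y) \_ Omega.
  by apply/funext => x; rewrite (@derive_val _ _ _ _ _ _ _ (Dg v x)).
have [_ _ bf bDf] := Cf; have [_ _ bg bDg] := Cg.
have [M1 p1 h1] := bound_restrict bf.
have [M2 p2 h2] := bound_restrict (bDf p).
have [M3 p3 h3] := bound_restrict (bDf q).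
have [M4 p4 h4] := bound_restrict bg.
have [M5 p5 h5] := bound_restrict (bDg p).
have [M6 p6 h6] := bound_restrict (bDg q).
have supp (h : 'rV[R]_n -> R) x : (h \_ Omega) x != 0 -> cube r x.
  by rewrite /patch; case: ifPn => [|_ /eqP//]; rewrite inE => /Or.
have := @Rintegral_null_lagrangian _ _ (f \_ Omega) (g \_ Omega) p q r
  (r + `|p| + `|q|) (M1 + M2 + M3 + M4 + M5 + M6).
have -> : \int[mu]_(x in cube (r + `|p| + `|q|))
   ('D_p (f \_ Omega) x * 'D_q (g \_ Omega) x -
    'D_q (f \_ Omega) x * 'D_p (g \_ Omega) x) =
   \int[mu]_(x in Omega) bracket p q f g x.
  have OE : Omega = cube (r + `|p| + `|q|) `&` Omega.
    apply/esym/setIidr => x /Or; rewrite /cube /= => xr.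
    by apply: lt_le_trans xr _; rewrite -addrA lerDl addr_ge0.
  rewrite [in RHS]OE Rintegral_mkcondr; apply: eq_Rintegral_on => x _.
  have := congr1 (@^~ x) (DfE p); have := congr1 (@^~ x) (DfE q).
  have := congr1 (@^~ x) (DgE p); have := congr1 (@^~ x) (DgE q).
  move=> /= -> -> -> ->; rewrite /patch /bracket; case: ifP => // _.
  by rewrite !mul0r subrr.
apply.
- by move=> x; split; [exact: (@ex_derive _ _ _ _ _ _ _ (Df p x))|
    exact: (@ex_derive _ _ _ _ _ _ _ (Df q x))].
- by move=> x; split; [exact: (@ex_derive _ _ _ _ _ _ _ (Dg p x))|
    exact: (@ex_derive _ _ _ _ _ _ _ (Dg q x))].
- exact: measurable_restrict_domain.
- exact: measurable_restrict_domain.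
- by rewrite DfE; exact: measurable_restrict_domain.
- by rewrite DfE; exact: measurable_restrict_domain.
- by rewrite DgE; exact: measurable_restrict_domain.
- by rewrite DgE; exact: measurable_restrict_domain.
- move=> x; have := congr1 (@^~ x) (DfE p); have := congr1 (@^~ x) (DfE q).
  by move=> /= -> ->; split; [apply: le_trans (h1 x) _|apply: le_trans (h2 x) _|
    apply: le_trans (h3 x) _]; lra.
- move=> x; have := congr1 (@^~ x) (DgE p); have := congr1 (@^~ x) (DgE q).
  by move=> /= -> ->; split; [apply: le_trans (h4 x) _|apply: le_trans (h5 x) _|
    apply: le_trans (h6 x) _]; lra.
- exact: supp.
- move=> x; have := congr1 (@^~ x) (DgE p) => /= ->; exact: supp.
- exact: lexx.
Qed.

End null_lagrangian_domain.

Section null_lagrangian_product.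
Context {R : realType} {n : nat}.
Variables (Omega : set 'rV[R]_n) (r : R).
Hypotheses (oO : open Omega) (Or : Omega `<=` cube r).
Implicit Types (x y v p q : 'rV[R]_n) (f g F G : 'rV[R]_n -> R).
Local Notation mu := (@lebesgue_rV R n).

(** Put H = F G, a = smoothstep (M^2 H^2 - 1) and k = smoothstep (4 M^2 H^2 - 1).
Then a F and k G vanish near the boundary and k = 1 where a is not locally zero.
Because F {H, G} = H {F, G}, the bracket {a F, k G} is {F, G} times a function
T M of H, which is bounded and tends to 1 where H is not 0 as M increases.
Where H = 0, one of F and G is 0, and its derivatives are 0 almost everywhere on
that set by level_set_null. *)
Lemma Rintegral_bracket_product0 F G p q : C1_bounded Omega F -> C1_bounded Omega G ->
  (forall y, closure Omega y -> ~ Omega y -> F y * G y = 0) ->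
  \int[mu]_(x in Omega) bracket p q F G x = 0.
Proof.
move=> CF CG FG0.
have mO := measurable_domain oO; have Ofin := domain_fin oO Or.
pose H x := F x * G x.
have CH : C1_bounded Omega H by exact: C1_boundedM.
pose T (M : R) x : R := smoothstep (M ^+ 2 * H x ^+ 2 - 1) +
   2 * M ^+ 2 * H x ^+ 2 * dsmoothstep (M ^+ 2 * H x ^+ 2 - 1).
have [dF _ bF bDF] := CF; have [dG _ bG bDG] := CG; have [dH cH bH bDH] := CH.
have cutoff (M c : R) : 0 < M -> 0 < c ->
    [/\ C1_bounded Omega (fun x => smoothstep (c * (M ^+ 2 * H x ^+ 2) - 1)),
     (forall x, ~ Omega x -> \forall y \near x, Omega y ->
        smoothstep (c * (M ^+ 2 * H y ^+ 2) - 1) = 0) &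
     (forall x v, Omega x -> 'D_v (fun y => smoothstep (c * (M ^+ 2 * H y ^+ 2) - 1)) x =
        dsmoothstep (c * (M ^+ 2 * H x ^+ 2) - 1) * (c * M ^+ 2 * 2 * H x) * 'D_v H x)].
  move=> M0 c0; split.
  - apply: C1_bounded_smoothstep; apply: C1_boundedB; last exact: C1_bounded_cst.
    by do 2 apply: C1_boundedZ; exact: C1_boundedM.
  - move=> x nOx.
    have [clx|nclx] := pselect (closure Omega x); last first.
      have : \forall y \near x, ~ closure Omega y.
        apply: (@open_nbhs_nbhs _ x (~` closure Omega)); split => //.
        exact/closed_openC/closed_closure.
      by apply: filterS => y ny Oy; exfalso; apply: ny; exact: subset_closure.
    have Hx : H x = 0 by exact: FG0.
    pose e := (c * M ^+ 2 + 1)^-1.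
    have cM0 : 0 < c * M ^+ 2 by rewrite mulr_gt0 ?exprn_gt0.
    have e0 : 0 < e by rewrite invr_gt0 addr_gt0.
    have e1 : e < 1 by rewrite invf_lt1 ?addr_gt0// ltrDr.
    have hn : \forall y \near x, closure Omega y -> `|H x - H y| < e.
      have cHx : H @ within (closure Omega) (nbhs x) --> H x by exact: cH.
      by have /cvgrPdist_lt/(_ _ e0) := cHx; rewrite near_withinE.
    apply: filterS hn => y hy Oy; apply: smoothstep_le0.
    have := hy (subset_closure Oy); rewrite Hx sub0r normrN => Hy.
    rewrite mulrA subr_le0.
    have : H y ^+ 2 <= e.
      rewrite -real_normK ?num_real// expr2.
      apply: le_trans (ltW Hy); rewrite ler_piMl// ltW//; exact: lt_trans e1.
    move=> he; apply: (@le_trans _ _ (c * M ^+ 2 * e)).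
      by rewrite ler_wpM2l// ltW.
    by rewrite /e ler_pdivrMr ?addr_gt0// mul1r lerDl.
  - move=> x v Ox; have dHx := dH x Ox.
    have dHH : differentiable (fun y => H y * H y) x by exact: differentiableM.
    have dcst (a : R) : differentiable (fun _ : 'rV[R]_n => a) x by [].
    have E : (fun y => smoothstep (c * (M ^+ 2 * H y ^+ 2) - 1)) =
       (fun y => smoothstep ((c * M ^+ 2) * (H y * H y) - 1)).
      by apply/funext => y; rewrite expr2 mulrA.
    rewrite E derive_smoothstep; last first.
      by apply: differentiableB => //; apply: differentiableM.
    rewrite derive_sub//; last by apply: differentiableM.
    rewrite derive_mul// derive_mul// !derive_cst expr2 -[M ^+ 2 * _]/(M ^+ 2 * (H x * H x)).
    rewrite [c * (M ^+ 2 * _)]mulrA; ring.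
have step (m : nat) : \int[mu]_(x in Omega) (T m.+1%:R x * bracket p q F G x) = 0.
  set M : R := m.+1%:R.
  have M0 : 0 < M by rewrite ltr0n.
  have [Ca a0 Da] := cutoff M 1 M0 ltr01.
  have [Ck k0 Dk] := cutoff M 4 M0 ltac:(lra).
  set a := (fun x => smoothstep (1 * _ - 1)) in Ca a0 Da.
  set k := (fun x => smoothstep (4 * _ - 1)) in Ck k0 Dk.
  have := @Rintegral_bracket_compact _ _ _ _ oO Or (fun x => a x * F x)
    (fun x => k x * G x) p q (C1_boundedM Ca CF) (C1_boundedM Ck CG).
  rewrite (@eq_Rintegral_on _ _ _ mu Omega (bracket p q _ _)
    (fun x => T M x * bracket p q F G x)).
    apply.
    - move=> x nOx; apply: filterS (a0 x nOx) => y ay Oy.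
      by rewrite -/(a y) in ay *; rewrite ay// mul0r.
    - move=> x nOx; apply: filterS (k0 x nOx) => y ay Oy.
      by rewrite -/(k y) in ay *; rewrite ay// mul0r.
  move=> x Ox; have dFx := dF x Ox; have dGx := dG x Ox.
  have [da _ _ _] := Ca; have [dk _ _ _] := Ck.
  have dax := da x Ox; have dkx := dk x Ox.
  rewrite /bracket !derive_mul// !Da// !Dk// !derive_mul//.
  rewrite /a /k /T !mul1r.
  set h := M ^+ 2 * H x ^+ 2.
  have [h1|h1] := leP h 1.
    rewrite [smoothstep (h - 1)]smoothstep_le0 ?subr_le0// [dsmoothstep (h - 1)]dsmoothstep_le0 ?subr_le0//.
    by ring.
  rewrite [smoothstep (4 * h - 1)]smoothstep_ge1; last lra.
  rewrite [dsmoothstep (4 * h - 1)]dsmoothstep_ge1; last lra.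
  rewrite /H; ring.
(* The derivative of smoothstep vanishes unless M^2 H^2 <= 2, and is at most 2:
   the bound is 1 + 2 * 2 * 2. *)
have T_le M x : `|T M x| <= 9.
  rewrite /T; apply: le_trans (ler_normD _ _) _.
  have /andP[s0 s1] := smoothstep_bound (M ^+ 2 * H x ^+ 2 - 1).
  have ds := dsmoothstep_bound (M ^+ 2 * H x ^+ 2 - 1).
  rewrite (ger0_norm s0) -[2 * _ * _]mulrA normrM.
  have h0 : 0 <= M ^+ 2 * H x ^+ 2 by rewrite mulr_ge0// sqr_ge0.
  have [h2|h2] := leP 2 (M ^+ 2 * H x ^+ 2).
    by rewrite dsmoothstep_ge1 ?normr0 ?mulr0; lra.
  rewrite (ger0_norm (_ : 0 <= 2 * _)); last lra.
  set s := smoothstep _ in s1 *; set h := M ^+ 2 * _ in h0 h2 *; set d := `|_| in ds *.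
  have d0 : 0 <= d by exact: normr_ge0.
  nra.
have mH2 (M : R) : bounded_measurable Omega (fun x => M ^+ 2 * H x ^+ 2).
  apply: bounded_measurableM; first exact: bounded_measurable_cst.
  by rewrite (_ : (fun x => _) = (fun x => H x * H x))//; exact: bounded_measurableM.
have mT M : measurable_fun Omega (T M).
  have m1 : measurable_fun Omega (fun x => M ^+ 2 * H x ^+ 2 - 1).
    by have [] := bounded_measurableB (mH2 M) (bounded_measurable_cst Omega (1 : R)).
  apply: measurable_funD.
    apply: (@measurableT_comp _ _ _ _ _ _ (@smoothstep R)) m1.
    by apply: continuous_measurable_fun; exact: continuous_smoothstep.
  apply: measurable_funM.
    rewrite (_ : (fun x => _) = (fun x => 2 * (M ^+ 2 * H x ^+ 2))).
      by have [] := bounded_measurableM (bounded_measurable_cst Omega (2 : R)) (mH2 M).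
    by apply/funext => x; rewrite mulrA.
  apply: (@measurableT_comp _ _ _ _ _ _ (@dsmoothstep R)) m1.
  by apply: continuous_measurable_fun; exact: continuous_dsmoothstep.
have bB : bounded_measurable Omega (bracket p q F G) by exact: C1_bounded_bracket.
pose L x : R := if H x == 0 then 0 else bracket p q F G x.
have mL : measurable_fun Omega L.
  rewrite /L; apply: measurable_fun_if => //.
    by apply: measurable_fun_eqr => //; case: bH.
  by have [mB _] := bB; apply: measurable_funS mB => // x [].
have cv : (fun m => \int[mu]_(x in Omega) (T m.+1%:R x * bracket p q F G x)) @ \oo -->
    \int[mu]_(x in Omega) L x.
  have [mB [K hK]] := bB.
  apply: (@bounded_convergence _ _ _ mu _ mO Ofin _ _ (9 * K)) => //.
  - by move=> m; apply: measurable_funM.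
  - by move=> m x Ox; rewrite normrM ler_pM//; exact: hK.
  - move=> x Ox; rewrite /L; case: eqP => Hx.
      rewrite (_ : (fun m => _) = fun=> 0); first exact: cvg_cst.
      apply/funext => m; rewrite /T Hx expr0n /= !mulr0 sub0r.
      by rewrite smoothstep_le0 ?oppr_le0// mul0r addr0 mul0r.
    apply: cvg_near_cst; near=> m.
    have h : 2 <= (m.+1%:R : R) ^+ 2 * H x ^+ 2.
      have Hx2 : 0 < H x ^+ 2 by rewrite exprn_even_gt0//; apply/eqP.
      rewrite -ler_pdivrMr//; apply: (@le_trans _ _ m.+1%:R).
        by rewrite (le_trans (ltW (archi_boundP _)))// ?ler_nat ?divr_ge0 ?ltW//;
          near: m; exact: nbhs_infty_ge.
      by rewrite expr2 ler_peMl// ler1n.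
    rewrite /T smoothstep_ge1 ?dsmoothstep_ge1; [|lra|lra].
    by rewrite mulr0 addr0 mul1r.
have L0 : \int[mu]_(x in Omega) L x = 0.
  rewrite (_ : (fun m => _) = fun=> 0) in cv; last by apply/funext => m; exact: step.
  by apply/esym/(cvg_unique _ _ cv) => //; exact: cvg_cst.
rewrite -[RHS]L0; apply/eqP; rewrite -subr_eq0; apply/eqP.
have bL : bounded_measurable Omega L.
  split=> //; have [_ [K hK]] := bB; exists `|K| => x Ox; rewrite /L; case: eqP => _.
    by rewrite normr0.
  by apply: le_trans (hK x Ox) _; exact: ler_norm.
rewrite -RintegralB_bounded//.
pose Z f v := Omega `&` [set x | f x = 0] `&` [set x | 'D_v f x != 0].
have Z0 f v : C1_bounded Omega f -> measurable (Z f v) /\ mu (Z f v) = 0%E.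
  move=> [df _ [mf _] mDf].
  exact: (level_set_null oO Or mf (mDf v).1 (fun x Ox => diff_derivable (df x Ox))).
have nullU (A B : set 'rV[R]_n) : measurable A /\ mu A = 0%E ->
    measurable B /\ mu B = 0%E -> measurable (A `|` B) /\ mu (A `|` B) = 0%E.
  by move=> [mA A0] [mB B0]; split; [exact: measurableU|exact: null_set_setU].
have [mN N0] := nullU _ _ (nullU _ _ (Z0 F p CF) (Z0 F q CF))
  (nullU _ _ (Z0 G p CG) (Z0 G q CG)).
apply: (Rintegral_null mO Ofin _ mN N0); first exact: bounded_measurableB.
move=> x Ox nN; rewrite /L; case: eqP => Hx; last by rewrite subrr.
have DF0 v : F x = 0 -> ~ Z F v x -> 'D_v F x = 0.
  by move=> Fx nZ; apply: contra_notP nZ => /eqP Dv; split.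
have DG0 v : G x = 0 -> ~ Z G v x -> 'D_v G x = 0.
  by move=> Gx nZ; apply: contra_notP nZ => /eqP Dv; split.
rewrite subr0 /bracket; move/eqP: Hx; rewrite mulf_eq0 => /orP[/eqP Fx|/eqP Gx].
  rewrite !DF0 ?mul0r ?subrr// => h; apply: nN; left; [right|left]; exact: h.
by rewrite !DG0 ?mulr0 ?subrr// => h; apply: nN; right; [left|right]; exact: h.
Unshelve. all: by end_near.
Qed.

End null_lagrangian_product.

(** * Normals at flat boundary points *)

Section normals.
Context {R : realType} {n : nat}.
Implicit Types (x y z v nu : 'rV[R]_n) (Omega C : set 'rV[R]_n).

(** A connected set that meets Omega but not its boundary is contained in Omega. *)
Lemma segment_boundary Omega C x y : open Omega ->
  (forall t, 0 <= t <= 1 -> C (x + t *: (y - x))) ->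
  (forall z, C z -> closure Omega z -> Omega z) -> Omega x -> Omega y.
Proof.
move=> oO hC noB Ox.
pose f (t : R) := x + t *: (y - x).
have cf : continuous f.
  move=> t; apply: cvgD; first exact: cvg_cst.
  by apply: cvgZr_tmp; exact: cvg_id.
have := @segment_connected R 0 1 (`[0, 1]%classic `&` f @^-1` Omega).
move=> H; have : 1 \in (`[0, 1]%classic `&` f @^-1` Omega).
  rewrite H.
  - by rewrite inE /= in_itv /= ler01 lexx.
  - by exists 0; split; rewrite /= ?in_itv /= ?lexx ?ler01// /f scale0r addr0.
  - by exists (f @^-1` Omega) => //; apply: open_comp => // t _; exact: cf.
  - exists (f @^-1` closure Omega).
      by apply: closed_comp; [move=> t _; exact: cf|exact: closed_closure].
    apply/seteqP; split => t [t01 Of]; split => //; first exact: subset_closure.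
    by apply: noB => //; apply: hC; move: t01; rewrite /= in_itv.
by rewrite inE => -[_]; rewrite /= /f scale1r addrC subrK.
Qed.

Lemma open_push Omega x v : open Omega -> Omega x ->
  \forall s \near (0 : R), Omega (x + s *: v).
Proof.
move=> oO Ox; have : x + s *: v @[s --> (0 : R)] --> x + (0 : R) *: v.
  apply: cvgD; first exact: cvg_cst.
  by apply: cvgZr_tmp; exact: cvg_id.
by apply; rewrite scale0r addr0; exact: open_nbhs_nbhs.
Qed.

Lemma near0_pos (P : set R) : (\forall s \near (0 : R), P s) -> exists2 s, 0 < s & P s.
Proof.
move=> [e /= e0 he]; exists (e / 2); first by rewrite divr_gt0.
by apply: he; rewrite /= sub0r normrN gtr0_norm ?divr_gt0//; lra.
Qed.

Lemma near_off_hyperplanes (hs : seq ('rV[R]_n * R)) y :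
  \forall z \near y, forall h, h \in hs -> hyperplane h z -> hyperplane h y.
Proof.
elim: hs => [|h hs IH]; first by near=> z => h; rewrite in_nil.
have h1 : \forall z \near y, hyperplane h z -> hyperplane h y.
  have [hy|hy] := pselect (hyperplane h y); first by near=> z.
  have : \forall z \near y, ~ hyperplane h z.
    apply: (@open_nbhs_nbhs _ y (~` hyperplane h)); split => //.
    apply: closed_openC; rewrite (_ : hyperplane h = dotv h.1 @^-1` [set z | z = h.2])//.
    by apply: closed_comp; [move=> z _; exact: continuous_dotv|exact: closed_eq].
  by apply: filterS.
near=> z => h'; rewrite inE => /orP[/eqP ->|h'hs].
  by near: z.
by move: h' h'hs; near: z.
Unshelve. all: by end_near. Qed.

(** Near y the hyperplane h carries the boundary, so Omega contains or misses each of
the two half balls it cuts out.  If Omega contained both, y would be interior to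
the closure of Omega; if it missed both, the open set Omega would be contained
in the hyperplane near y. *)
Lemma outward_normal_exists Omega (hs : seq ('rV[R]_n * R)) (h : 'rV[R]_n * R) y :
  open Omega -> interior (closure Omega) = Omega ->
  boundary Omega `<=` \bigcup_(h in [set` hs]) hyperplane h ->
  dotv h.1 h.1 = 1 -> boundary Omega y -> hyperplane h y ->
  (forall h', h' \in hs -> hyperplane h' y -> hyperplane h' = hyperplane h) ->
  outward_unit_normal Omega y h.1 \/ outward_unit_normal Omega y (- h.1).
Proof.
move=> oO icO bhs nu1 yb hy uniq.
have iO : interior Omega = Omega by apply/interior_id.
have /nbhs_ballP[e /= e0 he] : \forall z \near y, boundary Omega z -> hyperplane h z.
  have := near_off_hyperplanes hs y; apply: filterS => z hz bz.
  have [h' h's h'z] := bhs z bz.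
  by rewrite -(uniq h')//; exact: hz.
pose B z := `|y - z| < e.
have Bz z : B z -> boundary Omega z -> hyperplane h z.
  by move=> Bz; apply: he; rewrite mx_norm_ball.
have oB : open [set z | B z].
  rewrite (_ : mkset _ = ball y e); first exact: ball_open.
  by apply/seteqP; split => z; rewrite mx_norm_ball.
have By : B y by rewrite /B subrr normr0.
have yE z : hyperplane h z <-> dotv h.1 (z - y) = 0.
  rewrite dotvB; move: hy; rewrite /hyperplane /= => ->.
  by split => [->|/eqP]; rewrite ?subrr// subr_eq0 => /eqP.
have nOb z : closure Omega z -> ~ Omega z -> boundary Omega z.
  by move=> ? ?; split => //; rewrite iO.
(* A half ball is convex and contains no boundary point of Omega. *)
have half s : s * s = 1 -> forall x z, B x -> B z -> 0 < s * dotv h.1 (x - y) ->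
    0 < s * dotv h.1 (z - y) -> Omega x -> Omega z.
  move=> ss x z Bx Bz' x0 z0.
  apply: (@segment_boundary _ [set z | B z /\ 0 < s * dotv h.1 (z - y)] x z oO).
  - move=> t /andP[t0 t1] /=; split.
      rewrite /B (_ : y - _ = (1 - t) *: (y - x) + t *: (y - z)); last first.
        by rewrite scalerBl scale1r !scalerBr !opprD !addrA; apply/rowP => i;
          rewrite !mxE; ring.
      apply: le_lt_trans (ler_normD _ _) _; rewrite !normrZ.
      rewrite (ger0_norm t0) ger0_norm ?subr_ge0//.
      have [->|t10] := eqVneq t 1; first by rewrite subrr mul0r add0r mul1r.
      have t1' : 0 < 1 - t by rewrite subr_gt0 lt_neqAle t10.
      rewrite (_ : e = (1 - t) * e + t * e); last by ring.
      by apply: ltr_leD; [rewrite ltr_pM2l|rewrite ler_wpM2l// ltW].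
    rewrite (_ : x + t *: (z - x) - y = (1 - t) *: (x - y) + t *: (z - y)); last first.
      by apply/rowP => i; rewrite !mxE; ring.
    rewrite dotvD !dotvZ mulrDr !(mulrCA s).
    have [->|t10] := eqVneq t 1; first by rewrite subrr mul0r add0r mul1r.
    have t1' : 0 < 1 - t by rewrite subr_gt0 lt_neqAle t10.
    apply: ltr_pwDl; first exact: mulr_gt0.
    by apply: mulr_ge0 => //; exact: ltW.
  - move=> w [Bw w0] clw; apply: contrapT => nOw.
    have /yE w1 := Bz w Bw (nOb w clw nOw).
    by rewrite w1 mulr0 ltxx in w0.
(* As Omega is open, its points on the hyperplane can be moved to either side. *)
have off s x : s * s = 1 -> B x -> Omega x -> dotv h.1 (x - y) = 0 ->
    exists x', [/\ B x', Omega x' & 0 < s * dotv h.1 (x' - y)].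
  move=> ss Bx Ox x0.
  have [t t0 [Bt Ot]] : exists2 t, 0 < t & B (x + t *: (s *: h.1)) /\ Omega (x + t *: (s *: h.1)).
    by apply: near0_pos; apply: filterI; [exact: (open_push _ oB Bx)|exact: open_push].
  exists (x + t *: (s *: h.1)); split => //.
  rewrite addrAC dotvD x0 add0r !dotvZ nu1 mulr1 mulrCA ss mulr1 //.
have main s : s * s = 1 ->
   (exists x, [/\ B x, Omega x & 0 < s * dotv h.1 (x - y)]) ->
   ~ (exists x, [/\ B x, Omega x & 0 < - s * dotv h.1 (x - y)]) ->
   outward_unit_normal Omega y (- s *: h.1).
  move=> ss [x [Bx Ox x0]] nx; split => //.
    by rewrite dotvZ dotvZl nu1 mulr1 mulrNN.
  have : \forall z \near y, B z by exact: open_nbhs_nbhs.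
  apply: filterS => z Bz'; rewrite dotvZl mulNr oppr_lt0; split=> [Oz|z0]; last first.
    exact: (half s ss x z).
  rewrite ltNge le_eqVlt; apply/negP => /orP[/eqP z0|z0]; last first.
    by apply: nx; exists z; split => //; rewrite mulNr oppr_gt0.
  have z1 : dotv h.1 (z - y) = 0.
    by rewrite -[LHS]mul1r -ss -mulrA z0 mulr0.
  apply: nx; apply: (off (- s) z) => //; by rewrite mulrNN.
have [pP|nP] := pselect (exists x, [/\ B x, Omega x & 0 < 1 * dotv h.1 (x - y)]);
have [pN|nN] := pselect (exists x, [/\ B x, Omega x & 0 < - 1 * dotv h.1 (x - y)]).
- exfalso; have [_ nOy] := yb; apply: nOy; rewrite iO -icO.
  rewrite /interior; have : \forall z \near y, B z by exact: open_nbhs_nbhs.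
  apply: filterS => z Bz'.
  have [p [Bp Op p0]] := pP; have [q [Bq Oq q0]] := pN.
  have [z0|z0|z0] := ltgtP (dotv h.1 (z - y)) 0.
  - by apply: subset_closure; apply: (half (-1) _ q z) => //; rewrite ?mulrNN ?mulr1// mulN1r oppr_gt0.
  - by apply: subset_closure; apply: (half 1 _ p z) => //; rewrite ?mulr1 ?mul1r.
  - move=> A nA.
    have [t t0 [Bt At]] : exists2 t, 0 < t & B (z + t *: h.1) /\ A (z + t *: h.1).
      apply: near0_pos; apply: filterI; first exact: (open_push _ oB Bz').
      have nA' : A° z by rewrite /interior.
      have := open_push h.1 (open_interior A) nA'; apply: filterS => s; exact: interior_subset.
    exists (z + t *: h.1); split => //.
    apply: (half 1 _ p _) => //; rewrite ?mulr1//.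
    by rewrite addrAC dotvD z0 add0r dotvZ nu1 mulr1 mul1r.
- by right; rewrite -scaleN1r; apply: main => //; rewrite ?mulr1.
- left; rewrite -[h.1]scale1r -[X in X *: _]opprK; apply: main => //; rewrite ?opprK//.
  by rewrite mulrNN mulr1.
- exfalso; have [cly _] := yb.
  have [x [Ox Bx]] : (Omega `&` [set z | B z]) !=set0.
    by apply: cly; exact: open_nbhs_nbhs.
  have [x0|x0|x0] := ltgtP (dotv h.1 (x - y)) 0.
  - by apply: nN; exists x; split => //; rewrite mulN1r oppr_gt0.
  - by apply: nP; exists x; split => //; rewrite mul1r.
  - by apply: nP; apply: (off 1 x) => //; rewrite mulr1.
Unshelve. all: by end_near. Qed.

End normals.

(** * A flat piece of the boundary *)

Section tangential.
Context {R : realType} {n : nat}.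
Variables (Omega : set 'rV[R]_n) (r : R).
Hypotheses (oO : open Omega) (Or : Omega `<=` cube r).
Implicit Types (x y v p q : 'rV[R]_n) (f g F G : 'rV[R]_n -> R) (h : 'rV[R]_n * R).
Local Notation mu := (@lebesgue_rV R n).

Definition hyperplane_offset h x : R := dotv h.1 x - h.2.

Definition hyperplane_cutoff h (m : nat) x : R := smoothstep ((m.+1%:R * hyperplane_offset h x) ^+ 2).

Lemma differentiable_hyperplane_offset h x : differentiable (hyperplane_offset h) x.
Proof. by apply: differentiableB => //; exact: differentiable_dotv. Qed.

Lemma derive_hyperplane_offset h p x : 'D_p (hyperplane_offset h) x = dotv h.1 p.
Proof.
rewrite /hyperplane_offset derive_sub//; last exact: differentiable_dotv.
by rewrite derive_dotv derive_cst subr0.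
Qed.

Lemma differentiable_hyperplane_cutoff h m x : differentiable (hyperplane_cutoff h m) x.
Proof.
apply: (@differentiable_comp _ _ _ _ (fun x => (m.+1%:R * hyperplane_offset h x) ^+ 2) (@smoothstep R)).
  have d1 : differentiable (fun y => m.+1%:R * hyperplane_offset h y) x.
    by apply: differentiableM => //; exact: differentiable_hyperplane_offset.
  exact: (differentiableM d1 d1).
exact: differentiable_smoothstep.
Qed.

Lemma derive_hyperplane_cutoff h m p x : 'D_p (hyperplane_cutoff h m) x =
  dsmoothstep ((m.+1%:R * hyperplane_offset h x) ^+ 2) *
    (2 * m.+1%:R * (m.+1%:R * hyperplane_offset h x) * dotv h.1 p).
Proof.
have d1 : differentiable (fun y => m.+1%:R * hyperplane_offset h y) x.
  by apply: differentiableM => //; exact: differentiable_hyperplane_offset.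
rewrite /hyperplane_cutoff derive_smoothstep; last exact: (differentiableM d1 d1).
congr (_ * _); rewrite (_ : (fun y => _) = (fun y => (m.+1%:R * hyperplane_offset h y) * (m.+1%:R * hyperplane_offset h y)))//.
rewrite derive_mul// derive_mul//; last exact: differentiable_hyperplane_offset.
by rewrite derive_hyperplane_offset derive_cst; ring.
Qed.

Lemma C1_bounded_hyperplane_offset h : C1_bounded Omega (hyperplane_offset h).
Proof. by apply: C1_boundedB; [apply: (C1_bounded_dotv oO Or)|exact: C1_bounded_cst]. Qed.

Lemma C1_bounded_hyperplane_cutoff h m : C1_bounded Omega (hyperplane_cutoff h m).
Proof.
apply: C1_bounded_smoothstep; have C1 := C1_boundedZ m.+1%:R (C1_bounded_hyperplane_offset h).
exact: (C1_boundedM C1 C1).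
Qed.

Lemma hyperplane_cutoff_bound h m x : 0 <= hyperplane_cutoff h m x <= 1.
Proof. exact: smoothstep_bound. Qed.

Lemma hyperplane_cutoff0 h m x : hyperplane h x -> hyperplane_cutoff h m x = 0.
Proof.
by rewrite /hyperplane /hyperplane_cutoff /hyperplane_offset /= => ->; rewrite subrr mulr0 expr0n smoothstep_le0.
Qed.

Let mO := measurable_domain oO.
Let Ofin := domain_fin oO Or.

(** The distance to h is constant along p and q, so multiplying F by a function of it
multiplies the bracket by the same function.  With hyperplane_cutoff h, the
product vanishes on the boundary, and the cutoff tends to 1 off h. *)
Lemma Rintegral_bracket_tangential h p q F G :
  dotv h.1 h.1 = 1 -> dotv h.1 p = 0 -> dotv h.1 q = 0 ->
  C1_bounded Omega F -> C1_bounded Omega G ->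
  (forall y, closure Omega y -> ~ Omega y -> F y != 0 -> hyperplane h y) ->
  \int[mu]_(x in Omega) bracket p q F G x = 0.
Proof.
move=> h1 hp hq CF CG Fh.
have bB := C1_bounded_bracket p q CF CG; have [mB [K hK]] := bB.
have [dF _ _ _] := CF.
have step m : \int[mu]_(x in Omega) (hyperplane_cutoff h m x * bracket p q F G x) = 0.
  rewrite -(@Rintegral_bracket_product0 _ _ _ _ oO Or (fun x => hyperplane_cutoff h m x * F x) G p q) //.
  - apply: eq_Rintegral_on => x Ox; rewrite /bracket.
    have dFx := dF x Ox; have dh := differentiable_hyperplane_cutoff h m x.
    by rewrite !derive_mul// !derive_hyperplane_cutoff hp hq !mulr0 !addr0; ring.
  - by apply: C1_boundedM => //; exact: C1_bounded_hyperplane_cutoff.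
  - move=> y cy nOy; have [->|Fy] := eqVneq (F y) 0; first by rewrite mulr0 mul0r.
    by rewrite hyperplane_cutoff0 ?mul0r//; exact: Fh.
pose L x : R := if hyperplane_offset h x == 0 then 0 else bracket p q F G x.
have mL : measurable_fun Omega L.
  rewrite /L; apply: measurable_fun_if => //.
    by apply: measurable_fun_eqr => //; have [_ _ [mh _] _] := C1_bounded_hyperplane_offset h.
  by apply: measurable_funS mB => // x [].
have cv : (fun m => \int[mu]_(x in Omega) (hyperplane_cutoff h m x * bracket p q F G x)) @ \oo -->
    \int[mu]_(x in Omega) L x.
  apply: (@bounded_convergence _ _ _ mu _ mO Ofin _ _ (1 * K)) => //.
  - by move=> m; apply: measurable_funM => //; have [_ _ [mc _] _] := C1_bounded_hyperplane_cutoff h m.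
  - move=> m x Ox; rewrite normrM ler_pM//; last exact: hK.
    by have /andP[c0 c1] := hyperplane_cutoff_bound h m x; rewrite ger0_norm.
  - move=> x Ox; rewrite /L; case: eqP => hx.
      rewrite (_ : (fun m => _) = fun=> 0); first exact: cvg_cst.
      apply/funext => m; rewrite hyperplane_cutoff0 ?mul0r//.
      by apply/eqP; rewrite -subr_eq0; apply/eqP.
    apply: cvg_near_cst; near=> m.
    have hx0 : 0 < `|hyperplane_offset h x| by rewrite normr_gt0; apply/eqP.
    rewrite /hyperplane_cutoff smoothstep_ge1 ?mul1r// -real_normK ?num_real// expr_ge1//.
    rewrite normrM ger0_norm// -ler_pdivrMr//.
    have q0 : 0 <= 1 / `|hyperplane_offset h x| by rewrite divr_ge0.
    apply: le_trans (ltW (archi_boundP q0)) _.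
    by rewrite ler_nat; apply: leqW; near: m; exact: nbhs_infty_ge.
have L0 : \int[mu]_(x in Omega) L x = 0.
  rewrite (_ : (fun m => _) = fun=> 0) in cv; last by apply/funext => m; exact: step.
  by apply/esym/(cvg_unique _ _ cv) => //; exact: cvg_cst.
rewrite -[RHS]L0; apply/eqP; rewrite -subr_eq0; apply/eqP.
have bL : bounded_measurable Omega L.
  split=> //; exists `|K| => x Ox; rewrite /L; case: eqP => _.
    by rewrite normr0.
  by apply: le_trans (hK x Ox) _; exact: ler_norm.
rewrite -RintegralB_bounded//.
apply: (@Rintegral_null _ _ _ mu Omega mO Ofin _ (cube r `&` [set x | dotv h.1 x = h.2])) => //.
- exact: bounded_measurableB.
- exact: (@measurable_dotv _ _ (cube r) h.1 (measurable_cube r) (measurable_cube r)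
     [set h.2] (measurable_set1 h.2)).
- exact: hyperplane_null.
- move=> x Ox nN; rewrite /L; case: eqP => [hx|]; last by rewrite subrr.
  exfalso; apply: nN; split; first exact: Or.
  by apply/eqP; rewrite -subr_eq0; apply/eqP.
Unshelve. all: by end_near. Qed.

End tangential.

Section flat_boundary.
Context {R : realType} {n : nat}.
Variables (Omega : set 'rV[R]_n) (r : R).
Hypotheses (oO : open Omega) (Or : Omega `<=` cube r).
Implicit Types (x y v p q : 'rV[R]_n) (f g F G : 'rV[R]_n -> R) (h : 'rV[R]_n * R).
Local Notation mu := (@lebesgue_rV R n).
Let mO := measurable_domain oO.
Let Ofin := domain_fin oO Or.

Definition basis_vec (i : 'I_n) : 'rV[R]_n := delta_mx 0 i.

Lemma dotv_basis_vec v i : dotv v (basis_vec i) = v 0 i.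
Proof.
rewrite /dotv (bigD1 i)//= mxE !eqxx mulr1 big1 ?addr0// => j ji.
by rewrite mxE eqxx (negbTE ji) mulr0.
Qed.

Lemma derive_lincomb (I : Type) (s : seq I) (c : I -> R) (f : I -> 'rV[R]_n -> R) x v :
  (forall i, differentiable (f i) x) ->
  differentiable (fun y => \sum_(i <- s) c i * f i y) x /\
  'D_v (fun y => \sum_(i <- s) c i * f i y) x = \sum_(i <- s) c i * 'D_v (f i) x.
Proof.
move=> df; elim: s => [|i s [IH1 IH2]].
  rewrite (_ : (fun y => _) = fun=> 0); last by apply/funext => y; rewrite big_nil.
  by rewrite big_nil derive_cst.
rewrite (_ : (fun y => _) = (fun y => c i * f i y + \sum_(i <- s) c i * f i y)); last first.
  by apply/funext => y; rewrite big_cons.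
have di : differentiable (fun y => c i * f i y) x by apply: differentiableM.
split; first exact: differentiableD.
by rewrite derive_add// IH2 big_cons derive_mul// derive_cst mulr0 addr0.
Qed.

(** The terms with two normal directions cancel by antisymmetry. *)
Let bracket_frame (na nb Fn Fa Fb un ua ub : R) :
  (na * Fn + Fa) * (nb * un + ub) - (nb * Fn + Fb) * (na * un + ua) =
  Fa * ub - Fb * ua + (na * (Fn * ub - Fb * un) + nb * (Fa * un - Fn * ua)).
Proof. ring. Qed.

(** Each coordinate direction is nu_a nu + t a with t a tangential to h.  The
tangential brackets are covered by Rintegral_bracket_tangential.  In the mixed
ones, the sum over the index of the normal direction makes one of the two
functions a multiple of g = sum_a nu_a u_a, so that their product vanishes on
the boundary. *)
Lemma Rintegral_brackets_flat (A : finType) (idx : A -> 'I_n) (u : A -> 'rV[R]_n -> R)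
    phi h : dotv h.1 h.1 = 1 ->
  C1_bounded Omega phi -> (forall a, C1_bounded Omega (u a)) ->
  (forall y, closure Omega y -> ~ Omega y -> phi y != 0 ->
     hyperplane h y /\ \sum_a h.1 0 (idx a) * u a y = 0) ->
  \int[mu]_(x in Omega) (\sum_a \sum_b
     bracket (basis_vec (idx a)) (basis_vec (idx b)) (fun y => phi y * u a y) (u b) x) = 0.
Proof.
move=> h1 Cphi Cu bd.
set nu := h.1 in h1 bd *.
pose g y := \sum_a nu 0 (idx a) * u a y.
pose F a y := phi y * u a y.
pose t a := basis_vec (idx a) - nu 0 (idx a) *: nu.
have nut a : dotv nu (t a) = 0.
  by rewrite dotvB dotv_basis_vec dotvZ h1 mulr1 subrr.
have CF a : C1_bounded Omega (F a) by exact: C1_boundedM.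
have Cg : C1_bounded Omega g by apply: C1_bounded_sum => a; exact: C1_boundedZ.
have Cphig : C1_bounded Omega (fun y => phi y * g y) by exact: C1_boundedM.
have e0 : \int[mu]_(x in Omega) (\sum_a \sum_b bracket (t a) (t b) (F a) (u b) x) = 0.
  rewrite Rintegral_sum_bounded// => [|a _].
    rewrite big1// => a _; rewrite Rintegral_sum_bounded// => [|b _].
      rewrite big1// => b _; apply: (Rintegral_bracket_tangential oO Or h1) => //.
      by move=> y cy nOy; rewrite mulf_eq0 negb_or => /andP[py _]; have [] := bd y cy nOy py.
    exact: C1_bounded_bracket.
  by apply: bounded_measurable_sum => b _; exact: C1_bounded_bracket.
have e1 : \int[mu]_(x in Omega) (\sum_b bracket nu (t b) (fun y => phi y * g y) (u b) x) = 0.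
  rewrite Rintegral_sum_bounded// => [|b _]; last exact: C1_bounded_bracket.
  rewrite big1// => b _; apply: (Rintegral_bracket_product0 oO Or) => // y cy nOy.
  have [->|py] := eqVneq (phi y) 0; first by rewrite !mul0r.
  by rewrite /g; have [_ ->] := bd y cy nOy py; rewrite mulr0 mul0r.
have e2 : \int[mu]_(x in Omega) (\sum_a bracket (t a) nu (F a) g x) = 0.
  rewrite Rintegral_sum_bounded// => [|b _]; last exact: C1_bounded_bracket.
  rewrite big1// => b _; apply: (Rintegral_bracket_product0 oO Or) => // y cy nOy.
  rewrite /F; have [->|py] := eqVneq (phi y) 0; first by rewrite !mul0r.
  by rewrite /g; have [_ ->] := bd y cy nOy py; rewrite mulr0.
have b0 : bounded_measurable Omega (fun x => \sum_a \sum_b bracket (t a) (t b) (F a) (u b) x).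
  apply: bounded_measurable_sum => a _; apply: bounded_measurable_sum => b _.
  exact: C1_bounded_bracket.
have b1 : bounded_measurable Omega (fun x => \sum_b bracket nu (t b) (fun y => phi y * g y) (u b) x).
  by apply: bounded_measurable_sum => b _; exact: C1_bounded_bracket.
have b2 : bounded_measurable Omega (fun x => \sum_a bracket (t a) nu (F a) g x).
  by apply: bounded_measurable_sum => b _; exact: C1_bounded_bracket.
rewrite (@eq_Rintegral_on _ _ _ mu Omega _ (fun x =>
   \sum_a \sum_b bracket (t a) (t b) (F a) (u b) x +
   (\sum_b bracket nu (t b) (fun y => phi y * g y) (u b) x +
    \sum_a bracket (t a) nu (F a) g x))).
  rewrite RintegralD_bounded//; last exact: bounded_measurableD.
  by rewrite RintegralD_bounded// e0 e1 e2 !addr0.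
move=> x Ox.
have dF a : differentiable (F a) x by have [d _ _ _] := CF a; exact: d.
have du a : differentiable (u a) x by have [d _ _ _] := Cu a; exact: d.
have Dg v : 'D_v g x = \sum_a nu 0 (idx a) * 'D_v (u a) x.
  by have [_ ->] := derive_lincomb (index_enum A) (fun a => nu 0 (idx a)) v du.
have Dphig v : 'D_v (fun y => phi y * g y) x = \sum_a nu 0 (idx a) * 'D_v (F a) x.
  rewrite (_ : (fun y => _) = (fun y => \sum_a nu 0 (idx a) * F a y)).
    by have [_ ->] := derive_lincomb (index_enum A) (fun a => nu 0 (idx a)) v dF.
  by apply/funext => y; rewrite /g mulr_sumr; apply: eq_bigr => a _; rewrite mulrCA.
have De a f : differentiable f x ->
    'D_(basis_vec (idx a)) f x = nu 0 (idx a) * 'D_nu f x + 'D_(t a) f x.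
  by move=> df; rewrite -derive_vector// /t addrC subrK.
have -> : \sum_b bracket nu (t b) (fun y => phi y * g y) (u b) x =
    \sum_a \sum_b nu 0 (idx a) * bracket nu (t b) (F a) (u b) x.
  rewrite exchange_big; apply: eq_bigr => b _; rewrite /bracket !Dphig !mulr_suml.
  by rewrite -sumrB; apply: eq_bigr => a _; ring.
have -> : \sum_a bracket (t a) nu (F a) g x =
    \sum_a \sum_b nu 0 (idx b) * bracket (t a) nu (F a) (u b) x.
  apply: eq_bigr => a _; rewrite /bracket !Dg !mulr_sumr.
  by rewrite -sumrB; apply: eq_bigr => b _; ring.
rewrite -!big_split /=; apply: eq_bigr => a _; rewrite -!big_split /=.
apply: eq_bigr => b _; rewrite /bracket -/(F a).
rewrite (De a _ (dF a)) (De b _ (du b)) (De b _ (dF a)) (De a _ (du b)).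
exact: bracket_frame.
Qed.

End flat_boundary.

(** * Polytopes: removing the codimension 2 skeleton *)

Section polytope_brackets.
Context {R : realType} {n : nat}.
Variables (Omega : set 'rV[R]_n) (r : R) (hs : seq ('rV[R]_n * R)).
Hypotheses (oO : open Omega) (Or : Omega `<=` cube r).
Hypothesis icO : interior (closure Omega) = Omega.
Hypothesis hs1 : {in hs, forall h, dotv h.1 h.1 = 1}.
Hypothesis bhs : boundary Omega `<=` \bigcup_(h in [set` hs]) hyperplane h.
Variables (A : finType) (idx : A -> 'I_n) (u : A -> 'rV[R]_n -> R).
Hypothesis Cu : forall a, C1_bounded Omega (u a).
Hypothesis normal_u : forall x nu, outward_unit_normal Omega x nu ->
  \sum_a nu 0 (idx a) * u a x = 0.
Implicit Types (x y v p q : 'rV[R]_n) (h : 'rV[R]_n * R).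
Implicit Types (phi psi : 'rV[R]_n -> R) (Phi Psi : nat -> 'rV[R]_n -> R).
Local Notation mu := (@lebesgue_rV R n).
Let mO := measurable_domain oO.
Let Ofin := domain_fin oO Or.

Let integrand phi x :=
  \sum_a \sum_b bracket (basis_vec (idx a)) (basis_vec (idx b)) (fun y => phi y * u a y) (u b) x.

Let B phi := \int[mu]_(x in Omega) integrand phi x.

Let bounded_integrand phi : C1_bounded Omega phi -> bounded_measurable Omega (integrand phi).
Proof.
move=> Cphi; apply: bounded_measurable_sum => a _; apply: bounded_measurable_sum => b _.
by apply: C1_bounded_bracket => //; exact: C1_boundedM.
Qed.

Let split_B phi psi : C1_bounded Omega phi -> C1_bounded Omega psi ->
  B phi = B (fun x => phi x * psi x) + B (fun x => phi x * (1 - psi x)).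
Proof.
move=> Cphi Cpsi.
have Cpsi' : C1_bounded Omega (fun x => 1 - psi x) by apply: C1_boundedB => //; exact: C1_bounded_cst.
have C1 : C1_bounded Omega (fun x => phi x * psi x) by exact: C1_boundedM.
have C2 : C1_bounded Omega (fun x => phi x * (1 - psi x)) by exact: C1_boundedM.
rewrite /B -RintegralD_bounded//; [|exact: bounded_integrand..].
apply: eq_Rintegral_on => x Ox; rewrite /integrand -big_split; apply: eq_bigr => a _.
rewrite -big_split; apply: eq_bigr => b _ /=.
have E v : 'D_v (fun y => phi y * u a y) x =
   'D_v (fun y => phi y * psi y * u a y) x +
   'D_v (fun y => phi y * (1 - psi y) * u a y) x.
  rewrite -derive_add.
  - by congr ('D_v _ x); apply/funext => y; ring.
  - by have [d _ _ _] := C1_boundedM C1 (Cu a); exact: d.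
  - by have [d _ _ _] := C1_boundedM C2 (Cu a); exact: d.
by rewrite /bracket !E !mulrDl opprD addrACA.
Qed.

(** Cutoffs at scale 1/(m+1), whose gradients may grow linearly in m. *)
Definition cutoff_family Phi :=
  [/\ forall m, C1_bounded Omega (Phi m), forall m x, Omega x -> `|Phi m x| <= 1 &
      exists D, forall m x i, Omega x -> `|'D_(basis_vec i) (Phi m) x| <= D * m.+1%:R].

Definition supported_near h Phi := forall m x, Omega x -> ~ slab h m.+1%:R^-1 x ->
  Phi m x = 0 /\ forall v, 'D_v (Phi m) x = 0.

(** Constrains the hyperplanes through the boundary points where the cutoffs do not
vanish; each factor hyperplane_cutoff h removes h from them. *)
Definition only_meets (P : 'rV[R]_n * R -> Prop) Phi := forall m y, boundary Omega y ->
  Phi m y != 0 -> forall h, h \in hs -> hyperplane h y -> P h.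

Let cutoff_familyM Phi Psi : cutoff_family Phi -> cutoff_family Psi ->
  cutoff_family (fun m x => Phi m x * Psi m x).
Proof.
move=> [C1 b1 [D1 hD1]] [C2 b2 [D2 hD2]]; split.
- by move=> m; exact: C1_boundedM.
- by move=> m x Ox; rewrite normrM mulr_ile1//; [exact: b1|exact: b2].
- exists (D2 + D1) => m x i Ox.
  have [d1 _ _ _] := C1 m; have [d2 _ _ _] := C2 m.
  rewrite derive_mul; [|exact: d1|exact: d2].
  apply: le_trans (ler_normD _ _) _; rewrite mulrDl !normrM; apply: lerD.
    apply: le_trans (hD2 m x i Ox); rewrite ler_piMl//; exact: b1.
  apply: le_trans (hD1 m x i Ox); rewrite ler_piMl//; exact: b2.
Qed.

Let hyperplane_cutoff_derive_bound (d a b s M : R) : 0 <= d -> d <= 2 -> 0 <= a -> a <= b ->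
  0 <= s -> s <= 1 -> 0 <= M -> d * (2 * M * s * a) <= 4 * b * M.
Proof.
move=> d0 d2 a0 ab s0 s1 M0.
apply: (@le_trans _ _ (2 * (2 * M * 1 * b))); last first.
  by rewrite le_eqVlt; apply/orP; left; apply/eqP; ring.
apply: ler_pM => //; first by rewrite !mulr_ge0.
apply: ler_pM => //; first by rewrite !mulr_ge0.
by apply: ler_wpM2l => //; rewrite mulr_ge0.
Qed.

Let cutoff_family_hyperplane_cutoff h : cutoff_family (hyperplane_cutoff h).
Proof.
split.
- by move=> m; exact: (C1_bounded_hyperplane_cutoff oO Or).
- by move=> m x _; have /andP[c0 c1] := hyperplane_cutoff_bound h m x; rewrite ger0_norm.
- exists (4 * `|h.1|) => m x i _; rewrite derive_hyperplane_cutoff dotv_basis_vec.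
  move: (m.+1%:R * hyperplane_offset h x) => t.
  have [t1|t1] := leP 1 `|t|.
    rewrite dsmoothstep_ge1 ?mul0r ?normr0 ?mulr_ge0//.
    by rewrite -real_normK ?num_real// expr_ge1.
  rewrite !normrM !normr_nat.
  apply: hyperplane_cutoff_derive_bound => //; [exact: dsmoothstep_bound|exact: le_coord_norm|exact: ltW].
Qed.

Let cutoff_family_hyperplane_cutoffC h : cutoff_family (fun m x => 1 - hyperplane_cutoff h m x).
Proof.
have [C b [D hD]] := cutoff_family_hyperplane_cutoff h; split.
- by move=> m; apply: C1_boundedB => //; exact: C1_bounded_cst.
- move=> m x _; have /andP[c0 c1] := hyperplane_cutoff_bound h m x.
  by rewrite ger0_norm ?subr_ge0// lerBlDr lerDl.
- exists D => m x i Ox; rewrite derive_sub//; last exact: differentiable_hyperplane_cutoff.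
  by rewrite derive_cst sub0r normrN; exact: hD.
Qed.

Let supported_hyperplane_cutoffC h : supported_near h (fun m x => 1 - hyperplane_cutoff h m x).
Proof.
move=> m x Ox /negP; rewrite -leNgt => xh.
have t1 : 1 <= (m.+1%:R * hyperplane_offset h x) ^+ 2.
  rewrite -real_normK ?num_real// expr_ge1// normrM ger0_norm//.
  by rewrite mulrC -ler_pdivrMr// mul1r.
split; first by rewrite /hyperplane_cutoff smoothstep_ge1// subrr.
move=> v; rewrite derive_sub//; last exact: differentiable_hyperplane_cutoff.
by rewrite derive_cst derive_hyperplane_cutoff dsmoothstep_ge1// mul0r subrr.
Qed.

Let supported_mull h Phi Psi : cutoff_family Phi -> cutoff_family Psi ->
  supported_near h Phi -> supported_near h (fun m x => Phi m x * Psi m x).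
Proof.
move=> [C1 _ _] [C2 _ _] sP m x Ox nx; have [p0 Dp0] := sP m x Ox nx.
have [d1 _ _ _] := C1 m; have [d2 _ _ _] := C2 m.
split; first by rewrite p0 mul0r.
by move=> v; rewrite derive_mul ?p0 ?Dp0 ?mul0r ?mulr0 ?addr0//; [exact: d1|exact: d2].
Qed.

Let supported_mulr h Phi Psi : cutoff_family Phi -> cutoff_family Psi ->
  supported_near h Psi -> supported_near h (fun m x => Phi m x * Psi m x).
Proof.
move=> cP cQ sP; rewrite (_ : (fun m x => _) = (fun m x => Psi m x * Phi m x)).
  exact: supported_mull.
by apply/funext => m; apply/funext => x; rewrite mulrC.
Qed.

(** The integrand is O(m) on a set of measure O(1/m^2). *)
Let B_codim2 h h' Phi : h \in hs -> h' \in hs -> hyperplane h <> hyperplane h' ->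
  cutoff_family Phi -> supported_near h Phi -> supported_near h' Phi ->
  (fun m => B (Phi m)) @ \oo --> 0.
Proof.
move=> hh hh' hneq cP sh sh'; have [CP bP [D hD]] := cP.
have [C hC] := slabs_measure r (hs1 hh) (hs1 hh') hneq.
have [K K0 hK] : exists2 K, 0 <= K & forall x a b, Omega x ->
   `|u a x| <= K /\ `|'D_(basis_vec (idx b)) (u a) x| <= K.
  have bnd f : bounded_measurable Omega f ->
      {M : R | 0 <= M /\ forall x, Omega x -> `|f x| <= M}.
    move=> [_ h0]; have [M hM] := cid h0; exists `|M|; split=> // x Ox.
    by apply: le_trans (hM x Ox) (ler_norm M).
  have bu a : bounded_measurable Omega (u a) by have [_ _ ?] := Cu a.
  have bDu a b : bounded_measurable Omega (fun x => 'D_(basis_vec (idx b)) (u a) x).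
    by have [_ _ _] := Cu a; apply.
  pose K1 a := projT1 (bnd _ (bu a)); pose K2 a b := projT1 (bnd _ (bDu a b)).
  have K10 a : 0 <= K1 a by have [] := projT2 (bnd _ (bu a)).
  have K20 a b : 0 <= K2 a b by have [] := projT2 (bnd _ (bDu a b)).
  have S10 : 0 <= \sum_a K1 a by exact: sumr_ge0.
  have S20 : 0 <= \sum_a \sum_b K2 a b by do 2 (apply: sumr_ge0 => ? _).
  exists (\sum_a K1 a + \sum_a \sum_b K2 a b); first exact: addr_ge0.
  move=> x a b Ox; split.
    have [_ h1] := projT2 (bnd _ (bu a)); apply: le_trans (h1 x Ox) _.
    rewrite ler_wpDr// (bigD1 a)//= lerDl; exact: sumr_ge0.
  have [_ h1] := projT2 (bnd _ (bDu a b)); apply: le_trans (h1 x Ox) _.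
  rewrite ler_wpDl// (bigD1 a)//= ler_wpDr//.
    by apply: sumr_ge0 => ? _; exact: sumr_ge0.
  by rewrite (bigD1 b)//= lerDl; exact: sumr_ge0.
pose E m := Omega `&` slab h m.+1%:R^-1 `&` slab h' m.+1%:R^-1.
have mE m : measurable (E m).
  by apply: measurableI; [apply: measurableI => //|]; exact: measurable_slab.
pose D' := `|D|; have D'0 : 0 <= D' by exact: normr_ge0.
pose C1 := \sum_(a : A) \sum_(b : A) (2 * (K + K * D') * K).
have C10 : 0 <= C1.
  apply: sumr_ge0 => a _; apply: sumr_ge0 => b _; apply: mulr_ge0 => //.
  by apply: mulr_ge0 => //; apply: addr_ge0 => //; exact: mulr_ge0.
have bound m x : Omega x -> `|integrand (Phi m) x| <= C1 * m.+1%:R.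
  move=> Ox; rewrite /integrand /C1 mulr_suml.
  apply: le_trans (ler_norm_sum _ _ _) _; apply: ler_sum => a _; rewrite mulr_suml.
  apply: le_trans (ler_norm_sum _ _ _) _; apply: ler_sum => b _.
  have [dP _ _ _] := CP m; have [du _ _ _] := Cu a.
  have M1 : 1 <= m.+1%:R :> R by rewrite ler1n.
  have h1 c : `|'D_(basis_vec (idx c)) (fun y => Phi m y * u a y) x| <= (K + K * D') * m.+1%:R.
    rewrite derive_mul; [|exact: dP|exact: du].
    apply: le_trans (ler_normD _ _) _; rewrite mulrDl; apply: lerD; rewrite normrM.
      apply: le_trans (_ : K <= _); last by rewrite ler_peMr.
      rewrite -[K]mul1r; apply: ler_pM => //; first exact: bP.
      by have [_] := hK x a c Ox.
    rewrite -mulrA; apply: ler_pM => //; first by have [] := hK x a c Ox.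
    apply: le_trans (hD m x _ Ox) _; apply: ler_wpM2r => //; exact: ler_norm.
  rewrite /bracket; apply: le_trans (ler_normB _ _) _; rewrite !normrM.
  rewrite -[2 * _ * _]mulrA -mulrA mulr_natl mulr2n [_ * K * _]mulrAC.
  have h2 c : `|'D_(basis_vec (idx c)) (u b) x| <= K by have [] := hK x b c Ox.
  by apply: lerD; apply: ler_pM.
have zero m x : Omega x -> ~ E m x -> integrand (Phi m) x = 0.
  move=> Ox nE.
  have [p0 Dp0] : Phi m x = 0 /\ forall v, 'D_v (Phi m) x = 0.
    have [xh|nxh] := pselect (slab h m.+1%:R^-1 x); last exact: sh.
    by apply: sh' => // xh'; apply: nE; split.
  have [dP _ _ _] := CP m.
  rewrite /integrand big1// => a _; rewrite big1// => b _; have [du _ _ _] := Cu a.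
  have Z v : 'D_v (fun y => Phi m y * u a y) x = 0.
    by rewrite derive_mul; [rewrite p0 Dp0 mul0r mulr0 addr0|exact: dP|exact: du].
  by rewrite /bracket !Z !mul0r subrr.
have small m : `|B (Phi m)| <= C1 * C * m.+1%:R^-1.
  apply: (@le_trans _ _ ((C1 * m.+1%:R) * fine (mu (E m)))).
    apply: (le_Rintegral_small mO Ofin) => //.
    - by apply: bounded_integrand.
    - by rewrite mulr_ge0.
    - by move=> x [[]].
    - exact: zero.
    - exact: bound.
  have M0 : 0 < m.+1%:R :> R by [].
  rewrite -!mulrA; apply: ler_wpM2l => //; rewrite ler_pdivlMr//.
  rewrite (_ : _ * _ * _ = m.+1%:R ^+ 2 * fine (mu (E m))); last by ring.
  apply: le_trans (hC m); apply: ler_wpM2l; first exact: sqr_ge0.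
  set G := _ `&` slab h' _.
  have mG : measurable G.
    apply: measurableI; [apply: measurableI|]; try exact: measurable_slab.
    exact: measurable_cube.
  have Gfin : (mu G < +oo)%E.
    apply: le_lt_trans (lebesgue_rV_cube_fin r); apply: le_measure; rewrite ?inE//.
      exact: measurable_cube.
    by move=> x [[]].
  have EG : (mu (E m) <= mu G)%E.
    apply: le_measure; rewrite ?inE//.
    by move=> x [[Ox xh] xh']; split=> //; split=> //; exact: Or.
  apply: fine_le; rewrite ?ge0_fin_numE//; exact: le_lt_trans Gfin.
apply/norm_cvg0P; apply: (@squeeze_cvgr _ _ _ _ (fun=> 0) (fun m => C1 * C * m.+1%:R^-1)).
- by apply: nearW => m; rewrite small andbT.
- exact: cvg_cst.
- rewrite -[X in _ --> X](mulr0 (C1 * C)); apply: cvgMr; exact: cvg_harmonic.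
Qed.

Let cvg_split_B h Phi : cutoff_family Phi ->
  (fun m => B (fun x => Phi m x * hyperplane_cutoff h m x)) @ \oo --> 0 ->
  (fun m => B (fun x => Phi m x * (1 - hyperplane_cutoff h m x))) @ \oo --> 0 ->
  (fun m => B (Phi m)) @ \oo --> 0.
Proof.
move=> [CP _ _] c1 c2; have [Cc _ _] := cutoff_family_hyperplane_cutoff h.
rewrite -[X in _ --> X](addr0 0) (_ : (fun m => _) = (fun m =>
  B (fun x => Phi m x * hyperplane_cutoff h m x) + B (fun x => Phi m x * (1 - hyperplane_cutoff h m x)))).
  exact: (cvgD c1 c2).
by apply/funext => m; exact: split_B (CP m) (Cc m).
Qed.

Let only_meets_hyperplane_cutoff (P Q : 'rV[R]_n * R -> Prop) h Phi : only_meets P Phi ->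
  (forall h', P h' -> h' = h \/ Q h') ->
  only_meets Q (fun m x => Phi m x * hyperplane_cutoff h m x).
Proof.
move=> oP PQ m y yb; rewrite mulf_eq0 negb_or => /andP[p0 c0] h' h's h'y.
have [hE|//] := PQ h' (oP m y yb p0 h' h's h'y).
by move: c0; rewrite hyperplane_cutoff0 ?eqxx// -hE.
Qed.

(** Induction on the other hyperplanes L that the cutoffs may meet.  Multiplying by
hyperplane_cutoff h' removes h' from L, and the complementary factor confines
the cutoffs to slabs about h and h'.  When L is empty, h is the only hyperplane
left and the boundary is flat. *)
Let B_near_hyperplane h (L : seq ('rV[R]_n * R)) Phi : h \in hs -> {subset L <= hs} -> cutoff_family Phi ->
  supported_near h Phi ->
  only_meets (fun h' => h' \in L \/ hyperplane h' = hyperplane h) Phi ->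
  (fun m => B (Phi m)) @ \oo --> 0.
Proof.
move=> hh; elim: L Phi => [|h' L IH] Phi Ls cP sP oP.
  rewrite (_ : (fun m => _) = fun=> 0); first exact: cvg_cst.
  apply/funext => m; have [CP _ _] := cP.
  apply: (Rintegral_brackets_flat oO Or (hs1 hh)) => // y cy nOy py.
  have yb : boundary Omega y by split => //; rewrite (interior_id Omega).1.
  have only h' : h' \in hs -> hyperplane h' y -> hyperplane h' = hyperplane h.
    by move=> h's h'y; have [//|] := oP m y yb py h' h's h'y.
  have hy : hyperplane h y by have [h' h's h'y] := bhs yb; rewrite -(only h').
  split => //.
  have [/normal_u//|/normal_u] := outward_normal_exists oO icO bhs (hs1 hh) yb hy only.
  by under eq_bigr do rewrite mxE mulNr; rewrite sumrN => /eqP; rewrite oppr_eq0 => /eqP.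
have h's : h' \in hs by apply: Ls; rewrite inE eqxx.
have Ls' : {subset L <= hs} by move=> k kL; apply: Ls; rewrite inE kL orbT.
have [hE|hneq] := pselect (hyperplane h = hyperplane h').
  apply: IH => // m y yb py k ks ky.
  have [|->] := oP m y yb py k ks ky; last by right.
  by rewrite inE => /orP[/eqP ->|]; [right|left].
apply: (@cvg_split_B h') => //.
  apply: IH => //; first exact: cutoff_familyM.
    exact: supported_mull.
  apply: only_meets_hyperplane_cutoff oP _ => k [|->]; last by right; right.
  by rewrite inE => /orP[/eqP ->|kL]; [left|right; left].
apply: (B_codim2 hh h's hneq); first exact: cutoff_familyM.
  exact: supported_mull.
by apply: supported_mulr.
Qed.

(** Same induction, before a hyperplane has been singled out: the complementary
factor now confines the cutoffs to a slab about a single hyperplane. *)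
Let B_cutoff (L : seq ('rV[R]_n * R)) Phi : {subset L <= hs} -> cutoff_family Phi ->
  only_meets (fun h => h \in L) Phi -> (fun m => B (Phi m)) @ \oo --> 0.
Proof.
elim: L Phi => [|h L IH] Phi Ls cP oP.
  rewrite (_ : (fun m => _) = fun=> 0); first exact: cvg_cst.
  apply/funext => m; have [CP _ _] := cP.
  have bb a b : bounded_measurable Omega
     (bracket (basis_vec (idx a)) (basis_vec (idx b)) (fun y => Phi m y * u a y) (u b)).
    by apply: C1_bounded_bracket => //; exact: C1_boundedM.
  rewrite /B Rintegral_sum_bounded// => [|a _]; last exact: bounded_measurable_sum.
  rewrite big1// => a _; rewrite Rintegral_sum_bounded// big1// => b _.
  apply: (Rintegral_bracket_product0 oO Or) => //; first exact: C1_boundedM.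
  move=> y cy nOy; have [->|py] := eqVneq (Phi m y) 0; first by rewrite !mul0r.
  have yb : boundary Omega y by split => //; rewrite (interior_id Omega).1.
  by have [h hh hy] := bhs yb; have := oP m y yb py h hh hy.
have hh : h \in hs by apply: Ls; rewrite inE eqxx.
have Ls' : {subset L <= hs} by move=> k kL; apply: Ls; rewrite inE kL orbT.
apply: (@cvg_split_B h) => //.
  apply: IH => //; first exact: cutoff_familyM.
  apply: only_meets_hyperplane_cutoff oP _ => k.
  by rewrite inE => /orP[/eqP ->|kL]; [left|right].
apply: (@B_near_hyperplane h L) => //; first exact: cutoff_familyM.
  by apply: supported_mulr.
move=> m y yb; rewrite mulf_eq0 negb_or => /andP[py _] k ks ky.
have := oP m y yb py k ks ky.
by rewrite inE => /orP[/eqP ->|kL]; [right|left].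
Qed.

Lemma Rintegral_brackets_polytope :
  \int[mu]_(x in Omega) (\sum_a \sum_b
     bracket (basis_vec (idx a)) (basis_vec (idx b)) (u a) (u b) x) = 0.
Proof.
have sub : {subset hs <= hs} by [].
have := @B_cutoff hs (fun _ _ => 1) sub.
have -> : B (fun=> 1) = \int[mu]_(x in Omega) (\sum_a \sum_b
     bracket (basis_vec (idx a)) (basis_vec (idx b)) (u a) (u b) x).
  apply: eq_Rintegral_on => x _; apply: eq_bigr => a _; apply: eq_bigr => b _.
  by congr (bracket _ _ _ _ x); apply/funext => y; rewrite mul1r.
move=> H; apply: (@cvg_unique _ (@Rhausdorff R) ((fun=> _ : R) @ \oo)); first exact: cvg_cst.
apply: H => //; split.
- by move=> m; exact: C1_bounded_cst.
- by move=> m x _; rewrite normr1.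
- by exists 0 => m x i _; rewrite derive_cst normr0 mul0r.
Qed.

End polytope_brackets.

(** * Antisymmetric components and sums over tuples *)

Section tuples.
Context {R : realType} {n : nat}.
Implicit Types (k : nat).

Definition ins_index k (a : 'I_k.+1) (j : 'I_n) (I : k.-tuple 'I_n) : k.+1.-tuple 'I_n :=
  [tuple if unlift a b is Some c then tnth I c else j | b < k.+1].

Lemma tnth_ins_index k (a : 'I_k.+1) j (I : k.-tuple 'I_n) : tnth (ins_index a j I) a = j.
Proof. by rewrite tnth_mktuple unlift_none. Qed.

Lemma del_ins_index k (a : 'I_k.+1) j (I : k.-tuple 'I_n) : del_index a (ins_index a j I) = I.
Proof. by apply: eq_from_tnth => b; rewrite !tnth_mktuple liftK. Qed.

Lemma ins_del_index k (a : 'I_k.+1) (K : k.+1.-tuple 'I_n) :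
  ins_index a (tnth K a) (del_index a K) = K.
Proof.
apply: eq_from_tnth => b; rewrite tnth_mktuple; case: unliftP => [c|] ->//.
by rewrite tnth_mktuple.
Qed.

Lemma sum_del_index k (a : 'I_k.+1) (f : 'I_n -> k.-tuple 'I_n -> R) :
  \sum_(K : k.+1.-tuple 'I_n) f (tnth K a) (del_index a K) =
  \sum_j \sum_(I : k.-tuple 'I_n) f j I.
Proof.
rewrite pair_big (reindex (fun jI => ins_index a jI.1 jI.2)) /=; last first.
  exists (fun K => (tnth K a, del_index a K)) => [[j I] _|K _] /=.
    by rewrite tnth_ins_index del_ins_index.
  exact: ins_del_index.
by apply: eq_bigr => -[j I] _; rewrite tnth_ins_index del_ins_index.
Qed.

(** Moving the entry of rank c to the front is a cycle of sign (-1)^c. *)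
Lemma antisym_front k (w : components R n k.+1) (c : 'I_k.+1) (I : k.+1.-tuple 'I_n) :
  antisym_components w ->
  w I = (-1) ^+ c * w [tuple of tnth I c :: del_index c I].
Proof.
move=> aw; pose s := lift_perm ord0 c (1%g : 'S_k).
have -> : [tuple of tnth I c :: del_index c I] = [tuple tnth I (s a) | a < k.+1].
  apply: eq_from_tnth => b; rewrite tnth_mktuple.
  case: (unliftP ord0 b) => [d|] ->.
    by rewrite lift_perm_lift perm1 tnthS tnth_mktuple.
  by rewrite lift_perm_id tnth0.
rewrite aw /s odd_lift_perm odd_perm1 addbF /= signr_odd.
by rewrite mulrA -signr_odd -signr_addb addbb mul1r.
Qed.

Lemma del_index_comm k (K : k.+2.-tuple 'I_n) (a b : 'I_k.+2) (a' b' : 'I_k.+1) :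
  b = lift a b' -> a = lift b a' ->
  del_index b' (del_index a K) = del_index a' (del_index b K).
Proof.
move=> bE aE; apply: eq_from_tnth => c; rewrite !tnth_mktuple; congr (tnth K _).
apply/val_inj; move: (congr1 val bE) (congr1 val aE) => /=.
by rewrite /bump; move: (val a) (val b) (val a') (val b') (val c); lia.
Qed.

(** If a < b then a' = a and b' = b - 1. *)
Lemma sign_lift_lift k (a b : 'I_k.+2) (a' b' : 'I_k.+1) :
  b = lift a b' -> a = lift b a' ->
  (-1) ^+ a * (-1) ^+ b * ((-1) ^+ a' * (-1) ^+ b') = -1 :> R.
Proof.
move=> bE aE; rewrite -!exprD -signr_odd.
move: (congr1 val bE) (congr1 val aE) => /=; rewrite /bump.
case: a b a' b' {bE aE} => a ? [b ?] [a' ?] [b' ?] /= h1 h2.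
have [t ->] : exists t, (a + b + (a' + b') = t.*2.+1)%N.
  case: (leqP a b') h1 => ab h1; case: (leqP b a') h2 => ba h2; try lia.
  - by exists (a + b')%N; lia.
  - by exists (b + a')%N; lia.
by rewrite oddS odd_double expr1.
Qed.

(** Exchanging two equal entries changes the sign and leaves the tuple unchanged. *)
Lemma antisym_not_uniq k (w : components R n k) (I : k.-tuple 'I_n) :
  antisym_components w -> ~~ uniq I -> w I = 0.
Proof.
move=> aw /tuple_uniqP nU.
have [a [b [ab Iab]]] : exists a b, a != b /\ tnth I a = tnth I b.
  apply: contrapT => nab; apply: nU => a b Iab; apply/eqP.
  by apply: contrapT => /negP ab; apply: nab; exists a, b.
have := aw (tperm a b) I; rewrite odd_tperm ab expr1 mulN1r.
have -> : [tuple tnth I (tperm a b c) | c < k] = I.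
  by apply: eq_from_tnth => c; rewrite tnth_mktuple; case: tpermP => [->|->|].
by move=> /eqP; rewrite -addr_eq0 -mulr2n mulrn_eq0 /= => /eqP.
Qed.

Lemma increasingE k (I : k.-tuple 'I_n) :
  increasing I = uniq I && sorted (fun i j : 'I_n => (i <= j)%N) I.
Proof.
rewrite /increasing -[sorted _ _]/(sorted (relpre val ltn) I) -sorted_map.
rewrite ltn_sorted_uniq_leq (map_inj_uniq val_inj) sorted_map.
by [].
Qed.

(** Each tuple without repetition has a unique increasing rearrangement, and each
increasing tuple has k! rearrangements. *)
Lemma sqnorm_all k (w : components R n k) : antisym_components w ->
  k`!%:R * sqnorm w = \sum_(I : k.-tuple 'I_n) w I ^+ 2.
Proof.
move=> aw; rewrite (bigID (fun I : k.-tuple 'I_n => uniq I)) /=.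
rewrite [X in _ = _ + X]big1 ?addr0; last first.
  by move=> I nU; rewrite antisym_not_uniq// expr0n.
pose le := fun i j : 'I_n => (i <= j)%N.
have le_total : total le by move=> i j; exact: leq_total.
have le_trans : transitive le by move=> i j l; exact: leq_trans.
have le_anti : antisymmetric le.
  by move=> i j ij; apply/val_inj/eqP; rewrite eqn_leq.
pose srt (I : k.-tuple 'I_n) : k.-tuple 'I_n := [tuple of sort le I].
rewrite (partition_big srt (fun J : k.-tuple _ => increasing J)) /=; last first.
  move=> I U; rewrite increasingE /= sort_uniq U /=; exact: sort_sorted.
rewrite /sqnorm mulr_sumr; apply: eq_bigr => J incJ.
have /andP[UJ sJ] : uniq J && sorted le J by rewrite -increasingE.
have srtE (I : k.-tuple 'I_n) : (uniq I && (srt I == J)) = perm_eq I J.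
  apply/idP/idP => [/andP[U /eqP <-]|pIJ].
    by rewrite perm_sym perm_sort.
  rewrite (perm_uniq pIJ) UJ; apply/eqP/val_inj => /=.
  apply: (sorted_eq le_trans le_anti) => //; first exact: sort_sorted.
  by rewrite perm_sort.
rewrite (eq_bigr (fun=> w J ^+ 2)); last first.
  move=> I; rewrite srtE => /tuple_permP[s /val_inj ->].
  by rewrite aw exprMn -signr_odd sqrr_sign mul1r.
under eq_bigl => I do rewrite srtE.
rewrite sumr_const -[RHS]mulr_natl; congr (_%:R * _).
pose f (s : 'S_k) := [tuple tnth J (s i) | i < k].
have finj : injective f.
  move=> s t st; apply/permP => i.
  have := congr1 (fun T => tnth T i) st; rewrite !tnth_mktuple.
  by move/tuple_uniqP : UJ; apply.
rewrite -card_Sn -(card_imset _ finj); apply: eq_card => I.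
apply/imsetP/idP => [[s _ ->]|].
  by apply/tuple_permP; exists s.
by rewrite unfold_in => /tuple_permP[s /val_inj ->]; exists s.
Qed.

End tuples.

Section gaffney_algebra.
Context {R : realType} {n k : nat}.
(** X j I stands for the derivative in direction j of the component I. *)
Variable X : 'I_n -> components R n k.
Hypothesis aX : forall j, antisym_components (X j).

Definition jet_ext K : R := \sum_(a < k.+1) (-1) ^+ a * X (tnth K a) (del_index a K).

(** Deleting the entry of rank a from the rearrangement of K by s amounts to
rearranging by some t the tuple K without its entry of rank s a, and
s = lift_perm a (s a) t gives the signs. *)
Lemma antisym_jet_ext : antisym_components jet_ext.
Proof.
move=> s K; rewrite /jet_ext mulr_sumr [RHS](reindex_inj (@perm_inj _ s)) /=.
apply: eq_bigr => a _; rewrite tnth_mktuple.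
pose g c := odflt c (unlift (s a) (s (lift a c))).
have gE c : s (lift a c) = lift (s a) (g c).
  rewrite /g; case: unliftP => [d ->//|/perm_inj/eqP].
  by rewrite eq_sym (negbTE (neq_lift _ _)).
have ginj : injective g.
  by move=> c d cd; apply: (@lift_inj _ a); apply: (@perm_inj _ s); rewrite !gE cd.
pose t := perm ginj.
have sE : s = lift_perm a (s a) t.
  apply/permP => b; case: (unliftP a b) => [c|] ->; last by rewrite lift_perm_id.
  by rewrite lift_perm_lift permE gE.
have -> : del_index a [tuple tnth K (s a0) | a0 < k.+1] =
    [tuple tnth (del_index (s a) K) (t b) | b < k].
  by apply: eq_from_tnth => b; rewrite !tnth_mktuple gE permE.
rewrite aX !mulrA; congr (_ * _).
have -> : (-1) ^+ (odd_perm s) = (-1) ^+ (odd_perm (lift_perm a (s a) t)) :> R by rewrite -sE.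
rewrite odd_lift_perm signr_addb signr_addb !signr_odd.
have yy : (-1) ^+ s a * (-1) ^+ s a = 1 :> R by rewrite -expr2 sqrr_sign.
move: ((-1) ^+ s a : R) ((-1) ^+ a : R) ((-1) ^+ (odd_perm t) : R) yy => y z u yy.
by transitivity (z * u * (y * y)); [rewrite yy mulr1|ring].
Qed.

Lemma sum_diag a : \sum_(K : k.+1.-tuple 'I_n) X (tnth K a) (del_index a K) ^+ 2 =
  \sum_j \sum_(I : k.-tuple 'I_n) X j I ^+ 2.
Proof. exact: (sum_del_index a (fun j I => X j I ^+ 2)). Qed.

End gaffney_algebra.

Section gaffney_algebra_offdiag.
Context {R : realType} {n k : nat}.
Variable X : 'I_n -> components R n k.+1.
Hypothesis aX : forall j, antisym_components (X j).
Local Notation cons j J := [tuple of j :: J].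

(** Move the entry of rank b to the front of K without its entry of rank a, and
conversely.  What remains of K is the same on both sides, and the four signs
multiply to -1.  The functions Y and Z tell which of the two entries is the
direction of which derivative. *)
Lemma sum_offdiag (Y Z : 'I_n -> 'I_n -> 'I_n) (a b : 'I_k.+2) : a != b ->
  \sum_(K : k.+2.-tuple 'I_n) (-1) ^+ a * (-1) ^+ b *
    (X (Y (tnth K a) (tnth K b)) (del_index a K) *
     X (Z (tnth K a) (tnth K b)) (del_index b K)) =
  - \sum_i \sum_j \sum_(J : k.-tuple 'I_n) X (Y i j) (cons j J) * X (Z i j) (cons i J).
Proof.
move=> ab.
have [b' bE] : exists b', b = lift a b'.
  by have := ab; case: (unliftP a b) => [b' ->|->]; [exists b'|rewrite eqxx].
have [a' aE] : exists a', a = lift b a'.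
  by have := ab; case: (unliftP b a) => [a' ->|->]; [exists a'|rewrite eqxx].
transitivity (\sum_(K : k.+2.-tuple 'I_n) - (X (Y (tnth K a) (tnth (del_index a K) b'))
    (cons (tnth (del_index a K) b') (del_index b' (del_index a K))) *
   X (Z (tnth K a) (tnth (del_index a K) b')) (cons (tnth K a) (del_index b' (del_index a K))))).
  apply: eq_bigr => K _.
  rewrite (antisym_front b' (del_index a K) (aX _)).
  rewrite (antisym_front a' (del_index b K) (aX _)).
  have -> : tnth (del_index b K) a' = tnth K a by rewrite tnth_mktuple -aE.
  have -> : tnth (del_index a K) b' = tnth K b by rewrite tnth_mktuple -bE.
  rewrite -(del_index_comm _ bE aE).
  have sgn := sign_lift_lift (R := R) bE aE.
  set P := X _ (cons (tnth K b) _); set Q := X _ (cons (tnth K a) _).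
  transitivity ((-1) ^+ a * (-1) ^+ b * ((-1) ^+ a' * (-1) ^+ b') * (P * Q)).
    by move: P Q ((-1) ^+ a : R) ((-1) ^+ b : R) ((-1) ^+ a' : R) ((-1) ^+ b' : R) => *; ring.
  by rewrite sgn mulN1r.
rewrite sumrN; congr (- _).
rewrite (sum_del_index a (fun i I => X (Y i (tnth I b')) (cons (tnth I b') (del_index b' I)) *
   X (Z i (tnth I b')) (cons i (del_index b' I)))).
apply: eq_bigr => i _.
exact: (sum_del_index b' (fun j J => X (Y i j) (cons j J) * X (Z i j) (cons i J))).
Qed.

(** The k + 2 diagonal terms all give the full gradient, and the (k + 2) (k + 1)
other ones are given by sum_offdiag. *)
Lemma sum_signed_products (Y Z : 'I_n -> 'I_n -> 'I_n) : (forall i, Y i i = i /\ Z i i = i) ->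
  \sum_(K : k.+2.-tuple 'I_n) \sum_(a < k.+2) \sum_(b < k.+2) (-1) ^+ a * (-1) ^+ b *
    (X (Y (tnth K a) (tnth K b)) (del_index a K) *
     X (Z (tnth K a) (tnth K b)) (del_index b K)) =
  k.+2%:R * (\sum_j \sum_(I : k.+1.-tuple 'I_n) X j I ^+ 2) -
  (k.+2 * k.+1)%:R * (\sum_i \sum_j \sum_(J : k.-tuple 'I_n)
     X (Y i j) (cons j J) * X (Z i j) (cons i J)).
Proof.
move=> YZ; rewrite exchange_big /=.
under eq_bigr => a _ do rewrite exchange_big /=.
rewrite (eq_bigr (fun=> \sum_j \sum_(I : k.+1.-tuple 'I_n) X j I ^+ 2 -
  k.+1%:R * (\sum_i \sum_j \sum_(J : k.-tuple 'I_n)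
     X (Y i j) (cons j J) * X (Z i j) (cons i J)))).
  rewrite sumr_const card_ord -[LHS]mulr_natl mulrBr natrM mulrA //.
move=> a _; rewrite (bigD1 a) //=; congr (_ + _).
  rewrite -(sum_diag X a); apply: eq_bigr => K _.
  have [-> ->] := YZ (tnth K a).
  by rewrite -expr2 sqrr_sign mul1r expr2.
rewrite (eq_bigr (fun=> - \sum_i \sum_j \sum_(J : k.-tuple 'I_n)
     X (Y i j) (cons j J) * X (Z i j) (cons i J))).
  by rewrite sumr_const cardC1 card_ord /= -[LHS]mulr_natl mulrN.
by move=> b ba; apply: sum_offdiag; rewrite eq_sym.
Qed.

End gaffney_algebra_offdiag.

(** * The defect as a sum of null Lagrangians *)

Section gaffney_identity.
Context {R : realType} {n k : nat}.
Variable X : 'I_n -> components R n k.+1.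
Hypothesis aX : forall j, antisym_components (X j).
Local Notation cons j J := [tuple of j :: J].

Definition jet_dvg (J : k.-tuple 'I_n) : R := \sum_j X j (cons j J).

Lemma antisym_jet_dvg : antisym_components jet_dvg.
Proof.
move=> s J; rewrite /jet_dvg mulr_sumr; apply: eq_bigr => j _.
have -> : cons j [tuple tnth J (s a) | a < k] =
    [tuple tnth (cons j J) (lift_perm ord0 ord0 s b) | b < k.+1].
  apply: eq_from_tnth => b; rewrite tnth_mktuple; case: (unliftP ord0 b) => [c|] ->.
    by rewrite lift_perm_lift !tnthS tnth_mktuple.
  by rewrite lift_perm_id !tnth0.
by rewrite aX odd_lift_perm.
Qed.

Let G := \sum_j \sum_(I : k.+1.-tuple 'I_n) X j I ^+ 2.
Let E := \sum_i \sum_j \sum_(J : k.-tuple 'I_n) X i (cons j J) * X j (cons i J).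
Let C := \sum_i \sum_j \sum_(J : k.-tuple 'I_n) X j (cons j J) * X i (cons i J).

Let gradE : k.+1`!%:R * (\sum_j sqnorm (X j)) = G.
Proof. by rewrite mulr_sumr; apply: eq_bigr => j _; exact: sqnorm_all. Qed.

Let extE : k.+2`!%:R * sqnorm (jet_ext X) = k.+2%:R * G - (k.+2 * k.+1)%:R * E.
Proof.
rewrite sqnorm_all; last exact: antisym_jet_ext.
rewrite -(@sum_signed_products _ _ _ X aX (fun i _ => i) (fun _ j => j))//.
apply: eq_bigr => K _; rewrite expr2 /jet_ext mulr_suml; apply: eq_bigr => a _.
by rewrite mulr_sumr; apply: eq_bigr => b _; rewrite mulrACA.
Qed.

Let dvgE : k`!%:R * sqnorm jet_dvg = C.
Proof.
rewrite sqnorm_all; last exact: antisym_jet_dvg.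
rewrite /C exchange_big /=; under [RHS]eq_bigr do rewrite exchange_big.
rewrite exchange_big /=; apply: eq_bigr => J _.
rewrite expr2 /jet_dvg mulr_suml exchange_big /=; apply: eq_bigr => i _.
by rewrite mulr_sumr; apply: eq_bigr => j _; rewrite mulrC.
Qed.

Let fact_neq0 m : m`!%:R != 0 :> R.
Proof. by rewrite pnatr_eq0 -lt0n fact_gt0. Qed.

(** The two kinds of double sums differ from the divergence and exterior derivative
terms only by which derivative carries which direction. *)
Let combine : sqnorm (jet_ext X) + sqnorm jet_dvg - \sum_j sqnorm (X j) = k`!%:R^-1 * (C - E).
Proof.
apply: (mulfI (fact_neq0 k.+2)).
rewrite mulrBr mulrDr extE.
have -> : k.+2`!%:R * sqnorm jet_dvg = (k.+2 * k.+1)%:R * C.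
  by rewrite -dvgE mulrA -natrM !factS mulnA.
have -> : k.+2`!%:R * \sum_j sqnorm (X j) = k.+2%:R * G.
  by rewrite -gradE mulrA -natrM factS.
rewrite !factS !natrM; set f := k`!%:R; have f0 : f != 0 by exact: fact_neq0.
by field.
Qed.

(** This expression of the defect suits the condition on the contraction by nu: for
each J the functions u_i are the components i :: J. *)
Lemma gaffney_identity_dvg :
  sqnorm (jet_ext X) + sqnorm jet_dvg - \sum_j sqnorm (X j) =
  k`!%:R^-1 * \sum_(J : k.-tuple 'I_n) \sum_i \sum_j
    (X i (cons i J) * X j (cons j J) - X j (cons i J) * X i (cons j J)).
Proof.
rewrite combine; congr (_ * _); rewrite exchange_big /=.
under [RHS]eq_bigr do rewrite exchange_big.
rewrite /C /E -sumrB; apply: eq_bigr => i _; rewrite -sumrB; apply: eq_bigr => j _.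
by rewrite -sumrB; apply: eq_bigr => J _; ring.
Qed.

(** This expression of the defect suits the condition on the exterior product by nu:
for each K the functions u_a are the signed components of K without its entry
of rank a. *)
Lemma gaffney_identity_ext :
  sqnorm (jet_ext X) + sqnorm jet_dvg - \sum_j sqnorm (X j) =
  k.+2`!%:R^-1 * \sum_(K : k.+2.-tuple 'I_n) \sum_(a < k.+2) \sum_(b < k.+2)
    ((-1) ^+ a * X (tnth K a) (del_index a K) *
       ((-1) ^+ b * X (tnth K b) (del_index b K)) -
     (-1) ^+ a * X (tnth K b) (del_index a K) *
       ((-1) ^+ b * X (tnth K a) (del_index b K))).
Proof.
have S1 := @sum_signed_products _ _ _ X aX (fun i _ => i) (fun _ j => j) (fun _ => conj erefl erefl).
have S2 := @sum_signed_products _ _ _ X aX (fun _ j => j) (fun i _ => i) (fun _ => conj erefl erefl).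
have -> : \sum_(K : k.+2.-tuple 'I_n) \sum_(a < k.+2) \sum_(b < k.+2)
    ((-1) ^+ a * X (tnth K a) (del_index a K) *
       ((-1) ^+ b * X (tnth K b) (del_index b K)) -
     (-1) ^+ a * X (tnth K b) (del_index a K) *
       ((-1) ^+ b * X (tnth K a) (del_index b K))) =
   (k.+2 * k.+1)%:R * (C - E).
  transitivity (k.+2%:R * G - (k.+2 * k.+1)%:R * E -
                (k.+2%:R * G - (k.+2 * k.+1)%:R * C)); last by ring.
  rewrite -{1}S1 -{1}S2 -sumrB; apply: eq_bigr => K _.
  rewrite -sumrB; apply: eq_bigr => a _; rewrite -sumrB; apply: eq_bigr => b _.
  by congr (_ - _); rewrite mulrACA.
rewrite combine !factS !natrM; set f := k`!%:R; have f0 : f != 0 by exact: fact_neq0.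
have k0 : (0 : R) <= k%:R by [].
by field; rewrite fact_neq0 !gt_eqF ?ltr_wpDr.
Qed.

End gaffney_identity.

(** * Generalized polytopes *)

Section polytopes.
Context {R : realType} {n : nat}.
Implicit Types (x y nu : 'rV[R]_n) (P Omega : set 'rV[R]_n).

Lemma bounded_set_cube P : bounded_set P -> exists r, P `<=` cube r.
Proof.
move=> /pinfty_ex_gt0[M M0 hM]; exists (M + 1) => x Px; rewrite /cube /=.
by apply: le_lt_trans (hM x Px) _; rewrite ltrDl.
Qed.

Lemma hyperplane_normalize (h : 'rV[R]_n * R) : h.1 != 0 ->
  exists2 h', dotv h'.1 h'.1 = 1 & hyperplane h `<=` hyperplane h'.
Proof.
move=> h0.
have d0 : 0 < dotv h.1 h.1.
  rewrite lt_neqAle dotv_ge0 andbT eq_sym; apply: contra_neq h0; exact: dotv_eq0.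
pose s := Num.sqrt (dotv h.1 h.1).
have s0 : 0 < s by rewrite sqrtr_gt0.
exists (s^-1 *: h.1, s^-1 * h.2) => /=.
  have dE : dotv h.1 h.1 = s ^+ 2 by rewrite sqr_sqrtr ?ltW.
  rewrite dotvZl dotvZ dE.
  by field; rewrite gt_eqF.
by move=> x; rewrite /hyperplane /= dotvZl => ->.
Qed.

Lemma normalize_hyperplanes (hs : seq ('rV[R]_n * R)) P :
  {in hs, forall h, h.1 != 0} -> P `<=` \bigcup_(h in [set` hs]) hyperplane h ->
  exists2 hs' : seq ('rV[R]_n * R), {in hs', forall h : 'rV[R]_n * R, dotv h.1 h.1 = 1} &
    P `<=` \bigcup_(h in [set` hs']) hyperplane h.
Proof.
move=> h0 Ph.
have [hs' hs'1 hsub] : exists2 hs' : seq ('rV[R]_n * R), {in hs', forall h : 'rV[R]_n * R, dotv h.1 h.1 = 1} &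
    \bigcup_(h in [set` hs]) hyperplane h `<=` \bigcup_(h in [set` hs']) hyperplane h.
  elim: hs h0 {Ph} => [|h hs IH] h0.
    by exists [::] => // x [h].
  have [hs' hs'1 hsub] : exists2 hs' : seq ('rV[R]_n * R), {in hs', forall h : 'rV[R]_n * R, dotv h.1 h.1 = 1} &
      \bigcup_(h in [set` hs]) hyperplane h `<=` \bigcup_(h in [set` hs']) hyperplane h.
    by apply: IH => k kL; apply: h0; rewrite inE kL orbT.
  have [h' h'1 hh'] := hyperplane_normalize (h0 h (mem_head _ _)).
  exists (h' :: hs').
    by move=> k; rewrite inE => /orP[/eqP ->//|]; exact: hs'1.
  move=> x [k /=]; rewrite inE => /orP[/eqP ->|kL] hx.
    by exists h' => /=; [rewrite mem_head|exact: hh'].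
  have [|k' k's hx'] := hsub x; first by exists k.
  by exists k' => //=; rewrite inE; apply/orP; right.
by exists hs' => //; exact: subset_trans hsub.
Qed.

(** A point of an open hole P i is not in the closure of Omega.  Hence the boundary of
Omega is contained in the boundaries of P0 and of the holes, and a point interior
to the closure of Omega is in no closed hole, for otherwise a neighborhood of it
would meet P i. *)
Lemma generalized_polytope_regular Omega : generalized_polytope Omega ->
  exists r (hs : seq ('rV[R]_n * R)), [/\ open Omega, Omega `<=` cube r, interior (closure Omega) = Omega,
    {in hs, forall h : 'rV[R]_n * R, dotv h.1 h.1 = 1} &
    boundary Omega `<=` \bigcup_(h in [set` hs]) hyperplane h].
Proof.
move=> [P0 [M [P [[[bP0 oP0 iP0 [hs0 hs00 bd0]] pP] clP _ ->]]]].
set Omega' := _ `\` _.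
have oP i : open (P i) by have [] := pP i.
have iP i : interior (closure (P i)) = P i by have [] := pP i.
have clU : closed (\bigcup_i closure (P i)).
  apply: closed_bigcup => [|i _]; [exact: finite_finset|exact: closed_closure].
have oO : open Omega' by rewrite /Omega' setDE; apply: openI => //; exact: closed_openC.
have disj i x : P i x -> ~ closure Omega' x.
  move=> Pix clx; have [y [[_ ny] Py]] := clx (P i) (open_nbhs_nbhs (conj (oP i) Pix)).
  by apply: ny; exists i => //; exact: subset_closure.
have OP0 : Omega' `<=` P0 by move=> x [].
have iO : interior (closure Omega') = Omega'.
  apply/seteqP; split => [x ix|]; last first.
    by rewrite -open_subsetE//; exact: subset_closure.
  split.
    by rewrite -iP0; exact: (interiorS (closureS OP0)).
  move=> [i _ cix].
  have [y [Py iy]] := cix _ (open_nbhs_nbhs (conj (open_interior _) ix)).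
  exact: (disj i y Py (interior_subset iy)).
have [r Pr] := bounded_set_cube bP0.
have hsi i : {hs : seq ('rV[R]_n * R) | {in hs, forall h, h.1 != 0} /\
    boundary (P i) `<=` \bigcup_(h in [set` hs]) hyperplane h}.
  by apply: cid; have [_ _ _ [hs ? ?]] := pP i; exists hs.
pose hs := hs0 ++ flatten [seq sval (hsi i) | i <- enum 'I_M].
have hs_neq0 : {in hs, forall h, h.1 != 0}.
  move=> h; rewrite mem_cat => /orP[|/flatten_mapP[i _]]; first exact: hs00.
  by have [H _] := svalP (hsi i); exact: H.
have bd : boundary Omega' `<=` \bigcup_(h in [set` hs]) hyperplane h.
  move=> x [clx nix].
  have nOx : ~ Omega' x by rewrite (interior_id _).1 in nix.
  have clP0x : closure P0 x by exact: closureS clx.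
  have [P0x|nP0x] := pselect (P0 x); last first.
    have [|h hh hx] := bd0 x; first by split => //; rewrite (interior_id _).1.
    by exists h => //=; rewrite mem_cat; apply/orP; left.
  have [i _ cix] : (\bigcup_i closure (P i)) x by apply: contrapT => nx; exact: nOx.
  have nPix : ~ P i x by move=> Pix; exact: disj Pix clx.
  have [_ H] := svalP (hsi i).
  have [|h hh hx] := H x; first by split => //; rewrite (interior_id _).1.
  exists h => //=; rewrite mem_cat; apply/orP; right; apply/flatten_mapP.
  by exists i => //; rewrite mem_enum.
have [hs' hs'1 bd'] := normalize_hyperplanes hs_neq0 bd.
by exists r, hs'; split => //; exact: subset_trans Pr.
Qed.

End polytopes.

Section forms.
Context {R : realType} {n : nat}.
Variables (Omega : set 'rV[R]_n) (r : R).
Hypotheses (oO : open Omega) (Or : Omega `<=` cube r).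
Local Notation mu := (@lebesgue_rV R n).
Let mO := measurable_domain oO.
Let Ofin := domain_fin oO Or.

Lemma antisym_partial k (w : 'rV[R]_n -> components R n k) x j :
  C1_form Omega w -> Omega x ->
  antisym_components (fun I => partial j (fun y => w y I) x).
Proof.
move=> [aw Cw] Ox s I.
have df : differentiable (fun y => w y I) x by have [d _ _] := Cw I; exact: d.
transitivity (partial j (fun y => (-1) ^+ s * w y I) x).
  apply: near_eq_derive; near=> y.
  apply: aw; apply: subset_closure; near: y; exact: open_nbhs_nbhs.
rewrite /partial derive_mul// derive_cst mulr0 addr0 //.
Unshelve. all: by end_near. Qed.

Lemma sqL2_Rintegral (f : 'rV[R]_n -> R) : bounded_measurable Omega f ->
  sqL2 Omega f = (\int[mu]_(x in Omega) f x)%:E.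
Proof.
move=> bf; rewrite /sqL2 /Rintegral fineK//.
have bi := bounded_measurable_integrable (mu := mu) mO Ofin bf.
exact: (integrable_fin_num mO bi).
Qed.

Lemma bounded_measurable_sqnorm k (w : 'rV[R]_n -> components R n k) :
  (forall I, bounded_measurable Omega (fun x => w x I)) ->
  bounded_measurable Omega (fun x => sqnorm (w x)).
Proof.
move=> bw; apply: bounded_measurable_sum => I _.
exact: (bounded_measurableM (bw I) (bw I)).
Qed.

Lemma sqnorm_gradE k (w : 'rV[R]_n -> components R n k) x :
  sqnorm_grad w x = \sum_j sqnorm (fun I => partial j (fun y => w y I) x).
Proof. by rewrite /sqnorm_grad exchange_big. Qed.

End forms.

(** * The identity for forms *)

Section gaffney.
Context {R : realType} {n : nat}.
Variables (Omega : set 'rV[R]_n) (r : R) (hs : seq ('rV[R]_n * R)).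
Hypotheses (oO : open Omega) (Or : Omega `<=` cube r).
Hypothesis icO : interior (closure Omega) = Omega.
Hypothesis hs1 : {in hs, forall h, dotv h.1 h.1 = 1}.
Hypothesis bhs : boundary Omega `<=` \bigcup_(h in [set` hs]) hyperplane h.
Local Notation mu := (@lebesgue_rV R n).
Let mO := measurable_domain oO.
Let Ofin := domain_fin oO Or.

Section form.
Variables (k : nat) (w : 'rV[R]_n -> components R n k).
Hypothesis Cw : C1_form Omega w.

Let X x j I := partial j (fun y => w y I) x.

Let C1w I : C1_bounded Omega (fun x => w x I).
Proof. by apply: (C1_closure_C1_bounded oO Or); have [_] := Cw; apply. Qed.

Let bX j I : bounded_measurable Omega (fun x => X x j I).
Proof. by have [_ _ _] := C1w I; apply. Qed.

Lemma bounded_ext_deriv : bounded_measurable Omega (fun x => sqnorm (ext_deriv w x)).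
Proof.
apply: bounded_measurable_sqnorm => K; apply: bounded_measurable_sum => a _.
apply: bounded_measurableM; first exact: bounded_measurable_cst.
exact: bX.
Qed.

Lemma bounded_grad : bounded_measurable Omega (sqnorm_grad w).
Proof.
apply: bounded_measurable_sum => I _; apply: bounded_measurable_sum => j _.
exact: (bounded_measurableM (bX j I) (bX j I)).
Qed.

End form.

Lemma bounded_codiff k (w : 'rV[R]_n -> components R n k) : C1_form Omega w ->
  bounded_measurable Omega (fun x => sqnorm (codiff w x)).
Proof.
case: k w => [|k] w [_ Cw]; apply: bounded_measurable_sqnorm => J /=.
  exact: bounded_measurable_cst.
apply: bounded_measurable_sum => j _.
by have [_ _ _] := C1_closure_C1_bounded oO Or (Cw [tuple of j :: J]); apply.
Qed.

Lemma gaffney_reduction k (w : 'rV[R]_n -> components R n k) : C1_form Omega w ->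
  \int[mu]_(x in Omega) (sqnorm (ext_deriv w x) + sqnorm (codiff w x) - sqnorm_grad w x) = 0 ->
  sqL2 Omega (sqnorm_grad w) =
  (sqL2 Omega (fun x => sqnorm (ext_deriv w x)) +
   sqL2 Omega (fun x => sqnorm (codiff w x)))%E.
Proof.
move=> Cw; have bd := bounded_ext_deriv Cw; have bc := bounded_codiff Cw.
have bg := bounded_grad Cw.
rewrite RintegralB_bounded ?RintegralD_bounded//; last exact: bounded_measurableD.
move/eqP; rewrite subr_eq0 => /eqP h.
by rewrite !(sqL2_Rintegral oO Or)// -EFinD h.
Qed.

(** In degree 0 the identity holds pointwise. *)
Lemma gaffney0 (w : 'rV[R]_n -> components R n 0) : C1_form Omega w ->
  \int[mu]_(x in Omega) (sqnorm (ext_deriv w x) + sqnorm (codiff w x) - sqnorm_grad w x) = 0.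
Proof.
move=> Cw; rewrite (@eq_Rintegral_on _ _ _ mu Omega _ (fun=> 0)).
  by rewrite Rintegral_cst// mul0r.
move=> x Ox; rewrite sqnorm_gradE.
pose X x j I := partial j (fun y => w y I) x.
have aX j : antisym_components (X x j) := antisym_partial oO j Cw Ox.
have -> : sqnorm (codiff w x) = 0 by rewrite /sqnorm big1// => I _; rewrite expr0n.
rewrite addr0; apply/eqP; rewrite subr_eq0; apply/eqP.
have := sqnorm_all (antisym_jet_ext aX); rewrite mul1r => dE.
transitivity (\sum_(K : 1.-tuple 'I_n) jet_ext (X x) K ^+ 2); first exact: dE.
transitivity (\sum_j \sum_(I : 0.-tuple 'I_n) X x j I ^+ 2).
  rewrite -(sum_diag (X x) ord0); apply: eq_bigr => K _.
  by rewrite /jet_ext big_ord1 expr0 mul1r.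
by apply: eq_bigr => j _; rewrite -(sqnorm_all (aX j)) mul1r.
Qed.

Lemma gaffney_normal k (w : 'rV[R]_n -> components R n k.+1) : C1_N Omega k.+1 w ->
  \int[mu]_(x in Omega) (sqnorm (ext_deriv w x) + sqnorm (codiff w x) - sqnorm_grad w x) = 0.
Proof.
move=> [Cw nw].
pose u (J : k.-tuple 'I_n) (j : 'I_n) y := w y [tuple of j :: J].
have Cu J j : C1_bounded Omega (u J j).
  by apply: (C1_closure_C1_bounded oO Or); have [_] := Cw; apply.
pose L J x := \sum_i \sum_j bracket (basis_vec i) (basis_vec j) (u J i) (u J j) x.
have bL J : bounded_measurable Omega (L J).
  by do 2 (apply: bounded_measurable_sum => ? _); exact: C1_bounded_bracket.
have L0 J : \int[mu]_(x in Omega) L J x = 0.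
  apply: (Rintegral_brackets_polytope oO Or icO hs1 bhs (idx := id) (Cu J)).
  by move=> x nu /nw; exact.
rewrite (@eq_Rintegral_on _ _ _ mu Omega _ (fun x => k`!%:R^-1 * \sum_J L J x)).
  rewrite RintegralZ_bounded//; last exact: bounded_measurable_sum.
  by rewrite Rintegral_sum_bounded// big1 ?mulr0.
move=> x Ox; rewrite sqnorm_gradE.
exact: (gaffney_identity_dvg (fun j => antisym_partial oO j Cw Ox)).
Qed.

Lemma gaffney_tangential k (w : 'rV[R]_n -> components R n k.+1) : C1_T Omega k.+1 w ->
  \int[mu]_(x in Omega) (sqnorm (ext_deriv w x) + sqnorm (codiff w x) - sqnorm_grad w x) = 0.
Proof.
move=> [Cw tw].
have Cw' I : C1_bounded Omega (fun y => w y I).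
  by apply: (C1_closure_C1_bounded oO Or); have [_] := Cw; apply.
pose u (K : k.+2.-tuple 'I_n) (a : 'I_k.+2) y := (-1) ^+ a * w y (del_index a K).
have Cu K a : C1_bounded Omega (u K a) by exact: C1_boundedZ.
pose L K x := \sum_a \sum_b bracket (basis_vec (tnth K a)) (basis_vec (tnth K b)) (u K a) (u K b) x.
have bL K : bounded_measurable Omega (L K).
  by do 2 (apply: bounded_measurable_sum => ? _); exact: C1_bounded_bracket.
have L0 K : \int[mu]_(x in Omega) L K x = 0.
  apply: (Rintegral_brackets_polytope oO Or icO hs1 bhs (idx := tnth K) (Cu K)).
  move=> x nu /tw/(_ K) h; rewrite -[RHS]h; apply: eq_bigr => a _.
  by rewrite /u mulrA [_ * (-1) ^+ a]mulrC.
rewrite (@eq_Rintegral_on _ _ _ mu Omega _ (fun x => k.+2`!%:R^-1 * \sum_K L K x)).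
  rewrite RintegralZ_bounded//; last exact: bounded_measurable_sum.
  by rewrite Rintegral_sum_bounded// big1 ?mulr0.
move=> x Ox; rewrite sqnorm_gradE.
have Du K a j : 'D_(basis_vec j) (u K a) x = (-1) ^+ a * partial j (fun y => w y (del_index a K)) x.
  have dw : differentiable (fun y => w y (del_index a K)) x.
    by have [d _ _ _] := Cw' (del_index a K); exact: d.
  by rewrite derive_mul// derive_cst mulr0 addr0.
transitivity (k.+2`!%:R^-1 * \sum_(K : k.+2.-tuple 'I_n)
  \sum_(a < k.+2) \sum_(b < k.+2)
    ((-1) ^+ a * partial (tnth K a) (fun y => w y (del_index a K)) x *
       ((-1) ^+ b * partial (tnth K b) (fun y => w y (del_index b K)) x) -
     (-1) ^+ a * partial (tnth K b) (fun y => w y (del_index a K)) x *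
       ((-1) ^+ b * partial (tnth K a) (fun y => w y (del_index b K)) x))).
  exact: (gaffney_identity_ext (fun j => antisym_partial oO j Cw Ox)).
congr (_ * _); apply: eq_bigr => K _; apply: eq_bigr => a _; apply: eq_bigr => b _.
by rewrite /bracket !Du.
Qed.

End gaffney.

Unset Implicit Arguments.
Theorem theorem20 (R : realType) (n k : nat) (hk : (k <= n)%N)
    (Omega : set 'rV[R]_n) (hOmega : generalized_polytope Omega)
    (w : 'rV[R]_n -> components R n k)
    (hw : (C1_T Omega k `|` C1_N Omega k) w) :
  sqL2 Omega (sqnorm_grad w) =
  (sqL2 Omega (fun x => sqnorm (ext_deriv w x)) +
   sqL2 Omega (fun x => sqnorm (codiff w x)))%E.
Proof.
have [r [hs [oO Or icO hs1 bhs]]] := generalized_polytope_regular hOmega.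
have Cw : C1_form Omega w by case: hw => -[].
apply: (gaffney_reduction oO Or Cw).
case: k hk w hw Cw => [|k] _ w hw Cw; first exact: (gaffney0 oO).
case: hw => hw; first exact: (gaffney_tangential oO Or icO hs1 bhs).
exact: (gaffney_normal oO Or icO hs1 bhs).
Qed.
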